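(* Assume $\rho\neq0$, and let $t>0$. Let $\hat q=\hat q(u,x,\xi,\eta)$ be the solution to $$\partial_t \hat q=\tfrac12\partial_{xx}[\sigma^2\hat q]-\partial_x[(\mu-i\eta\sigma)\hat q]-\Big(\tfrac{\eta^2}{2}+ix\xi\Big)\hat q,\qquad \hat q(0,x,\xi,\eta)=\delta_{v_0}(x).$$ Then $$f_{Z_{J_{T_t}}}(z)=\frac{1}{(2\pi)^2|\rho|}\iiint \hat f_{T_t,B_j}(\xi,\eta)\,e^{\frac{i\eta z}{\rho}-\frac{(1-\rho^2)\eta^2j}{2\rho^2}}\Big(\int e^{i\xi y}f_{J_y}(j)\,dy\Big)\,d\xi\, d\eta\, dj,$$ where $$\hat f_{T_t,B_j}(\xi,\eta)=\begin{cases} e^{-\frac{(j-t)\eta^2}{2}}\displaystyle\int\hat q(t,x,\xi,\eta)\,dx,& t\leq j,\\[2mm] \displaystyle\frac{1}{2\pi}\iint\Big(\int\exp\big(\Phi(t,j,-\xi,x,y)+i\bar\xi y\big)dy\Big)\hat q(j,x,\bar\xi,\eta)\,d\bar\xi\, dx,& t\geq j.\end{cases}$$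
   Context: Setting. Let $(\Omega,\mathcal F,\mathbb F,\mathbb P)$ be a filtered probability space, with $\mathbb F=(\mathcal F_t)_{t\ge0}$ satisfying the usual conditions, carrying two independent Brownian motions $B$ and $W$ and an adapted non-decreasing Lévy process $J$ independent of $(B,W)$. For $\rho\in[-1,1]$ let $Z_t:=\rho B_t+\sqrt{1-\rho^2}\,W_t$. Let $\mu,\sigma:[0,\infty)\times\mathbb R\to\mathbb R$ be such that the SDE $$dv_t=\mu(t,v_t)dt+\sigma(t,v_t)dB_t,\quad v_0=1,\qquad dT_t=v_tdt,\quad T_0=0$$ has a unique strong solution, with $v$ nonnegative, $\mathbb E T_t=t$, and $T_t\to\infty$ a.s. as $t\to\infty$. Since $(v,T)$ is Markov, $\Phi$ denotes the complex-valued function with $\mathbb E[e^{i\xi T_t}\mid\mathcal F_s]=\exp(\Phi(t,s,\xi,v_s,T_s))$ for $s\le t$. In the PDE, $\mu=\mu(t,x)$, $\sigma=\sigma(t,x)$. The function $\hat q$ is the Fourier transform $\hat q(t,x,\xi,\eta)=\iint e^{-i\xi y-i\eta z}q(t,x,y,z)\,dy\,dz$ of the unique solution $q$ of the Fokker–Planck equation for $(v_t,T_t,B_t)$: $$\partial_tq=\tfrac12\partial_{xx}[\sigma^2q]+\partial_{xz}[\sigma q]+\tfrac12\partial_{zz}q-\partial_x[\mu q]-x\partial_yq,\qquad q(0,x,y,z)=\delta_{v_0}(x)\delta(y)\delta(z).$$ Conventions. $f_\xi$ denotes the (possibly generalized) probability density of a random variable or vector $\xi$, with joint densities written $f_{\xi,\eta}$;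 $\hat f_{T_t,B_j}(\xi,\eta)=\iint e^{-i\xi y-i\eta z}f_{T_t,B_j}(y,z)\,dy\,dz$. Unless limits are indicated, integrals are over the whole domain of the variable (in particular $j$ and $y$ as arguments of $f_{J_y}(j)$ range over $[0,\infty)$).
   Formalization: Φ is taken as a version with |exp Φ| ≤ 1 and exp Φ continuous in y (arbitrary a.e. versions make the t ≥ j formula false); q is the law of (v,T,B), q̂ the unique measure-valued solution, μ and σ are Borel, and divergent integrals are limits of Gaussian-cutoff integrals. *)

(* Defs.v *)
From HB Require Import structures.
From mathcomp Require Import all_boot all_order all_algebra.
From mathcomp Require Import all_classical all_reals all_analysis.
From mathcomp Require Import complex.
Import Order.TTheory GRing.Theory Num.Theory.
Import numFieldNormedType.Exports.

Set Implicit Arguments.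
Unset Strict Implicit.
Unset Printing Implicit Defensive.

Local Open Scope classical_set_scope.
Local Open Scope ring_scope.
Local Open Scope complex_scope.

(** * Complex-valued integrals, limits, measures *)

Section Complex.
Context {R : realType}.

Definition cexp (z : R[i]) : R[i] :=
  (expR (complex.Re z) * cos (complex.Im z))
    +i* (expR (complex.Re z) * sin (complex.Im z)).

Definition ccvg {U : Type} (G : set_system U) (f : U -> R[i]) (l : R[i]) : Prop :=
  (complex.Re (f x) @[x --> G] --> complex.Re l) /\
  (complex.Im (f x) @[x --> G] --> complex.Im l).

Definition cmeasurable {d} {X : measurableType d} (f : X -> R[i]) : Prop :=
  measurable_fun setT (fun x => complex.Re (f x)) /\
  measurable_fun setT (fun x => complex.Im (f x)).

Definition cint {d} {X : measurableType d} (m : {measure set X -> \bar R})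
    (D : set X) (f : X -> R[i]) : R[i] :=
  (\int[m]_(x in D) complex.Re (f x)) +i* (\int[m]_(x in D) complex.Im (f x)).

(* The complex measure [cm_dens x * cm_base dx]. By the polar decomposition
   every complex Borel measure on the line has this form. The representation
   is not unique: complex measures are compared with [cm_eq]. *)
Record cmeasure := CMeasure {
  cm_base : {finite_measure set R -> \bar R} ;
  cm_dens : R -> R[i] ;
  cm_int_Re : cm_base.-integrable setT (fun x => (complex.Re (cm_dens x))%:E) ;
  cm_int_Im : cm_base.-integrable setT (fun x => (complex.Im (cm_dens x))%:E)
}.

Definition cm_int (nu : cmeasure) (f : R -> R[i]) : R[i] :=
  cint (cm_base nu) setT (fun x => f x * cm_dens nu x).

Definition cm_val (nu : cmeasure) (A : set R) : R[i] :=
  cint (cm_base nu) A (cm_dens nu).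

Definition cm_eq (nu nu' : cmeasure) : Prop :=
  forall A, measurable A -> cm_val nu A = cm_val nu' A.

(* Integral of [f >= 0] against a measure equivalent, up to a factor of at most
   [sqrt 2], to the total variation of [nu]. *)
Definition cm_absint (nu : cmeasure) (D : set R) (f : R -> R) : \bar R :=
  (\int[cm_base nu]_(x in D)
     (f x * (`|complex.Re (cm_dens nu x)| + `|complex.Im (cm_dens nu x)|))%:E)%E.

End Complex.

(** * Generalized functions *)

Section Distributions.
Context {R : realType}.

Definition test_fun (phi : R -> R) : Prop :=
  (forall n x, derivable (derive1n n phi) x 1) /\
  (exists M, forall x, M < `|x| -> phi x = 0).

(* Cutoff giving a meaning to integrals that do not converge absolutely: an
   oscillatory integral is the limit, as [e] decreases to 0, of the absolutely
   convergent integral in which each non-absolutely convergent variable [x] is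
   weighted by [gauss e x]. In this sense
   [(2 pi)^-1 \int \int exp(i x y) g(y) dx dy = g(0)] for [g] bounded and
   continuous. *)
Definition gauss (e x : R) : R := expR (- (e * x ^+ 2 / 2)).

End Distributions.

(** * Processes; time is [0, +oo[ inside [R] *)

Section Processes.
Context {d : measure_display} {Omega : measurableType d} {R : realType}.
Variable P : probability Omega R.

Implicit Types (F : R -> set (set Omega)) (X Y v T : R -> {RV P >-> R}).

Definition usual_filtration F : Prop :=
  [/\ forall t, 0 <= t -> sigma_algebra setT (F t),
      forall t, 0 <= t -> F t `<=` d.-measurable,
      forall s t, 0 <= s -> s <= t -> F s `<=` F t,
      forall A, P.-negligible A -> F 0 A &
      forall t A, 0 <= t -> (forall u, t < u -> F u A) -> F t A].

Definition adapted F (X : R -> Omega -> R) : Prop :=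
  forall t A, 0 <= t -> measurable A -> F t (X t @^-1` A).

Definition continuous_paths (X : R -> Omega -> R) : Prop :=
  \forall w \ae P, {within `[0, +oo[, continuous (fun t => X t w)}.

Definition cadlag_paths (X : R -> Omega -> R) : Prop :=
  \forall w \ae P,
    (forall t, 0 <= t -> X u w @[u --> t^'+] --> X t w) /\
    (forall t, 0 < t -> cvg (X u w @[u --> t^'-])).

Definition indep_sigma (G H : set (set Omega)) : Prop :=
  forall A C, G A -> H C -> (P (A `&` C) = P A * P C)%E.

(* sigma-algebra generated by [X s], for [s] in [D] *)
Definition sigma_proc X (D : set R) : set (set Omega) :=
  <<s [set A | exists s C, [/\ D s, measurable C & A = X s @^-1` C]] >>.

Definition sigma_proc2 X Y (D : set R) : set (set Omega) :=
  <<s sigma_proc X D `|` sigma_proc Y D >>.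

(* natural filtration of [X] completed by the null sets *)
Definition natural_filtration X (t : R) : set (set Omega) :=
  [set A | exists2 C, sigma_proc X `[0, t] C &
             P.-negligible ((A `\` C) `|` (C `\` A))].

Definition indep_increments F X : Prop :=
  forall s t A C, 0 <= s -> s < t -> F s A -> measurable C ->
    (P (A `&` [set w | C (X t w - X s w)%R]) =
     P A * P [set w | C (X t w - X s w)%R])%E.

Definition brownian F X : Prop :=
  [/\ \forall w \ae P, X 0 w = 0,
      adapted F X,
      indep_increments F X,
      forall s t C, 0 <= s -> s < t -> measurable C ->
        P [set w | C (X t w - X s w)] = normal_prob 0 (Num.sqrt (t - s)) C &
      continuous_paths X].

(* Continuity in probability follows from stationarity and the paths being
   right-continuous at 0. *)
Definition levy F X : Prop :=
  [/\ \forall w \ae P, X 0 w = 0,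
      adapted F X,
      indep_increments F X,
      forall s t C, 0 <= s -> s < t -> measurable C ->
        P [set w | C (X t w - X s w)] = P [set w | C (X (t - s) w)] &
      cadlag_paths X].

Definition nondecreasing_paths X : Prop :=
  \forall w \ae P, forall s t, 0 <= s -> s <= t -> X s w <= X t w.

(** ** Itô integral *)

(* [H s = \sum_(k < n) h_k 1_{t_k < s <= t_(k+1)}] with [h_k] bounded and
   [F_(t_k)]-measurable *)
Record simple_process F := SimpleProcess {
  sp_n : nat ;
  sp_time : nat -> R ;
  sp_val : nat -> Omega -> R ;
  sp_time0 : 0 <= sp_time 0 ;
  sp_time_le : forall k, sp_time k <= sp_time k.+1 ;
  sp_bounded : exists M, forall k w, `|sp_val k w| <= M ;
  sp_adapted : forall k A, measurable A -> F (sp_time k) (sp_val k @^-1` A)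
}.

Definition sp_fun F (H : simple_process F) (s : R) (w : Omega) : R :=
  \sum_(k < sp_n H)
    (if (sp_time H k < s) && (s <= sp_time H k.+1) then sp_val H k w else 0).

Definition sp_integral F (H : simple_process F) (X : R -> Omega -> R)
    (t : R) (w : Omega) : R :=
  \sum_(k < sp_n H)
    sp_val H k w * (X (Num.min (sp_time H k.+1) t) w
                    - X (Num.min (sp_time H k) t) w).

Definition cvg0_in_probability (Y : nat -> Omega -> \bar R) : Prop :=
  forall a : R, 0 < a -> P [set w | (a%:E <= Y n w)%E] @[n --> \oo] --> 0%E.

(* [I_t = \int_0^t H_s dX_s] for a Brownian motion [X] *)
Definition ito_integral F X (H I : R -> Omega -> R) : Prop :=
  [/\ adapted F I, continuous_paths I &
   exists S : nat -> simple_process F, forall t, 0 <= t ->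
     cvg0_in_probability (fun n w =>
       (\int[lebesgue_measure]_(s in `[0%R, t])
           ((sp_fun (S n) s w - H s w) ^+ 2)%:E)%E) /\
     cvg0_in_probability (fun n w =>
       (`|sp_integral (S n) X t w - I t w|)%:E)].

(** ** The SDE *)

(* [dv = mu dt + sigma dB, v_0 = 1, dT = v dt, T_0 = 0], driven by [X]. The
   solution is strong: adapted to the completed filtration of [X]. *)
Definition strong_solution F X (mu sigma : R -> R -> R) v T : Prop :=
  [/\ adapted (natural_filtration X) v /\ adapted (natural_filtration X) T,
      continuous_paths v,
      \forall w \ae P, forall t, 0 <= t ->
        (\int[lebesgue_measure]_(s in `[0%R, t])
          (`|mu s (v s w)| + sigma s (v s w) ^+ 2)%:E < +oo)%E,
      exists2 I, ito_integral F X (fun s w => sigma s (v s w)) I &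
        \forall w \ae P, forall t, 0 <= t ->
          v t w = 1 + \int[lebesgue_measure]_(s in `[0, t]) mu s (v s w) + I t w &
      \forall w \ae P, forall t, 0 <= t ->
        T t w = \int[lebesgue_measure]_(s in `[0, t]) v s w].

Definition unique_strong_solution F X (mu sigma : R -> R -> R) v T : Prop :=
  strong_solution F X mu sigma v T /\
  forall v' T', strong_solution F X mu sigma v' T' ->
    \forall w \ae P, forall t, 0 <= t -> v' t w = v t w /\ T' t w = T t w.

(** ** Conditional characteristic exponent *)

Definition cond_exp (G : set (set Omega)) (Y E : Omega -> R) : Prop :=
  [/\ forall C, measurable C -> G (E @^-1` C),
      P.-integrable setT (fun w => (E w)%:E) &
      forall A, G A -> \int[P]_(w in A) E w = \int[P]_(w in A) Y w].

Definition ccond_exp (G : set (set Omega)) (Y E : Omega -> R[i]) : Prop :=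
  cond_exp G (fun w => complex.Re (Y w)) (fun w => complex.Re (E w)) /\
  cond_exp G (fun w => complex.Im (Y w)) (fun w => complex.Im (E w)).

(* [E[exp(i xi T_t) | F_s] = exp(Phi(t, s, xi, v_s, T_s))]. This determines
   [Phi] only almost everywhere for the law of [(v_s, T_s)], which may be
   singular in [y], while [exp Phi] is integrated against [dy]. As [T] enters
   the dynamics only additively, the transition function of [(v, T)] gives an
   [exp Phi] that is a characteristic function, hence of modulus at most 1, and
   continuous in [y]; the last two clauses select such versions. *)
Definition char_exponent F v T (Phi : R -> R -> R -> R -> R -> R[i]) : Prop :=
  forall s t xi, 0 <= s -> s <= t ->
  [/\ cmeasurable (fun p : R * R => cexp (Phi t s xi p.1 p.2)),
      ccond_exp (F s) (fun w => cexp (0 +i* (xi * T t w)))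
                      (fun w => cexp (Phi t s xi (v s w) (T s w))),
      forall x y, complex.Re (Phi t s xi x y) <= 0 &
      forall x, continuous (fun y => complex.Re (cexp (Phi t s xi x y))) /\
                continuous (fun y => complex.Im (cexp (Phi t s xi x y)))].

(** ** Generalized densities *)

(* The generalized density of a random vector is its law: [f_X(x) dx] stands
   for [distribution P X]. *)
Definition rv_pair (X Y : {RV P >-> R}) (w : Omega) : R * R := (X w, Y w).

Lemma measurable_rv_pair (X Y : {RV P >-> R}) :
  measurable_fun setT (rv_pair X Y).
Proof. by apply: measurable_fun_pair. Qed.

HB.instance Definition _ (X Y : {RV P >-> R}) :=
  isMeasurableFun.Build _ _ _ _ (rv_pair X Y) (measurable_rv_pair X Y).

Definition fhat (X Y : {RV P >-> R}) (xi eta : R) : R[i] :=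
  cint (distribution P (rv_pair X Y)) setT
       (fun p => cexp (0 +i* (- (xi * p.1) - eta * p.2))).

(* [f_X] equals, as a generalized function, the oscillatory integral with
   regularizations [g e] *)
Definition gdensity_eq (X : Omega -> R) (g : R -> R -> R[i]) : Prop :=
  forall phi, test_fun phi ->
    ccvg 0^'+ (fun e => cint lebesgue_measure setT (fun z => (phi z)%:C * g e z))
         (\int[P]_w phi (X w))%:C.

End Processes.

(** * Fokker-Planck equations, in the sense of distributions *)

Section FokkerPlanck.
Context {R : realType}.
Variables mu sigma : R -> R -> R.

(* A point [((x, y), z)] of the space is a value of [((v, T), B)]. Products
   [f x * g y * h z] span a dense subspace of the test functions of three
   variables, so they suffice to test the equation
     [\d_t q = 1/2 \d_xx (sigma^2 q) + \d_xz (sigma q) + 1/2 \d_zz q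
               - \d_x (mu q) - x \d_y q]
   with [q] at time 0 the Dirac mass at [(1, 0, 0)]. *)
Definition fp_adjoint (f g h : R -> R) (s : R) (p : R * R * R) : R :=
  let x := p.1.1 in let y := p.1.2 in let z := p.2 in
  sigma s x ^+ 2 / 2 * derive1n 2 f x * g y * h z
  + sigma s x * derive1 f x * g y * derive1 h z
  + f x * g y * derive1n 2 h z / 2
  + mu s x * derive1 f x * g y * h z
  + x * f x * derive1 g y * h z.

Definition fp_solution (q : R -> probability (R * R * R)%type R) : Prop :=
  (forall t k, 0 <= t ->
     (\int[lebesgue_measure]_(s in `[0%R, t])
       \int[q s]_(p in [set p | (`|p.1.1| <= k)%R])
         (`|mu s p.1.1| + sigma s p.1.1 ^+ 2)%:E < +oo)%E) /\
  (forall f g h t, test_fun f -> test_fun g -> test_fun h -> 0 <= t ->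
     \int[q t]_p (f p.1.1 * g p.1.2 * h p.2) =
     f 1 * g 0 * h 0 +
     \int[lebesgue_measure]_(s in `[0, t]) \int[q s]_p fp_adjoint f g h s p).

Definition fp_unique_solution (q : R -> probability (R * R * R)%type R) : Prop :=
  fp_solution q /\
  forall q', fp_solution q' ->
    forall t A, 0 <= t -> measurable A -> q' t A = q t A.

(* [q t] is the law of [(v_t, T_t, B_t)]. *)
Definition law_flow d (Omega : measurableType d) (P : probability Omega R)
    (v T B : R -> {RV P >-> R}) (q : R -> probability (R * R * R)%type R) : Prop :=
  forall t A, 0 <= t -> measurable A ->
    q t A = P [set w | A (v t w, T t w, B t w)].

(* At fixed [(xi, eta)]:
     [\d_t p = 1/2 \d_xx (sigma^2 p) - \d_x ((mu - i eta sigma) p)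
               - (eta^2 / 2 + i x xi) p],  with [p 0] the Dirac mass at 1. *)
Definition fphat_adjoint (xi eta : R) (f : R -> R) (s x : R) : R[i] :=
  (sigma s x ^+ 2 / 2 * derive1n 2 f x)%:C
  + (mu s x +i* (- (eta * sigma s x))) * (derive1 f x)%:C
  - ((eta ^+ 2 / 2) +i* (x * xi)) * (f x)%:C.

Definition fphat_solution (xi eta : R) (p : R -> cmeasure) : Prop :=
  [/\ forall t, exists C : R, forall s, 0 <= s -> s <= t ->
        (cm_absint (p s) setT (fun=> 1%R) <= C%:E)%E,
      forall t k, 0 <= t ->
        (\int[lebesgue_measure]_(s in `[0%R, t])
          cm_absint (p s) `[(- k)%R, k]
            (fun x => `|mu s x| + sigma s x ^+ 2)%R < +oo)%E &
      forall f t, test_fun f -> 0 <= t ->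
        cm_int (p t) (fun x => (f x)%:C) =
        (f 1)%:C +
        cint lebesgue_measure `[0, t]
          (fun s => cm_int (p s) (fphat_adjoint xi eta f s))].

(* [qhat t xi eta] is the complex measure [qhat(t, x, xi, eta) dx]. *)
Definition fphat_unique_solution (qhat : R -> R -> R -> cmeasure) : Prop :=
  forall xi eta,
    fphat_solution xi eta (fun t => qhat t xi eta) /\
    forall p, fphat_solution xi eta p ->
      forall t, 0 <= t -> cm_eq (p t) (qhat t xi eta).

End FokkerPlanck.

(** * Right-hand sides, regularized by [gauss] *)

Section Formulas.
Context {d : measure_display} {Omega : measurableType d} {R : realType}.
Variable P : probability Omega R.

(* [f_{J_y}(j) dy dj] is the measure [distribution P (J y) (dj) dy], whence the
   innermost position of the [j]-integral. *)
Definition density_rhs (rho : R) (T_t : {RV P >-> R}) (B J : R -> {RV P >-> R})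
    (e z : R) : R[i] :=
  (((2 * pi) ^+ 2 * `|rho|)^-1)%:C *
  cint lebesgue_measure setT (fun xi =>
  cint lebesgue_measure setT (fun eta =>
  cint lebesgue_measure `[0, +oo[ (fun y =>
    (gauss e xi * gauss e eta * gauss e y)%:C *
    cint (distribution P (J y)) `[0, +oo[ (fun j =>
      fhat T_t (B j) xi eta *
      cexp ((- ((1 - rho ^+ 2) * eta ^+ 2 * j / (2 * rho ^+ 2)))
              +i* (eta * z / rho)) *
      cexp (0 +i* (xi * y)))))).

Definition fhat_late_rhs (Phi : R -> R -> R -> R -> R -> R[i])
    (qhat : R -> R -> R -> cmeasure) (t j xi eta e : R) : R[i] :=
  ((2 * pi)^-1)%:C *
  cint lebesgue_measure setT (fun xib =>
    (gauss e xib)%:C *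
    cm_int (qhat j xib eta) (fun x =>
      cint lebesgue_measure setT (fun y =>
        (gauss e y)%:C * cexp (Phi t j (- xi) x y + (0 +i* (xib * y)))))).

End Formulas.

(* Main.v *)
(** The complex measures [A |-> E[exp (- i xi T_s - i eta B_s); v_s \in A]] solve
    the transformed Fokker-Planck equation: test the equation for the law of
    [(v, T, B)] with [f x * cos (xi y + a) * cos (eta z + b)], cut off by test
    functions. By uniqueness they are the [qhat s xi eta]. For [t <= j] the
    increment [B_j - B_t] is Gaussian and independent of [(T_t, B_t)]. For
    [j <= t] one conditions on the past up to [j] and inverts the Fourier
    transform in [T_j]: integrating [exp (i xib (y - T_j))] against the Gaussian
    cutoff gives an approximate identity at [y = T_j].

    For the density, the Gaussian factor turns the characteristic function of
    [(T_t, B_j)] into that of [(T_t, Z_j)] with [Z_j] built from both Brownian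
    motions. After Fubini, the [xi]- and [eta]-integrals become approximate
    identities at [y = T_t] and [z = Z_{J_y}], and the limit exists because
    [y |-> E phi (Z_{J_y})] is continuous at every [y > 0], [J] having no fixed
    jumps, while [T_t > 0] almost surely. *)
Require Import Defs.
From HB Require Import structures.
From mathcomp Require Import all_boot all_order all_algebra.
From mathcomp Require Import all_classical all_reals all_analysis.
From mathcomp Require Import complex.
From mathcomp Require Import finmap measurable_realfun.
From mathcomp Require Import ring lra.
Import Order.TTheory GRing.Theory Num.Theory.
Import numFieldNormedType.Exports.
Set Implicit Arguments.
Unset Strict Implicit.
Unset Printing Implicit Defensive.
Local Open Scope classical_set_scope.
Local Open Scope ring_scope.

(** * Integrals of bounded functions *)

(** The weight [gauss e x dx] is a constant times the normal law of standard deviation [1 / sqrt e].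
    In the inversion formulas every regularized Lebesgue integral therefore becomes an integral of a
    bounded function against a probability, where Fubini and dominated convergence are
    unconditional; the constants recombine with the factors [1 / (2 pi)] into normal densities whose
    variance is of order [e]. Two obstacles shape the rest. The processes are families of random
    variables with paths regular only almost surely, so Fubini in [(s, w)] and substitution of
    random times need jointly measurable versions; those of [J] and of [(B, W)] are kept measurable
    for the completed sigma-algebras of these processes, so that independence still applies. And
    [mu], [sigma] are controlled only through the local integrability clause of [fp_solution]: the
    terms of the transformed equation are integrable at almost every time only, whence integration
    lemmas that tolerate exceptional null sets without measurability. Independence moves [J] and
    [(B, W)] to two copies of [Omega], where [T_t] is a constant as far as [J] is concerned. *)

Section BoundedIntegrals.
Context {R : realType}.

Lemma bounded_integrable d (X : measurableType d)
    (m : {finite_measure set X -> \bar R}) (f : X -> R) (M : R) :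
  measurable_fun setT f -> (forall x, `|f x| <= M) ->
  m.-integrable setT (EFin \o f).
Proof.
move=> mf fM; apply: measurable_bounded_integrable => //.
  by rewrite ltey_eq fin_num_measure.
exists M; split; first exact: num_real.
by move=> N MN x _ /=; exact: le_trans (fM x) (ltW MN).
Qed.

Lemma dct d (X : measurableType d) (m : {measure set X -> \bar R})
    (f_ : nat -> X -> R) (f g : X -> R) :
  (forall n, measurable_fun setT (f_ n)) -> measurable_fun setT f ->
  (forall n x, `|f_ n x| <= g x) -> m.-integrable setT (EFin \o g) ->
  (\forall x \ae m, f_ n x @[n --> \oo] --> f x) ->
  \int[m]_x f_ n x @[n --> \oo] --> \int[m]_x f x.
Proof.
move=> mf_ mf fg ig fcv.
have mf_' n : measurable_fun setT (fun x => (f_ n x)%:E) by exact/measurable_EFinP.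
have mf' : measurable_fun setT (fun x => (f x)%:E) by exact/measurable_EFinP.
have H1 : {ae m, forall x, setT x -> (EFin \o f_ n) x @[n --> \oo] --> (EFin \o f) x}.
  apply: filterS fcv => x fx _; apply: cvg_EFin => //.
  exact: nearW.
have H2 : {ae m, forall x n, setT x -> (`|(EFin \o f_ n) x| <= (EFin \o g) x)%E}.
  by apply: aeW => x n _ /=; rewrite lee_fin.
have [iF _ cF] := dominated_convergence measurableT mf_' mf' H1 ig H2.
rewrite /Rintegral; apply: fine_cvg; rewrite fineK//.
exact: integrable_fin_num.
Qed.

Lemma bounded_dct d (X : measurableType d)
    (m : {finite_measure set X -> \bar R}) (f_ : nat -> X -> R) (f : X -> R) M :
  (forall n, measurable_fun setT (f_ n)) -> measurable_fun setT f ->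
  (forall n x, `|f_ n x| <= M) ->
  (\forall x \ae m, f_ n x @[n --> \oo] --> f x) ->
  \int[m]_x f_ n x @[n --> \oo] --> \int[m]_x f x.
Proof.
move=> mf_ mf fM fcv; apply: (@dct _ _ _ _ _ (fun=> M)) => //.
by apply: (@bounded_integrable _ _ _ _ `|M|).
Qed.

Lemma Rintegral_bounded d (X : measurableType d)
    (m : {finite_measure set X -> \bar R}) (f : X -> R) (M : R) :
  measurable_fun setT f -> (forall x, `|f x| <= M) ->
  `|\int[m]_x f x| <= M * fine (m setT).
Proof.
move=> mf fM; have iF := bounded_integrable m mf fM.
apply: (le_trans (le_normr_Rintegral _ iF)) => //.
rewrite -Rintegral_cst//; apply: le_Rintegral => //.
- exact: integrable_norm.
- by apply: (@bounded_integrable _ _ _ _ `|M|).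
Qed.

Lemma Rintegral_le_prob d (X : measurableType d) (m : probability X R)
    (f : X -> R) (M : R) :
  measurable_fun setT f -> (forall x, `|f x| <= M) -> `|\int[m]_x f x| <= M.
Proof.
move=> mf fM; have := Rintegral_bounded m mf fM.
have -> : fine (m setT) = 1 by rewrite /= (@probability_setT _ _ _ m).
by rewrite mulr1.
Qed.

Section Fubini.
Context d d' (X : measurableType d) (Y : measurableType d').
Variables (m1 : {finite_measure set X -> \bar R})
          (m2 : {finite_measure set Y -> \bar R}).

Lemma bounded_integrable_prod (f : X * Y -> R) (M : R) :
  measurable_fun setT f -> (forall p, `|f p| <= M) ->
  (m1 \x m2)%E.-integrable setT (EFin \o f).
Proof.
move=> mf fM; have mf' : measurable_fun setT (fun x => (f x)%:E) by exact/measurable_EFinP.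
apply: (@integrable12ltyP _ _ _ _ R m1 m2 _ mf').2.
apply: (@le_lt_trans _ _ (\int[m1]_x (M * fine (m2 setT))%:E)%E).
  apply: ge0_le_integral => //.
  - by move=> x _; apply: integral_ge0 => y _; exact: abse_ge0.
  - apply: (@measurable_fun_fubini_tonelli_F _ _ _ _ R m2 (fun p => `|(EFin \o f) p|%E)) => //=.
    by apply/measurable_EFinP; exact: measurableT_comp.
  - move=> x _; rewrite EFinM fineK ?fin_num_measure//.
    rewrite -integral_cst//; apply: ge0_le_integral => //.
    + apply: measurableT_comp => //; apply/measurable_EFinP.
      exact: measurableT_comp.
    + by move=> y _; rewrite /= lee_fin.
rewrite integral_cst//= lte_mul_pinfty// ?lee_fin ?ltey_eq ?fin_num_measure//.
rewrite mulr_ge0 ?fine_ge0//; exact: le_trans (normr_ge0 _) (fM point).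
Qed.

Lemma measurable_Rintegral_snd (f : X * Y -> R) (M : R) :
  measurable_fun setT f -> (forall p, `|f p| <= M) ->
  measurable_fun setT (fun x => \int[m2]_y f (x, y)).
Proof.
move=> mf fM; apply: (measurableT_comp (fine_measurable _)) => //.
exact: (measurable_fubini_F (bounded_integrable_prod mf fM)).
Qed.

Lemma Rintegral_prod (f : X * Y -> R) (M : R) :
  measurable_fun setT f -> (forall p, `|f p| <= M) ->
  \int[m1]_x \int[m2]_y f (x, y) = \int[(m1 \x m2)%E]_p f p.
Proof.
move=> mf fM; have iF := bounded_integrable_prod mf fM.
rewrite /Rintegral -(integral12_prod_meas1 iF); congr fine.
apply: eq_integral => x _; rewrite fineK//; apply: integrable_fin_num => //.
apply: (bounded_integrable m2 (f := fun y => f (x, y)) (M := M)) => //.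
exact: measurableT_comp.
Qed.

Lemma Rintegral_swap (f : X * Y -> R) (M : R) :
  measurable_fun setT f -> (forall p, `|f p| <= M) ->
  \int[m1]_x \int[m2]_y f (x, y) = \int[m2]_y \int[m1]_x f (x, y).
Proof.
move=> mf fM; have iF := bounded_integrable_prod mf fM.
rewrite (Rintegral_prod mf fM) /Rintegral -(integral21_prod_meas1 iF); congr fine.
apply: eq_integral => y _; rewrite fineK//; apply: integrable_fin_num => //.
apply: (bounded_integrable m1 (f := fun x => f (x, y)) (M := M)) => //.
exact: measurableT_comp.
Qed.

End Fubini.

Lemma Rintegral_distribution d d' (X : measurableType d) (Y : measurableType d')
    (P : probability X R) (V : {mfun X >-> Y}) (f : Y -> R) (M : R) :
  measurable_fun setT f -> (forall y, `|f y| <= M) ->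
  \int[distribution P V]_y f y = \int[P]_x f (V x).
Proof.
move=> mf fM; rewrite /Rintegral integral_distribution//.
  exact/measurable_EFinP.
apply: (bounded_integrable P (f := f \o V) (M := M)) => [|x]; last exact: fM.
exact: (measurableT_comp mf (measurable_funPT V)).
Qed.

End BoundedIntegrals.

(* Two densities [d1], [d2] with the same integrals over the preimages by [a],
   resp. [b], of every measurable set define the same image measure. *)
Section Transfer.
Import HBNNSimple.
Context {R : realType} dX dY dT (X : measurableType dX) (Y : measurableType dY)
  (T : measurableType dT).
Variables (m1 : {measure set X -> \bar R}) (m2 : {measure set Y -> \bar R}).
Variables (a : X -> T) (b : Y -> T) (d1 : X -> R) (d2 : Y -> R).
Hypotheses (ma : measurable_fun setT a) (mb : measurable_fun setT b).
Hypotheses (i1 : m1.-integrable setT (EFin \o d1))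
           (i2 : m2.-integrable setT (EFin \o d2)).
Hypothesis E : forall C, measurable C ->
  \int[m1]_(x in a @^-1` C) d1 x = \int[m2]_(y in b @^-1` C) d2 y.

Lemma Rintegral_sum d (U : measurableType d) (m : {measure set U -> \bar R})
    n (h : 'I_n -> U -> R) :
  (forall i, m.-integrable setT (EFin \o h i)) ->
  \int[m]_x (\sum_(i < n) h i x) = \sum_(i < n) \int[m]_x h i x.
Proof.
move=> ih; transitivity (fine (\sum_(i < n) (\int[m]_x h i x)%:E)); last by rewrite sumEFin.
rewrite {1}/Rintegral; under eq_integral do rewrite -sumEFin.
congr fine; rewrite integral_sum//; apply: eq_bigr => i _.
by rewrite /Rintegral fineK//; exact: (integrable_fin_num measurableT (ih i)).
Qed.

Lemma measurable_int_EFin d (U : measurableType d)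
    (m : {measure set U -> \bar R}) (f : U -> R) :
  m.-integrable setT (EFin \o f) -> measurable_fun setT f.
Proof. by move=> /measurable_int /measurable_EFinP. Qed.

Lemma integrable_bounded_mul d (U : measurableType d)
    (m : {measure set U -> \bar R}) (f g : U -> R) (M : R) :
  measurable_fun setT f -> (forall x, `|f x| <= M) ->
  m.-integrable setT (EFin \o g) ->
  m.-integrable setT (EFin \o (fun x => f x * g x)).
Proof.
move=> mf fM ig.
apply: (le_integrable measurableT _ _ (integrableZl measurableT M ig)).
  apply/measurable_EFinP; apply: measurable_funM => //.
  exact: measurable_int_EFin ig.
move=> x _ /=; rewrite lee_fin !normrM ler_wpM2r//.
exact: le_trans (fM x) (ler_norm _).
Qed.

(** A simple function is the finite sum of its values times the indicators of its level sets, so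
    both sides are finite sums of the integrals equated by [E]. *)
Lemma transfer_nnsfun (g : {nnsfun T >-> R}) :
  \int[m1]_x (g (a x) * d1 x) = \int[m2]_y (g (b y) * d2 y).
Proof.
have aux d (U : measurableType d) (m : {measure set U -> \bar R}) (c : U -> T)
    (h : U -> R) : measurable_fun setT c -> m.-integrable setT (EFin \o h) ->
    \int[m]_x (g (c x) * h x) =
    \sum_(i < #|` fset_set (range g)|)
      (fset_set (range g))`_i *
      \int[m]_(x in c @^-1` (g @^-1` [set (fset_set (range g))`_i])) h x.
  move=> mc ih.
  set s := fset_set _.
  have mA i : measurable (c @^-1` (g @^-1` [set s`_i])).
    by rewrite -[X in measurable X]setTI; apply: mc.
  have iA i : m.-integrable setT (EFin \o (h \_ (c @^-1` (g @^-1` [set s`_i])))).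
    have := (integrable_mkcond (EFin \o h) (mA i)).1 (integrableS measurableT (mA i) (@subsetT _ _) ih).
    by rewrite restrict_EFin.
  have -> : \int[m]_x (g (c x) * h x) = \int[m]_x \sum_(i < #|` s|)
      (s`_i * (h \_ (c @^-1` (g @^-1` [set s`_i])) x)).
    apply: eq_Rintegral => x _; rewrite fimfunEord mulr_suml.
    apply: eq_bigr => i _; rewrite -mulrA; congr (_ * _).
    rewrite indicE patchE; have -> : (x \in c @^-1` (g @^-1` [set s`_i])) = (c x \in g @^-1` [set s`_i]).
      by apply/idP/idP => /set_mem H; apply/mem_set; exact: H.
    by case: ifPn => _; rewrite ?mul1r ?mul0r.
  rewrite Rintegral_sum => [|i]; last first.
    exact: (integrableZl measurableT (s`_i) (iA i)).
  apply: eq_bigr => i _; rewrite RintegralZl//; congr (_ * _).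
  by rewrite [in RHS]Rintegral_mkcond.
rewrite !aux//; apply: eq_bigr => i _; congr (_ * _); exact: E.
Qed.

(** The densities are signed, so the simple approximations of [f] pass to the limit by domination
    with [M] times the modulus of the density, not by monotone convergence. *)
Lemma transfer_ge0 (f : T -> R) (M : R) : measurable_fun setT f ->
  (forall t, 0 <= f t <= M) ->
  \int[m1]_x (f (a x) * d1 x) = \int[m2]_y (f (b y) * d2 y).
Proof.
move=> mf fM.
have mf' : measurable_fun [set: T] (fun t => (f t)%:E) by exact/measurable_EFinP.
have f0' t : setT t -> (0 <= (f t)%:E)%E by rewrite lee_fin; case/andP: (fM t).
have [g [ndg cg]] := approximation measurableT mf' f0'.
have {}cg t : g n t @[n --> \oo] --> f t.
  by have /fine_cvg := cg t I.
have gf n t : 0 <= g n t <= M.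
  apply/andP; split => //.
  apply: le_trans (proj2 (andP (fM t))).
  have /nondecreasing_cvgn_le : nondecreasing_seq (g ^~ t).
    by move=> i j ij; have /lefP := ndg _ _ ij.
  move=> /(_ _ n); rewrite (cvg_lim _ (cg t))//; apply.
  exact: cg.
have aux d (U : measurableType d) (m : {measure set U -> \bar R}) (c : U -> T)
    (h : U -> R) : measurable_fun setT c -> m.-integrable setT (EFin \o h) ->
    \int[m]_x (g n (c x) * h x) @[n --> \oo] --> \int[m]_x (f (c x) * h x).
  move=> mc ih; have mh := measurable_int_EFin ih.
  apply: (@dct _ _ _ _ _ _ (fun x => M * `|h x|)).
  - move=> n; apply: measurable_funM => //; apply: measurableT_comp => //.
  - by apply: measurable_funM => //; exact: measurableT_comp.
  - move=> n x; rewrite normrM ler_wpM2r//.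
    by have /andP[g0 gM] := gf n (c x); rewrite ger0_norm.
  - exact: (integrableZl measurableT M (integrable_norm ih)).
  - by apply: aeW => x; apply: cvgM; [exact: (cg _)|exact: cvg_cst].
have h1 := aux _ _ _ _ _ ma i1; have h2 := aux _ _ _ _ _ mb i2.
rewrite -(cvg_lim _ h1)// -(cvg_lim _ h2)//; congr (lim (_ @ \oo)).
by apply/funext => n; exact: transfer_nnsfun.
Qed.

(** [f + M] is nonnegative, and the added constant contributes [M] times the total integrals of [d1]
    and [d2], which agree by [E] on the whole space. *)
Lemma transfer_bounded (f : T -> R) (M : R) : measurable_fun setT f ->
  (forall t, `|f t| <= M) ->
  \int[m1]_x (f (a x) * d1 x) = \int[m2]_y (f (b y) * d2 y).
Proof.
move=> mf fM.
have mfM : measurable_fun setT (fun t => f t + M) by exact: measurable_funD.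
have fM2 t : 0 <= f t + M <= M + M.
  by have := fM t; rewrite ler_norml => /andP[? ?]; lra.
have := transfer_ge0 mfM fM2.
have aux d (U : measurableType d) (m : {measure set U -> \bar R}) (c : U -> T)
    (h : U -> R) : measurable_fun setT c -> m.-integrable setT (EFin \o h) ->
    \int[m]_x ((f (c x) + M) * h x) = \int[m]_x (f (c x) * h x) + M * \int[m]_x h x.
  move=> mc ih; rewrite -RintegralZl// -RintegralD//.
  - by apply: eq_Rintegral => x _; rewrite mulrDl.
  - by apply: (@integrable_bounded_mul _ _ _ (f \o c) _ M) => //; [exact: measurableT_comp|move=> x; exact: fM].
  - exact: (integrableZl measurableT M ih).
rewrite !aux//.
have -> : \int[m1]_x d1 x = \int[m2]_x d2 x by have := E measurableT; rewrite !preimage_setT.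
exact: addIr.
Qed.

(** Truncation: [f] is set to 0 where [|f| > n]. This version serves the unbounded coefficients of
    the Fokker-Planck operator. *)
Lemma transfer (f : T -> R) : measurable_fun setT f ->
  m1.-integrable setT (EFin \o (fun x => f (a x) * d1 x)) ->
  m2.-integrable setT (EFin \o (fun y => f (b y) * d2 y)) ->
  \int[m1]_x (f (a x) * d1 x) = \int[m2]_y (f (b y) * d2 y).
Proof.
move=> mf if1 if2.
pose f_ (n : nat) t := if `|f t| <= n%:R then f t else 0.
have mf_ n : measurable_fun setT (f_ n).
  apply: measurable_fun_ifT => //.
  by apply: measurable_fun_ler => //; exact: measurableT_comp.
have cf_ t : f_ n t @[n --> \oo] --> f t.
  apply: cvg_near_cst; near=> n; rewrite /f_ ifT//.
  by near: n; exact: nbhs_infty_ger.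
have lef n t : `|f_ n t| <= `|f t| by rewrite /f_; case: ifP => // _; rewrite normr0.
have aux d (U : measurableType d) (m : {measure set U -> \bar R}) (c : U -> T)
    (h : U -> R) : measurable_fun setT c -> measurable_fun setT h ->
    m.-integrable setT (EFin \o (fun x => f (c x) * h x)) ->
    \int[m]_x (f_ n (c x) * h x) @[n --> \oo] --> \int[m]_x (f (c x) * h x).
  move=> mc mh ih.
  apply: (@dct _ _ _ _ _ _ (fun x => `|f (c x) * h x|)).
  - by move=> n; apply: measurable_funM => //; exact: measurableT_comp.
  - by apply: measurable_funM => //; exact: measurableT_comp.
  - by move=> n x; rewrite !normrM ler_wpM2r.
  - exact: integrable_norm.
  - by apply: aeW => x; apply: cvgM; [exact: cf_|exact: cvg_cst].
have h1 := aux _ _ _ _ _ ma (measurable_int_EFin i1) if1.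
have h2 := aux _ _ _ _ _ mb (measurable_int_EFin i2) if2.
rewrite -(cvg_lim _ h1)// -(cvg_lim _ h2)//; congr (lim (_ @ \oo)).
apply/funext => n; apply: (@transfer_bounded _ n%:R) => // t.
by rewrite /f_; case: ifP => //; rewrite normr0.
Unshelve. all: by end_near. Qed.

End Transfer.

(** * Gaussian integrals *)

Section Normal.
Context {R : realType}.
Notation mu := (@lebesgue_measure R).

(** On sets this is the definition of [normal_prob]; [transfer_bounded], with both maps the
    identity, passes from sets to bounded functions. *)
Lemma Rintegral_normal (m s : R) (f : R -> R) (M : R) :
  measurable_fun setT f -> (forall x, `|f x| <= M) ->
  \int[normal_prob m s]_x f x = \int[mu]_x (f x * normal_pdf m s x).
Proof.
move=> mf fM.
have := @transfer_bounded R _ _ _ _ _ _ (normal_prob m s) mu id id (fun=> 1) (normal_pdf m s)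
  (@measurable_id _ _ _) (@measurable_id _ _ _) _ (integrable_normal_pdf m s) _ f M mf fM.
move=> <- //.
- by apply: eq_Rintegral => x _; rewrite mulr1.
- by apply: (@bounded_integrable _ _ _ (normal_prob m s) (fun=> 1) 1) => // x; rewrite normr1.
- move=> C mC; rewrite !preimage_id Rintegral_cst// mul1r; reflexivity.
Qed.

Lemma normal_integrableM (m s : R) (f : R -> R) (M : R) :
  measurable_fun setT f -> (forall x, `|f x| <= M) ->
  mu.-integrable setT (EFin \o (fun x => f x * normal_pdf m s x)).
Proof.
by move=> mf fM; apply: (@integrable_bounded_mul R _ _ mu f (normal_pdf m s) M) => //; exact: integrable_normal_pdf.
Qed.

(** With [u = (x - a)^2 / (4 s^2)] the exponentials are [exp (- 2 u)] on the left and [exp (- u)] on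
    the right, and [|x - a| <= s (1 + u) <= s exp u], where the first inequality is
    [(|x - a| - 2 s)^2 >= 0]. First moments are thus dominated by a normal density, whose integral
    is known. *)
Lemma normal_pdf_moment (a s x : R) : 0 < s ->
  `|x - a| * normal_pdf a s x <= Num.sqrt 2 * s * normal_pdf a (Num.sqrt 2 * s) x.
Proof.
move=> s0; have s20 : 0 < Num.sqrt 2 :> R by rewrite sqrtr_gt0.
rewrite !normal_pdfE ?gt_eqF ?mulr_gt0// /normal_peak /normal_fun.
have E : (Num.sqrt 2 * s) ^+ 2 = 2 * s ^+ 2 by rewrite exprMn sqr_sqrtr.
rewrite E.
have -> : Num.sqrt (2 * s ^+ 2 * pi *+ 2) = Num.sqrt 2 * Num.sqrt (s ^+ 2 * pi *+ 2) :> R.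
  rewrite -sqrtrM ?ler0n//; congr Num.sqrt.
  by rewrite -mulrA [RHS]mulrnAr.
rewrite invfM mulrCA [leRHS](_ : _ = (Num.sqrt (s ^+ 2 * pi *+ 2))^-1 *
   (s * expR (- (x - a) ^+ 2 / (2 * s ^+ 2 *+ 2)))); last first.
  have : Num.sqrt (s ^+ 2 * pi *+ 2) != 0 by rewrite gt_eqF// sqrtr_gt0 mulrn_wgt0// mulr_gt0 ?pi_gt0// exprn_gt0.
  move: (Num.sqrt (s ^+ 2 * pi *+ 2)) (Num.sqrt 2) s20 => p r r0 p0.
  by field; rewrite p0 gt_eqF.
rewrite ler_wpM2l ?invr_ge0 ?sqrtr_ge0//.
set u := (x - a) ^+ 2 / (2 * s ^+ 2 *+ 2).
have u0 : 0 <= u by rewrite divr_ge0 ?sqr_ge0// mulrn_wge0// mulr_ge0// sqr_ge0.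
have -> : - (x - a) ^+ 2 / (s ^+ 2 *+ 2) = - u - u.
  by rewrite /u; field; rewrite gt_eqF.
have -> : - (x - a) ^+ 2 / (2 * s ^+ 2 *+ 2) = - u by rewrite /u mulNr.
rewrite expRD mulrA ler_wpM2r ?expR_ge0// expRN ler_pdivrMr ?expR_gt0//.
apply: (@le_trans _ _ (s * (1 + u))); last by rewrite ler_pM2l// expR_ge1Dx.
have -> : s * (1 + u) = s + `|x - a| ^+ 2 / (4 * s).
  by rewrite /u real_normK ?num_real//; field; rewrite gt_eqF.
set w := `|x - a|.
rewrite -subr_ge0 (_ : _ - w = (w - 2 * s) ^+ 2 / (4 * s)); last by field; rewrite gt_eqF.
by rewrite divr_ge0 ?sqr_ge0// mulr_ge0// ltW.
Qed.

Lemma normal_integrable_moment (a s : R) : 0 < s ->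
  mu.-integrable setT (EFin \o (fun x => `|x - a| * normal_pdf a s x)).
Proof.
move=> s0; apply: (le_integrable measurableT _ _
  (integrableZl measurableT (Num.sqrt 2 * s) (integrable_normal_pdf a (Num.sqrt 2 * s)))).
  apply/measurable_EFinP; apply: measurable_funM; last exact: measurable_normal_pdf.
  by apply: measurableT_comp => //; exact: measurable_funB.
move=> x _ /=; rewrite lee_fin ger0_norm ?mulr_ge0 ?normal_pdf_ge0//.
by rewrite (le_trans (normal_pdf_moment _ _ s0))// ler_norm.
Qed.

Lemma Rintegral_normal_pdf (m s : R) : \int[mu]_x normal_pdf m s x = 1.
Proof. by rewrite /Rintegral integral_normal_pdf. Qed.

(** The modulus [c + K |x - a|] covers two uses: a bounded function continuous at [a] (small [c],
    large [K]) and a Lipschitz function ([c = 0]). The constant [sqrt 2 * s] is the one of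
    [normal_pdf_moment]. *)
Lemma normal_approx (a s c K L M : R) (f : R -> R) : 0 < s -> 0 <= K ->
  measurable_fun setT f -> (forall x, `|f x| <= M) ->
  (forall x, `|f x - L| <= c + K * `|x - a|) ->
  `|\int[normal_prob a s]_x f x - L| <= c + K * (Num.sqrt 2 * s).
Proof.
move=> s0 K0 mf fM fL.
rewrite (Rintegral_normal a s mf fM).
have iL : mu.-integrable setT (EFin \o (fun x => L * normal_pdf a s x)).
  exact: (integrableZl measurableT L (integrable_normal_pdf a s)).
have ic : mu.-integrable setT (EFin \o (fun x => c * normal_pdf a s x)).
  exact: (integrableZl measurableT c (integrable_normal_pdf a s)).
have iK : mu.-integrable setT (EFin \o (fun x => K * (`|x - a| * normal_pdf a s x))).
  exact: (integrableZl measurableT K (normal_integrable_moment a s0)).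
have iK' : mu.-integrable setT (EFin \o (fun x => K * (Num.sqrt 2 * s) * normal_pdf a (Num.sqrt 2 * s) x)).
  exact: (integrableZl measurableT _ (integrable_normal_pdf a (Num.sqrt 2 * s))).
have if_ := normal_integrableM a s mf fM.
have -> : \int[mu]_x (f x * normal_pdf a s x) - L =
    \int[mu]_x (f x * normal_pdf a s x - L * normal_pdf a s x).
  rewrite RintegralB// RintegralZl//; last exact: integrable_normal_pdf.
  by rewrite Rintegral_normal_pdf mulr1.
apply: (le_trans (le_normr_Rintegral _ _)) => //.
  exact: (integrableB measurableT if_ iL).
apply: (@le_trans _ _ (\int[mu]_x (c * normal_pdf a s x + K * (Num.sqrt 2 * s) * normal_pdf a (Num.sqrt 2 * s) x))).
  apply: le_Rintegral => //.
  - by apply: integrable_norm; exact: (integrableB measurableT if_ iL).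
  - exact: (integrableD measurableT ic iK').
  - move=> x _; rewrite -mulrBl normrM (ger0_norm (normal_pdf_ge0 _ _ _)).
    apply: (le_trans (ler_wpM2r (normal_pdf_ge0 _ _ _) (fL x))).
    rewrite mulrDl lerD2l -mulrA -mulrA ler_wpM2l//.
    exact: normal_pdf_moment.
rewrite RintegralD// RintegralZl//; last exact: integrable_normal_pdf.
rewrite RintegralZl//; last exact: integrable_normal_pdf.
by rewrite !Rintegral_normal_pdf !mulr1.
Qed.

End Normal.

Section NormalFourier.
Context {R : realType}.
Notation mu := (@lebesgue_measure R).

Lemma is_derive_ext (f g : R -> R) (x df dg : R) :
  is_derive x 1 f df -> f =1 g -> df = dg -> is_derive x 1 g dg.
Proof. by move=> fd /funext <- <-. Qed.

Lemma is_derive1_derivable (f : R -> R) (x df : R) : is_derive x 1 f df -> derivable f x 1.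
Proof. by move=> fd; apply: ex_derive. Qed.

Lemma is_derive1_val (f : R -> R) (x df : R) : is_derive x 1 f df -> derive1 f x = df.
Proof. by move=> fd; rewrite derive1E derive_val. Qed.

Lemma is_derive1_continuous (f df : R -> R) : (forall x : R, is_derive x (1 : R) f (df x)) ->
  continuous f.
Proof.
move=> fd x; apply: differentiable_continuous; apply/derivable1_diffP.
exact: is_derive1_derivable.
Qed.

Lemma is_derive_affine (u w x : R) : is_derive x 1 (fun y => u * y + w) u.
Proof.
apply: (is_derive_ext (is_deriveD (is_deriveZ u (is_derive_id x 1)) (is_derive_cst w x 1))) => //.
by rewrite addr0 /GRing.scale/= mulr1.
Qed.

Lemma is_derive_cos_affine (u w x : R) :
  is_derive x 1 (fun y => cos (u * y + w)) (- sin (u * x + w) * u).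
Proof. exact: (is_derive1_comp (is_derive_cos _) (is_derive_affine u w x)). Qed.

Lemma is_derive_sin_affine (u w x : R) :
  is_derive x 1 (fun y => sin (u * y + w)) (cos (u * x + w) * u).
Proof. exact: (is_derive1_comp (is_derive_sin _) (is_derive_affine u w x)). Qed.

Lemma is_derive_expR_sqr (k x : R) :
  is_derive x 1 (fun y => expR (k * y ^+ 2)) (expR (k * x ^+ 2) * (2 * k * x)).
Proof.
apply: (is_derive_ext (is_derive1_comp (is_derive_expR _)
  (is_deriveZ k (is_deriveX 2 (is_derive_id x 1))))) => [y|].
  by rewrite /= exprfctE.
by rewrite /GRing.scale/= exprfctE; congr (_ * _); ring.
Qed.

Lemma is_derive_normal_pdf (s x : R) : s != 0 ->
  is_derive x 1 (normal_pdf 0 s) (- (x / s ^+ 2) * normal_pdf 0 s x).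
Proof.
move=> s0; rewrite normal_pdfE//.
have E y : - (y - 0) ^+ 2 / (s ^+ 2 *+ 2) = - (s ^+ 2 *+ 2)^-1 * y ^+ 2.
  by rewrite subr0 mulNr mulrC -mulNr.
apply: (is_derive_ext (is_deriveZ (normal_peak s) (is_derive_expR_sqr (- (s ^+ 2 *+ 2)^-1) x))).
  by move=> y; rewrite /normal_fun E.
rewrite /normal_fun E /GRing.scale/=.
move: (expR _) (normal_peak s) => u v.
by field.
Qed.

Lemma measurable_cos_affine (u w : R) : measurable_fun setT (fun y : R => cos (u * y + w)).
Proof.
by apply: continuous_measurable_fun; exact: is_derive1_continuous (is_derive_cos_affine u w).
Qed.

Lemma measurable_sin_affine (u w : R) : measurable_fun setT (fun y : R => sin (u * y + w)).
Proof.
by apply: continuous_measurable_fun; exact: is_derive1_continuous (is_derive_sin_affine u w).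
Qed.

Lemma normr_cos_le1 (x : R) : `|cos x| <= 1.
Proof. by rewrite ler_norml cos_le1 cos_geN1. Qed.

Lemma normr_sin_le1 (x : R) : `|sin x| <= 1.
Proof. by rewrite ler_norml sin_le1 sin_geN1. Qed.

Lemma normal_integrable_id_sin (s a c : R) : 0 < s ->
  mu.-integrable setT (EFin \o (fun x => x * sin (a * x + c) * normal_pdf 0 s x)).
Proof.
move=> s0; apply: (le_integrable measurableT _ _ (normal_integrable_moment 0 s0)).
  apply/measurable_EFinP; apply: measurable_funM; last exact: measurable_normal_pdf.
  by apply: measurable_funM => //; exact: measurable_sin_affine.
move=> x _ /=; rewrite lee_fin subr0 !normrM normr_id ler_wpM2r// ler_piMr//.
exact: normr_sin_le1.
Qed.

(** The derivative of [H]. That its integral vanishes is an integration by parts: for the centred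
    normal density [p], the integral of [x sin (a x + c) p] is [s^2 a] times that of
    [cos (a x + c) p]. *)
Let h (s a c x : R) := a * cos (a * x + c) * normal_pdf 0 s x
  - (s ^+ 2)^-1 * (x * sin (a * x + c) * normal_pdf 0 s x).

Let H (s a c x : R) := normal_pdf 0 s x * sin (a * x + c).

Let is_derive_H (s a c x : R) : 0 < s -> is_derive x 1 (H s a c) (h s a c x).
Proof.
move=> s0.
have s0' : s != 0 by rewrite gt_eqF.
apply: (is_derive_ext (is_deriveM (is_derive_normal_pdf x s0') (is_derive_sin_affine a c x))) => //.
by rewrite /h /GRing.scale/=; ring.
Qed.

Let continuous_h (s a c : R) : 0 < s -> continuous (h s a c).
Proof.
move=> s0 x.
have cp : {for x, continuous (normal_pdf 0 s)} by apply: continuous_normal_pdf; rewrite gt_eqF.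
have cc : {for x, continuous (fun y => cos (a * y + c))}.
  exact: is_derive1_continuous (is_derive_cos_affine a c) x.
have cs : {for x, continuous (fun y => sin (a * y + c))}.
  exact: is_derive1_continuous (is_derive_sin_affine a c) x.
apply: cvgB; first by apply: cvgM => //; apply: cvgM => //; exact: cvg_cst.
apply: cvgM; first exact: cvg_cst.
by apply: cvgM => //; apply: cvgM => //; exact: cvg_id.
Qed.

Let integrable_h (s a c : R) : 0 < s -> mu.-integrable setT (EFin \o h s a c).
Proof.
move=> s0.
have i1 : mu.-integrable setT (EFin \o (fun x => a * cos (a * x + c) * normal_pdf 0 s x)).
  apply: (@normal_integrableM _ 0 s _ `|a|).
    by apply: measurable_funM => //; exact: measurable_cos_affine.
  by move=> x; rewrite normrM ler_piMr// normr_cos_le1.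
have i2 := integrableZl measurableT (s ^+ 2)^-1 (normal_integrable_id_sin a c s0).
exact: (integrableB measurableT i1 i2).
Qed.

(** Makes the boundary terms of the integration by parts decay like [1 / |x|]. *)
Let H_bound (s a c x : R) : 0 < s ->
  `|x| * `|H s a c x| <= Num.sqrt 2 * s * normal_peak (Num.sqrt 2 * s).
Proof.
move=> s0; have s20 : 0 < Num.sqrt 2 :> R by rewrite sqrtr_gt0.
have := normal_pdf_moment 0 x s0; rewrite subr0 => xp.
rewrite /H normrM (ger0_norm (normal_pdf_ge0 _ _ _)) mulrA.
apply: le_trans (_ : `|x| * normal_pdf 0 s x <= _).
  by rewrite ler_piMr ?mulr_ge0 ?normal_pdf_ge0// normr_sin_le1.
apply: (le_trans xp); rewrite ler_pM2l ?mulr_gt0//.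
by apply: normal_pdf_ub; rewrite gt_eqF// mulr_gt0.
Qed.

Let integral_h (s a c : R) : 0 < s -> \int[mu]_x h s a c x = 0.
Proof.
move=> s0.
(* The successor keeps the interval nondegenerate already for [n = 0], as the fundamental theorem of
   calculus requires. *)
pose I (n : nat) : set R := [set` `[- n.+1%:R, n.+1%:R]].
have ih := integrable_h a c s0; have mh := measurable_int_EFin ih.
have cI : \int[mu]_x (h s a c \_ (I n)) x @[n --> \oo] --> \int[mu]_x h s a c x.
  apply: (@dct R _ _ mu (fun n => h s a c \_ (I n)) (h s a c) (fun x => `|h s a c x|)).
  - by move=> n; apply: ((measurable_restrictT (h s a c) _).1 (measurable_funTS mh)); exact: measurable_itv.
  - exact: mh.
  - by move=> n x; rewrite patchE; case: ifP => // _; rewrite normr0.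
  - exact: integrable_norm.
  - apply: aeW => x; apply: cvg_near_cst; near=> n.
    suff Ix : I n x by rewrite patchE mem_set.
    rewrite /I /= in_itv/= -ler_norml.
    rewrite (@le_trans _ _ n%:R)// ?ler_nat//; near: n; exact: nbhs_infty_ger.
rewrite -(cvg_lim _ cI)//.
have E n : \int[mu]_x (h s a c \_ (I n)) x = H s a c n.+1%:R - H s a c (- n.+1%:R).
  rewrite -Rintegral_mkcond /Rintegral (@continuous_FTC2 _ _ (H s a c))//.
  - by apply: gtrN; rewrite ltr0n.
  - by apply: continuous_subspaceT; exact: continuous_h.
  - have cH := is_derive1_continuous (fun x => is_derive_H a c x s0).
    split.
    + by move=> x _; exact: is_derive1_derivable (is_derive_H a c x s0).
    + by apply: cvg_at_right_filter; exact: cH.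
    + by apply: cvg_at_left_filter; exact: cH.
  - by move=> x _; exact: is_derive1_val (is_derive_H a c x s0).
under eq_fun do rewrite E.
pose C := Num.sqrt 2 * s * normal_peak (Num.sqrt 2 * s).
have HC n (x : R) : `|x| = n.+1%:R -> `|H s a c x| <= C * n.+1%:R^-1.
  move=> xn; have := H_bound a c x s0; rewrite xn mulrC => HCx.
  by rewrite ler_pdivlMr.
apply: (@cvg_lim _ _ _ \oo) => //.
apply/cvgr0Pnorm_le => e e0.
have cC : C * 2 * n.+1%:R^-1 @[n --> \oo] --> 0.
  rewrite -[X in _ --> X](mulr0 (C * 2)); apply: cvgM; first exact: cvg_cst.
  exact: cvg_harmonic.
near=> n.
apply: (le_trans (ler_normB _ _)).
apply: (@le_trans _ _ (C * 2 * n.+1%:R^-1)).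
  rewrite (_ : C * 2 * _ = C * n.+1%:R^-1 + C * n.+1%:R^-1); last by ring.
  by apply: lerD; apply: HC; rewrite ?normrN ger0_norm.
apply: le_trans (ler_norm _) _; near: n.
exact: (cvgr0_norm_le _ cC).
Unshelve. all: by end_near. Qed.

Let G (s c a : R) := \int[mu]_x (cos (a * x + c) * normal_pdf 0 s x).

(** Differentiation under the integral, dominated by [|x|] times the density, gives minus the
    integral of [x sin (a x + c)]; [integral_h] converts it into a multiple of [G] itself. *)
Let is_derive_G (s c a : R) : 0 < s ->
  is_derive a 1 (G s c) (- (s ^+ 2 * a) * G s c a).
Proof.
move=> s0.
pose f (b x : R) := cos (b * x + c) * normal_pdf 0 s x.
have df (b x : R) : is_derive b (1 : R) (f ^~ x) (- (x * sin (b * x + c) * normal_pdf 0 s x)).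
  have d1 := is_deriveZ (normal_pdf 0 s x) (is_derive_cos_affine x c b).
  apply: (is_derive_ext d1) => [y|]; rewrite /f /GRing.scale/=.
    by rewrite [LHS]mulrC (mulrC x y).
  by rewrite (mulrC x b); ring.
have i1 b : mu.-integrable setT (EFin \o f b).
  apply: (@normal_integrableM _ 0 s _ 1); first exact: measurable_cos_affine.
  by move=> x; rewrite normr_cos_le1.
have Ia : [set` `](a - 1), (a + 1)[] a by rewrite /= in_itv/= ltrBlDr ltrDl ltr01.
have dG : derivable (G s c) a 1 /\ derive1 (G s c) a = \int[mu]_x (partial1of2 f a x).
  have bnd x y : [set` `](a - 1), (a + 1)[] x -> setT y ->
     `|partial1of2 f x y| <= `|y - 0| * normal_pdf 0 s y.
    move=> _ _; rewrite /partial1of2 (is_derive1_val (df x y)) normrN !normrM subr0.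
    rewrite (ger0_norm (normal_pdf_ge0 _ _ _)) ler_wpM2r ?normal_pdf_ge0// ler_piMr//.
    exact: normr_sin_le1.
  have g0 y : 0 <= `|y - 0| * normal_pdf 0 s y by rewrite mulr_ge0// normal_pdf_ge0.
  have ig := normal_integrable_moment 0 s0.
  have df' x y : [set` `](a - 1), (a + 1)[] x -> setT y -> derivable (f ^~ y) x 1.
    by move=> _ _; exact: is_derive1_derivable (df x y).
  split.
    exact: (derivable_under_integral measurableT Ia (fun x _ => i1 x) df' g0 ig bnd).
  exact: (differentiation_under_integral measurableT Ia (fun x _ => i1 x) df' g0 ig bnd).
case: dG => dG1 dG2.
have -> : - (s ^+ 2 * a) * G s c a = derive1 (G s c) a.
  rewrite dG2.
  have -> : \int[mu]_x partial1of2 f a x = \int[mu]_x ((-1) * (x * sin (a * x + c) * normal_pdf 0 s x)).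
    by apply: eq_Rintegral => x _; rewrite /partial1of2 (is_derive1_val (df a x)) mulN1r.
  have is_ := normal_integrable_id_sin a c s0.
  rewrite RintegralZl//.
  have := integral_h a c s0; rewrite /h.
  have i2 : mu.-integrable setT (EFin \o (fun x => a * (cos (a * x + c) * normal_pdf 0 s x))).
    exact: (integrableZl measurableT a (i1 a)).
  have i3 : mu.-integrable setT (EFin \o (fun x => (s ^+ 2)^-1 * (x * sin (a * x + c) * normal_pdf 0 s x))).
    exact: (integrableZl measurableT _ is_).
  under eq_Rintegral do rewrite -(mulrA a).
  rewrite RintegralB// RintegralZl//; last exact: (i1 a).
  rewrite RintegralZl// -/(G s c a) => /eqP.
  rewrite subr_eq0 => /eqP E.
  have s20 : s ^+ 2 != 0 by rewrite expf_neq0// gt_eqF.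
  by rewrite mulN1r mulNr -mulrA E mulrA divff// mul1r.
by rewrite derive1E; apply: DeriveDef.
Qed.

(** By [is_derive_G] the transform solves [G' = - s^2 a G], so its product with the integrating
    factor [exp (s^2 a^2 / 2)] is constant in [a]. The phase [c] delivers the cosine and the sine
    transform together. *)
Lemma normal_fourier (s a c : R) : 0 < s ->
  \int[normal_prob 0 s]_x cos (a * x + c) = cos c * expR (- (s ^+ 2 * a ^+ 2 / 2)).
Proof.
move=> s0.
rewrite (@Rintegral_normal _ 0 s (fun x => cos (a * x + c)) 1); last 2 first.
- exact: measurable_cos_affine.
- by move=> x; rewrite normr_cos_le1.
rewrite -/(G s c a).
pose D b := G s c b * expR (s ^+ 2 / 2 * b ^+ 2).
have dD (b : R) : is_derive b (1 : R) D 0.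
  apply: (is_derive_ext (is_deriveM (is_derive_G c b s0) (is_derive_expR_sqr (s ^+ 2 / 2) b))) => //.
  by rewrite /GRing.scale/=; field.
have := is_derive_0_is_cst a 0 dD.
rewrite /D expr0n/= mulr0 expR0 mulr1.
have -> : G s c 0 = cos c.
  rewrite /G; under eq_Rintegral do rewrite mul0r add0r.
  by rewrite RintegralZl ?Rintegral_normal_pdf ?mulr1//; exact: integrable_normal_pdf.
move=> Ec; rewrite -Ec -[RHS]mulrA -expRD.
by rewrite (_ : _ + _ = 0) ?expR0 ?mulr1//; field.
Qed.

End NormalFourier.
Local Open Scope complex_scope.

(** * Complex-valued integrals *)

Section ComplexIntegrals.
Context {R : realType}.
Implicit Types z w : R[i].

Lemma complexE z w : complex.Re z = complex.Re w -> complex.Im z = complex.Im w -> z = w.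
Proof. by case: z w => [a b] [c d] /= -> ->. Qed.

Lemma ReM z w : complex.Re (z * w) =
  complex.Re z * complex.Re w - complex.Im z * complex.Im w.
Proof. by case: z w => [a b] [c d]. Qed.

Lemma ImM z w : complex.Im (z * w) =
  complex.Re z * complex.Im w + complex.Im z * complex.Re w.
Proof. by case: z w => [a b] [c d]. Qed.

Lemma ReD z w : complex.Re (z + w) = complex.Re z + complex.Re w.
Proof. by case: z w => [a b] [c d]. Qed.

Lemma ImD z w : complex.Im (z + w) = complex.Im z + complex.Im w.
Proof. by case: z w => [a b] [c d]. Qed.

Lemma cexpD z w : cexp (z + w) = cexp z * cexp w.
Proof.
apply: complexE; rewrite ?ReM ?ImM /cexp /= ReD ImD expRD ?cosD ?sinD.
  by ring.
by ring.
Qed.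

(** Locked so that simplification does not open it: phases are handled through [expiD], [Re_expi]
    and [Im_expi] only. *)
Definition expi (x : R) : R[i] := locked (fun y => cexp (0 +i* y)) x.

Lemma expiE x : expi x = cexp (0 +i* x).
Proof. by rewrite /expi -lock. Qed.

Lemma Re_expi x : complex.Re (expi x) = cos x.
Proof. by rewrite expiE /cexp /= expR0 mul1r. Qed.

Lemma Im_expi x : complex.Im (expi x) = sin x.
Proof. by rewrite expiE /cexp /= expR0 mul1r. Qed.

Lemma expiD x y : expi (x + y) = expi x * expi y.
Proof. by rewrite !expiE -cexpD; congr cexp; apply: complexE; rewrite ?ReD ?ImD/= ?addr0. Qed.

Lemma expi0 : expi 0 = 1.
Proof. by apply: complexE; rewrite ?Re_expi ?Im_expi ?cos0 ?sin0. Qed.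

Lemma cexp_real_expi (a b : R) : cexp (a +i* b) = (expR a)%:C * expi b.
Proof.
apply: complexE.
  by rewrite ReM Re_expi Im_expi /cexp [in RHS]/= mul0r subr0.
by rewrite ImM Re_expi Im_expi /cexp [in RHS]/= mul0r addr0.
Qed.

(** The class in which the Fourier integrals are manipulated: stable under products, composition and
    partial integration, and integrable for every finite measure. Bounds are put on the real and
    imaginary parts because [cint] is computed part by part. *)
Definition cbmeas d (X : measurableType d) (f : X -> R[i]) : Prop :=
  cmeasurable f /\
  exists M, forall x, `|complex.Re (f x)| <= M /\ `|complex.Im (f x)| <= M.

Section Closure.
Context d (X : measurableType d).
Implicit Types f g : X -> R[i].

Lemma cbmeas_real (f : X -> R) M : measurable_fun setT f ->
  (forall x, `|f x| <= M) -> cbmeas (fun x => (f x)%:C).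
Proof.
move=> mf fM; split; first by split => //=; exact: measurable_cst.
exists M => x; rewrite /= normr0; split => //; exact: le_trans (normr_ge0 _) (fM x).
Qed.

Lemma cbmeas_indic (A : set X) : measurable A -> cbmeas (fun x => (\1_A x : R)%:C).
Proof.
move=> mA; apply: (@cbmeas_real _ 1) => [|x]; first exact: measurable_indic.
by rewrite indicE; case: (_ \in _); rewrite ?normr1 ?normr0.
Qed.

Lemma cbmeas_cst (c : R[i]) : cbmeas (fun _ : X => c).
Proof.
split; first by split => //=; exact: measurable_cst.
exists (Num.max `|complex.Re c| `|complex.Im c|) => x.
by rewrite !le_max !lexx orbT.
Qed.

Lemma cbmeasM f g : cbmeas f -> cbmeas g -> cbmeas (fun x => f x * g x).
Proof.
move=> [[mf1 mf2] [M fM]] [[mg1 mg2] [N gN]]; split.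
  split.
    under eq_fun do rewrite ReM.
    by apply: measurable_funB; exact: measurable_funM.
  under eq_fun do rewrite ImM.
  by apply: measurable_funD; exact: measurable_funM.
exists (M * N + M * N) => x; rewrite ReM ImM.
have [f1 f2] := fM x; have [g1 g2] := gN x.
split; first by apply: (le_trans (ler_normB _ _)); rewrite !normrM; apply: lerD; exact: ler_pM.
by apply: (le_trans (ler_normD _ _)); rewrite !normrM; apply: lerD; exact: ler_pM.
Qed.

Lemma cbmeas_expi (f : X -> R) : measurable_fun setT f -> cbmeas (fun x => expi (f x)).
Proof.
move=> mf; split.
  split.
    under eq_fun do rewrite Re_expi.
    by apply: measurableT_comp => //; apply: continuous_measurable_fun; exact: continuous_cos.
  under eq_fun do rewrite Im_expi.
  by apply: measurableT_comp => //; apply: continuous_measurable_fun; exact: continuous_sin.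
by exists 1 => x; rewrite Re_expi Im_expi; split; [exact: normr_cos_le1|exact: normr_sin_le1].
Qed.

Lemma cbmeas_comp d' (Y : measurableType d') (h : Y -> X) f :
  measurable_fun setT h -> cbmeas f -> cbmeas (f \o h).
Proof.
move=> mh [[mf1 mf2] [M fM]]; split; last by exists M => y; exact: fM.
split.
  exact: (measurableT_comp mf1 mh).
exact: (measurableT_comp mf2 mh).
Qed.

Lemma cbmeas_Re f : cbmeas f -> exists2 M, measurable_fun setT (fun x => complex.Re (f x)) &
  forall x, `|complex.Re (f x)| <= M.
Proof. by move=> [[m1 m2] [M fM]]; exists M => // x; have [] := fM x. Qed.

Lemma cbmeas_Im f : cbmeas f -> exists2 M, measurable_fun setT (fun x => complex.Im (f x)) &
  forall x, `|complex.Im (f x)| <= M.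
Proof. by move=> [[m1 m2] [M fM]]; exists M => // x; have [] := fM x. Qed.

End Closure.

Lemma eq_cint d (X : measurableType d) (m : {measure set X -> \bar R}) D (f g : X -> R[i]) :
  (forall x, D x -> f x = g x) -> cint m D f = cint m D g.
Proof.
move=> fg; apply: complexE => /=; apply: eq_Rintegral => x; by move=> /set_mem Dx; rewrite fg.
Qed.

Lemma cint_mkcond d (X : measurableType d) (m : {measure set X -> \bar R}) D (f : X -> R[i]) :
  cint m D f = cint m setT (fun x => (\1_D x)%:C * f x).
Proof.
by apply: complexE => /=; rewrite Rintegral_mkcond; apply: eq_Rintegral => x _;
  rewrite ?ReM ?ImM patchE indicE /=; case: ifP => _;
  rewrite ?mul1r ?mul0r ?subr0 ?addr0.
Qed.

Lemma cintZl d (X : measurableType d) (m : {finite_measure set X -> \bar R})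
    (c : R[i]) (f : X -> R[i]) : cbmeas f ->
  cint m setT (fun x => c * f x) = c * cint m setT f.
Proof.
move=> [[mf1 mf2] [M fM]].
have i1 : m.-integrable setT (EFin \o (fun x => complex.Re (f x))).
  by apply: (@bounded_integrable _ _ _ _ _ M) => // x; case: (fM x).
have i2 : m.-integrable setT (EFin \o (fun x => complex.Im (f x))).
  by apply: (@bounded_integrable _ _ _ _ _ M) => // x; case: (fM x).
apply: complexE; rewrite ?ReM ?ImM /=.
  under eq_Rintegral do rewrite ReM.
  rewrite RintegralB ?RintegralZl//; first exact: (integrableZl measurableT _ i1).
  exact: (integrableZl measurableT _ i2).
under eq_Rintegral do rewrite ImM.
rewrite RintegralD ?RintegralZl//; first exact: (integrableZl measurableT _ i2).
exact: (integrableZl measurableT _ i1).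
Qed.

Lemma cintZr d (X : measurableType d) (m : {finite_measure set X -> \bar R})
    (c : R[i]) (f : X -> R[i]) : cbmeas f ->
  cint m setT (fun x => f x * c) = cint m setT f * c.
Proof.
by move=> bf; rewrite mulrC -cintZl//; apply: eq_cint => x _; rewrite mulrC.
Qed.

Lemma cint_swap d d' (X : measurableType d) (Y : measurableType d')
    (m1 : {finite_measure set X -> \bar R}) (m2 : {finite_measure set Y -> \bar R})
    (f : X * Y -> R[i]) : cbmeas f ->
  cint m1 setT (fun x => cint m2 setT (fun y => f (x, y))) =
  cint m2 setT (fun y => cint m1 setT (fun x => f (x, y))).
Proof.
move=> [[mf1 mf2] [M fM]]; apply: complexE => /=.
  by rewrite (Rintegral_swap m1 m2 mf1 (M := M))// => p; case: (fM p).
by rewrite (Rintegral_swap m1 m2 mf2 (M := M))// => p; case: (fM p).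
Qed.

Lemma cbmeas_cint d d' (X : measurableType d) (Y : measurableType d')
    (m2 : probability Y R) (f : X * Y -> R[i]) : cbmeas f ->
  cbmeas (fun x => cint m2 setT (fun y => f (x, y))).
Proof.
move=> [[mf1 mf2] [M fM]]; split; last first.
  exists M => x; split => /=; apply: Rintegral_le_prob.
  - exact: (measurableT_comp mf1 (pair1_measurable x)).
  - by move=> y; case: (fM (x, y)).
  - exact: (measurableT_comp mf2 (pair1_measurable x)).
  - by move=> y; case: (fM (x, y)).
split.
  (* Measurability of the partial integral is obtained from integrability on a product, which calls
     for some finite measure on [X]; a Dirac mass exists on any [X]. *)
  apply: (@measurable_Rintegral_snd R _ _ X Y (@dirac _ X point R) m2 _ M mf1) => p.
  by case: (fM p).
apply: (@measurable_Rintegral_snd R _ _ X Y (@dirac _ X point R) m2 _ M mf2) => p.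
by case: (fM p).
Qed.

Lemma cint_dct d (X : measurableType d) (m : {finite_measure set X -> \bar R})
    (f_ : nat -> X -> R[i]) (f : X -> R[i]) M :
  (forall n, cmeasurable (f_ n)) -> cmeasurable f ->
  (forall n x, `|complex.Re (f_ n x)| <= M /\ `|complex.Im (f_ n x)| <= M) ->
  (\forall x \ae m, ccvg \oo (f_ ^~ x) (f x)) ->
  ccvg \oo (fun n => cint m setT (f_ n)) (cint m setT f).
Proof.
move=> mf_ [mf1 mf2] fM fcv; split.
  apply: (@bounded_dct _ _ _ _ _ _ M) => //.
  - by move=> n; case: (mf_ n).
  - by move=> n x; case: (fM n x).
  - by apply: filterS fcv => x [].
apply: (@bounded_dct _ _ _ _ _ _ M) => //.
- by move=> n; case: (mf_ n).
- by move=> n x; case: (fM n x).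
- by apply: filterS fcv => x [].
Qed.

Lemma cint_distribution d d' (X : measurableType d) (Y : measurableType d')
    (P : probability X R) (V : {mfun X >-> Y}) (f : Y -> R[i]) : cbmeas f ->
  cint (distribution P V) setT f = cint P setT (fun x => f (V x)).
Proof.
move=> [[mf1 mf2] [M fM]]; apply: complexE => /=.
  by rewrite (Rintegral_distribution P V mf1 (M := M))// => p; case: (fM p).
by rewrite (Rintegral_distribution P V mf2 (M := M))// => p; case: (fM p).
Qed.

Lemma cint_real d (X : measurableType d) (m : {measure set X -> \bar R}) (f : X -> R) :
  cint m setT (fun x => (f x)%:C) = (\int[m]_x f x)%:C.
Proof.
apply: complexE => //=; rewrite /Rintegral.
by under eq_integral do rewrite /=; rewrite integral0.
Qed.

End ComplexIntegrals.

(** * Gaussian cutoffs as multiples of normal laws *)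

Section GaussianWeights.
Context {R : realType}.
Notation mu := (@lebesgue_measure R).

(** The total integral [sqrt (2 pi / e)] of [gauss e], written as the inverse of the peak of the
    normal density of standard deviation [1 / sqrt e]. *)
Definition gauss_mass (e : R) : R := (normal_peak (Num.sqrt e)^-1)^-1.

Lemma gaussE (e x : R) : 0 < e ->
  gauss e x = gauss_mass e * normal_pdf 0 (Num.sqrt e)^-1 x.
Proof.
move=> e0; have s0 : Num.sqrt e != 0 by rewrite gt_eqF// sqrtr_gt0.
rewrite normal_pdfE ?invr_neq0// /gauss_mass mulrA mulVf ?mul1r; last first.
  by rewrite gt_eqF// normal_peak_gt0// invr_neq0.
rewrite /gauss /normal_fun subr0 exprVn sqr_sqrtr ?ltW//; congr expR.
by field; rewrite gt_eqF.
Qed.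

Lemma gauss_ge0 (e x : R) : 0 <= gauss e x.
Proof. exact: expR_ge0. Qed.

Lemma gauss_le1 (e x : R) : 0 <= e -> gauss e x <= 1.
Proof.
move=> e0; rewrite /gauss -[leRHS]expR0 ler_expR oppr_le0.
by rewrite divr_ge0// mulr_ge0// sqr_ge0.
Qed.

Lemma measurable_gauss (e : R) : measurable_fun setT (gauss e).
Proof.
apply: continuous_measurable_fun.
have -> : gauss e = (fun y => expR (- (e / 2) * y ^+ 2)).
  by apply/funext => y; rewrite /gauss; congr expR; rewrite mulNr mulrAC.
exact: is_derive1_continuous (is_derive_expR_sqr (- (e / 2))).
Qed.

(** This is [exp (- (x - a)^2 / (2 e))], in two roles: the characteristic function at [x - a] of the
    normal law attached to [gauss e], in the form produced by [normal_expi], and the unnormalized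
    density of the normal law of mean [a] and variance [e]. *)
Definition gkernel (e a x : R) : R := expR (- ((Num.sqrt e)^-1 ^+ 2 * (x - a) ^+ 2 / 2)).

Lemma gkernel_le1 e a x : `|gkernel e a x| <= 1.
Proof.
rewrite ger0_norm ?expR_ge0// -[leRHS]expR0 ler_expR oppr_le0.
by rewrite divr_ge0// mulr_ge0// sqr_ge0.
Qed.

Lemma measurable_gkernel d (X : measurableType d) e (a x : X -> R) :
  measurable_fun setT a -> measurable_fun setT x ->
  measurable_fun setT (fun p => gkernel e (a p) (x p)).
Proof.
move=> ma mx; apply: measurableT_comp => //; apply: measurableT_comp => //.
apply: measurable_funM => //; apply: measurable_funM => //.
by apply: measurable_funX; exact: measurable_funB.
Qed.

Lemma Rintegral_gauss (e : R) (f : R -> R) (M : R) : 0 < e ->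
  measurable_fun setT f -> (forall x, `|f x| <= M) ->
  \int[mu]_x (gauss e x * f x) = gauss_mass e * \int[normal_prob 0 (Num.sqrt e)^-1]_x f x.
Proof.
move=> e0 mf fM; rewrite (Rintegral_normal 0 _ mf fM) -RintegralZl//.
  by apply: eq_Rintegral => x _; rewrite gaussE// -mulrA (mulrC (f x)).
exact: (normal_integrableM 0 _ mf fM).
Qed.

Lemma cint_gauss (e : R) (f : R -> R[i]) : 0 < e -> cbmeas f ->
  cint mu setT (fun x => (gauss e x)%:C * f x) =
  (gauss_mass e)%:C * cint (normal_prob 0 (Num.sqrt e)^-1) setT f.
Proof.
move=> e0 [[mf1 mf2] [M fM]]; apply: complexE; rewrite ?ReM ?ImM /= ?mul0r ?subr0 ?addr0.
  under eq_Rintegral do rewrite ReM /= mul0r subr0.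
  by rewrite (@Rintegral_gauss e _ M)// => x; case: (fM x).
under eq_Rintegral do rewrite ImM /= mul0r addr0.
by rewrite (@Rintegral_gauss e _ M)// => x; case: (fM x).
Qed.

Lemma sin_cosD (x : R) : sin x = cos (x + - (pi / 2)).
Proof. by rewrite cosD cosN sinN cos_pihalf sin_pihalf; ring. Qed.

Lemma normal_expi (s u : R) : 0 < s ->
  cint (normal_prob 0 s) setT (fun x => expi (x * u)) = (expR (- (s ^+ 2 * u ^+ 2 / 2)))%:C.
Proof.
move=> s0; apply: complexE => /=.
  under eq_Rintegral do rewrite Re_expi mulrC -[_ * _]addr0.
  by rewrite normal_fourier// cos0 mul1r.
under eq_Rintegral do rewrite Im_expi mulrC sin_cosD.
by rewrite normal_fourier// cosN cos_pihalf mul0r.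
Qed.

(** The constant [1 / (2 pi)] of Fourier inversion times the mass [sqrt (2 pi / e)] is the peak
    [1 / sqrt (2 pi e)]: integrating out one regularized frequency leaves exactly a normal density
    of variance [e]. *)
Lemma gauss_mass_pdf (e a x : R) : 0 < e ->
  (2 * pi)^-1 * gauss_mass e * gkernel e a x =
  normal_pdf a (Num.sqrt e) x.
Proof.
move=> e0; have s0 : 0 < Num.sqrt e by rewrite sqrtr_gt0.
rewrite normal_pdfE ?gt_eqF// /gkernel /gauss_mass /normal_peak /normal_fun invrK.
have E : Num.sqrt e ^+ 2 = e by rewrite sqr_sqrtr// ltW.
rewrite exprVn E; congr (_ * _); last by congr expR; field; rewrite gt_eqF.
have pi0 := pi_gt0 R; move: pi pi0 => p p0.
have [p0' e0'] : p != 0 /\ e != 0 by rewrite !gt_eqF.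
(* Both sides are nonnegative; comparing their squares removes the square roots. *)
apply/eqP; rewrite -(@eqrXn2 _ 2) ?mulr_ge0 ?invr_ge0 ?sqrtr_ge0//; last first.
  by rewrite mulr_ge0// ltW.
rewrite exprMn sqr_sqrtr; last by rewrite mulrn_wge0// mulr_ge0 ?invr_ge0 ?ltW.
rewrite exprVn [X in _ == X]exprVn sqr_sqrtr; last by rewrite mulrn_wge0// mulr_ge0 ?ltW.
by apply/eqP; field; rewrite p0' e0'.
Qed.

End GaussianWeights.

(** * Integrals of functions that agree off a null set *)

Section EqualOffNull.
Import HBNNSimple.
Context d (X : measurableType d) (R : realType) (m : {measure set X -> \bar R}).
Local Open Scope ereal_scope.

(** A simple function below [f], multiplied by the indicator of the complement of [N], lies below
    [g] and keeps its integral. *)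
Let ge0_le_off_null (N : set X) (f g : X -> \bar R) : measurable N -> m N = 0 ->
  (forall x, 0 <= f x) -> (forall x, 0 <= g x) -> (forall x, ~ N x -> f x = g x) ->
  \int[m]_x f x <= \int[m]_x g x.
Proof.
move=> mN N0 f0 g0 fg; rewrite !ge0_integralTE//.
apply: ge_ereal_sup => _ /= [h hf <-].
have mNC : measurable (~` N) by exact: measurableC.
apply: le_trans (ereal_sup_ubound _); last first.
  exists (proj_nnsfun h mNC) => //= x.
  rewrite mindicE; have [/set_mem xN|xN] := boolP (x \in ~` N).
    by rewrite mulr1 -fg//; exact: hf.
  by rewrite mulr0 g0.
rewrite -!integralT_nnsfun.
rewrite (@ae_eq_integral _ _ _ m setT (EFin \o proj_nnsfun h mNC))//.
- by apply/measurable_EFinP; exact: measurable_funPT.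
- by apply/measurable_EFinP; exact: measurable_funPT.
exists N; split => // x /=; apply: contra_notP => Nx _.
by rewrite mindicE mem_set ?mulr1.
Qed.

(* No measurability of [f] and [g] is required: the integral is a supremum
   over measurable simple functions. *)
Lemma integral_eq_off_null (N : set X) (f g : X -> \bar R) : measurable N -> m N = 0 ->
  (forall x, ~ N x -> f x = g x) -> \int[m]_x f x = \int[m]_x g x.
Proof.
move=> mN N0 fg; rewrite integralE [RHS]integralE; congr (_ - _); apply/eqP; rewrite eq_le;
  apply/andP; split; apply: (ge0_le_off_null mN N0) => // x Nx; by rewrite unlock (fg x Nx).
Qed.

End EqualOffNull.

(** * Conditional expectations as Radon-Nikodym densities *)

Section CondDensity.
Context {R : realType}.

Lemma Rintegral_eq_off_null d (X : measurableType d) (m : {measure set X -> \bar R})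
    (D : set X) (f g : X -> R) : measurable D ->
  (\forall x \ae m, D x -> f x = g x) -> \int[m]_(x in D) f x = \int[m]_(x in D) g x.
Proof.
move=> mD [N [mN N0 sN]]; rewrite Rintegral_mkcond [RHS]Rintegral_mkcond; congr fine.
apply: (integral_eq_off_null mN N0) => x Nx; rewrite !patchE; case: ifPn => // /set_mem Dx.
congr (_%:E); apply: contrapT => fgx; apply: Nx; apply: sN => /= h; exact/fgx/h.
Qed.

(** The hypothesis on the set where [f > 1] says that the nonnegative function [max (f - 1) 0] has
    integral at most 0, so it vanishes almost everywhere. *)
Lemma ae_le1 d (X : measurableType d) (m : {finite_measure set X -> \bar R}) (f : X -> R) :
  m.-integrable setT (EFin \o f) ->
  (forall A, measurable A -> \int[m]_(x in A) f x <= fine (m A)) ->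
  \forall x \ae m, f x <= 1.
Proof.
move=> fi fA; have mf := measurable_int_EFin fi.
pose k x := Num.max (f x - 1) 0.
pose A := [set x | 1 < f x].
have mA : measurable A.
  have -> : A = f @^-1` `]1, +oo[ by apply/seteqP; split => x /=; rewrite in_itv/= andbT.
  by rewrite -[X in measurable X]setTI; apply: mf => //; exact: measurable_itv.
have i1 : m.-integrable setT (EFin \o (fun=> (1 : R))).
  by apply: (@bounded_integrable _ _ _ _ _ 1) => // x; rewrite normr1.
have kE : \int[m]_x k x = \int[m]_(x in A) (f x - 1).
  rewrite [RHS]Rintegral_mkcond; apply: eq_Rintegral => x _; rewrite patchE /k.
  case: ifPn => [/set_mem|/negP nA]; first by rewrite /A/= => fx; rewrite max_l// subr_ge0 ltW.
  rewrite max_r// subr_le0 leNgt; apply/negP => fx; apply: nA; exact/mem_set.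
have k0 : \int[m]_x k x <= 0.
  rewrite kE RintegralB//; last 2 first.
  - exact: (integrableS measurableT mA (@subsetT _ _) fi).
  - exact: (integrableS measurableT mA (@subsetT _ _) i1).
  by rewrite Rintegral_cst// mul1r subr_le0 fA.
have ki : m.-integrable setT (EFin \o k).
  apply: (le_integrable measurableT _ _ (integrableD measurableT (integrable_norm fi) i1)).
    apply/measurable_EFinP; apply: measurable_funTS; apply: measurable_maxr => //.
    by apply: measurable_funB.
  move=> x _ /=; rewrite lee_fin.
  have k0x : 0 <= k x by rewrite /k le_max lexx orbT.
  rewrite ger0_norm// [leRHS]ger0_norm ?addr_ge0// /k ge_max addr_ge0// andbT.
  by rewrite (le_trans (ler_norm _))// (le_trans (ler_normB _ _))// normr1.
have : (\int[m]_x `|(EFin \o k) x| = 0)%E.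
  have kpos x : (0 <= (EFin \o k) x)%E by rewrite lee_fin /k le_max lexx orbT.
  under eq_integral do rewrite gee0_abs//.
  apply/eqP; rewrite eq_le integral_ge0 ?andbT; last by move=> x _; exact: kpos.
  have := integrable_fin_num measurableT ki.
  by move=> /fineK <-; rewrite lee_fin.
move/(ae_eq_integral_abs m measurableT (measurable_int _ ki)).1.
apply: filterS => x /= /(_ I) [kx].
have : f x - 1 <= k x by rewrite /k le_max lexx.
by rewrite kx subr_le0.
Qed.

(* The density of the image by [V] of [h dP], a version of the conditional
   expectation of [h] given [V]. *)
Lemma cond_density d d' (X : measurableType d) (Y : measurableType d')
    (P : probability X R) (V : {mfun X >-> Y}) (h : X -> R) :
  measurable_fun setT h -> (forall x, `|h x| <= 1) ->
  exists g : Y -> R, [/\ measurable_fun setT g, forall y, `|g y| <= 1 &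
    forall C, measurable C ->
      \int[distribution P V]_(y in C) g y = \int[P]_(x in V @^-1` C) h x].
Proof.
move=> mh h1.
have ih : P.-integrable setT (EFin \o h) by exact: (@bounded_integrable _ _ _ _ _ 1).
have mV : measurable_fun setT V by exact: measurable_funPT.
pose nu_ : {charge set Y -> \bar R} := pushforward (induced_charge ih) V.
pose nu : {charge set Y -> \bar R} := nu_ mV.
have mVA A : measurable A -> measurable (V @^-1` A).
  by move=> mA; rewrite -[X in measurable X]setTI; exact: (measurable_funPT V).
have numu : nu `<< distribution P V.
  apply/null_content_dominatesP => A mA A0.
  rewrite /nu /nu_ /= /pushforward /induced_charge.
  apply: null_set_integral => //; first exact: mVA.
  by apply/measurable_EFinP; exact: measurable_funTS.
pose g0 y := fine (Radon_Nikodym nu (distribution P V) y).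
have ig0 : (distribution P V).-integrable setT (EFin \o g0).
  apply: eq_integrable (Radon_Nikodym_integrable numu) => // y _.
  by rewrite /g0 /= fineK// Radon_Nikodym_fin_num.
have g0E C : measurable C ->
    \int[distribution P V]_(y in C) g0 y = \int[P]_(x in V @^-1` C) h x.
  move=> mC; have := Radon_Nikodym_integral numu mC.
  rewrite /nu /nu_ /= /pushforward /induced_charge /Rintegral => /= ->; congr fine.
  by apply: eq_integral => y _; rewrite /g0 fineK// Radon_Nikodym_fin_num.
(* Used with [s] equal to 1 and -1, to bound the density from above and from below. *)
have hb C (s : R) : measurable C -> `|s| <= 1 ->
    s * \int[P]_(x in V @^-1` C) h x <= fine (distribution P V C).
  move=> mC s1; have mVC := mVA _ mC.
  have ihC := integrableS measurableT mVC (@subsetT _ _) ih.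
  apply: le_trans (ler_norm _) _; rewrite normrM.
  apply: le_trans (ler_piMl _ s1) _ => //.
  apply: (le_trans (le_normr_Rintegral _ ihC)) => //.
  rewrite -[leRHS]mul1r -(Rintegral_cst P mVC); apply: le_Rintegral => //.
  - exact: integrable_norm.
  - exact: finite_measure_integrable_cst.
have le1 : \forall y \ae distribution P V, g0 y <= 1.
  apply: ae_le1 => // A mA; rewrite g0E// -[leLHS]mul1r hb// normr1//.
have ge1 : \forall y \ae distribution P V, - g0 y <= 1.
  have iN : (distribution P V).-integrable setT (EFin \o (fun y => (-1) * g0 y)).
    exact: (integrableZl measurableT (-1) ig0).
  have : \forall y \ae distribution P V, (-1) * g0 y <= 1.
    apply: ae_le1 => // A mA; rewrite RintegralZl//; last first.
      exact: (integrableS measurableT mA (@subsetT _ _) ig0).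
    by rewrite g0E// hb// normrN1.
  by apply: filterS => y; rewrite mulN1r.
have mg0 := measurable_int_EFin ig0.
(* The Radon-Nikodym density is bounded by 1 almost everywhere only; clipping it to [[-1, 1]]
   changes it on a null set and makes the bound hold everywhere. *)
exists (fun y => Num.max (-1) (Num.min 1 (g0 y))); split.
- by apply: measurable_maxr => //; exact: measurable_minr.
- by move=> y; rewrite ler_norml le_max lexx/= ge_max ge_min lexx andbT; lra.
- move=> C mC; rewrite -g0E//; apply: Rintegral_eq_off_null => //.
  apply: filterS2 le1 ge1 => y y1 y2 _.
  by rewrite min_r// max_r//; lra.
Qed.

End CondDensity.

(** * Gaussian approximate identities *)

Section ApproximateIdentity.
Context {R : realType}.

Lemma onem_gauss (e y : R) : 1 - gauss e y <= e * y ^+ 2 / 2.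
Proof. by have := expR_ge1Dx (- (e * y ^+ 2 / 2)); rewrite /gauss; lra. Qed.

Lemma approximate_identity (a M : R) (F : R -> R) (e_ : nat -> R) :
  measurable_fun setT F -> (forall x, `|F x| <= M) ->
  F y @[y --> a] --> F a -> (forall n, 0 < e_ n) -> e_ n @[n --> \oo] --> (0 : R) ->
  \int[normal_prob a (Num.sqrt (e_ n))]_y (gauss (e_ n) y * F y) @[n --> \oo] --> F a.
Proof.
move=> mF FM cF e0 ecv.
have M0 : 0 <= M by exact: le_trans (normr_ge0 _) (FM 0).
apply/cvgrPdist_le => eps eps0.
have eps40 : 0 < eps / 4 by rewrite divr_gt0.
have /cvgrPdist_le/(_ _ eps40)[del /= del0 hdel] := cF.
(* Within [del] of [a], the function [F] varies by at most [eps / 4] and the factor [gauss] costs at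
   most [C1 * e], by [onem_gauss]. Farther away the difference is at most [2 M], hence at most
   [(2 M / del) |y - a|]; [normal_approx] turns this slope into [C2 * sqrt e]. *)
pose C1 := M * ((`|a| + del) ^+ 2 / 2); pose C2 := 2 * M / del * Num.sqrt 2.
have c1 : C1 * e_ n @[n --> \oo] --> (0 : R).
  by rewrite -[X in _ --> X](mulr0 C1); apply: cvgM => //; exact: cvg_cst.
have c2 : C2 * Num.sqrt (e_ n) @[n --> \oo] --> (0 : R).
  rewrite -[X in _ --> X](mulr0 C2); apply: cvgM; first exact: cvg_cst.
  by rewrite -(sqrtr0 R); apply: cvg_comp ecv _; exact: sqrt_continuous.
have eps20 : 0 < eps / 2 by rewrite divr_gt0.
near=> n.
have h1 : C1 * e_ n <= eps / 4.
  apply: le_trans (ler_norm _) _; near: n; exact: (cvgr0_norm_le _ c1).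
have h2 : C2 * Num.sqrt (e_ n) <= eps / 2.
  apply: le_trans (ler_norm _) _; near: n; exact: (cvgr0_norm_le _ c2).
have e0n := e0 n.
have K0 : 0 <= 2 * M / del by rewrite divr_ge0 ?mulr_ge0// ltW.
have gF y : `|gauss (e_ n) y * F y| <= M.
  rewrite normrM ger0_norm ?gauss_ge0//; apply: le_trans (FM y).
  by rewrite ler_piMl// gauss_le1// ltW.
have := @normal_approx R a (Num.sqrt (e_ n)) (eps / 2) (2 * M / del) (F a) M
  (fun y => gauss (e_ n) y * F y).
rewrite distrC => /(_ _ K0 _ gF) H.
apply: (le_trans (H _ _ _)).
- by rewrite sqrtr_gt0.
- by apply: measurable_funM => //; exact: measurable_gauss.
- move=> y.
  have [yd|yd] := ltP `|a - y| del.
    apply: (@le_trans _ _ (eps / 2)); last by rewrite lerDl mulr_ge0.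
    rewrite (_ : _ - F a = - (F a - F y) - (1 - gauss (e_ n) y) * F y); last by ring.
    apply: (le_trans (ler_normB _ _)); rewrite normrN.
    have := hdel y yd.
    suff : `|(1 - gauss (e_ n) y) * F y| <= eps / 4 by move: (`|_|) (`|_|) => u w; lra.
    apply: le_trans h1; rewrite normrM ger0_norm ?subr_ge0 ?gauss_le1 ?(ltW e0n)//.
    apply: (le_trans (ler_pM _ _ (onem_gauss _ _) (FM y))) => //.
      by rewrite subr_ge0 gauss_le1// ltW.
    rewrite (_ : C1 * _ = e_ n * (`|a| + del) ^+ 2 / 2 * M); last by rewrite /C1; ring.
    rewrite ler_wpM2r// ler_wpM2r ?invr_ge0// ler_pM2l//.
    rewrite -(real_normK (num_real y)) lerXn2r ?nnegrE ?addr_ge0 ?(ltW del0)//.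
    have -> : y = a - (a - y) by ring.
    by apply: (le_trans (ler_normB _ _)); rewrite lerD2l ltW.
  apply: (@le_trans _ _ (2 * M)).
    by apply: (le_trans (ler_normB _ _)); rewrite mulr2n mulrDl mul1r; apply: lerD.
  apply: (@le_trans _ _ (2 * M / del * `|y - a|)); last by rewrite lerDr ltW.
  by rewrite -mulrA ler_peMr ?mulr_ge0// mulrC ler_pdivlMr// mul1r distrC.
- by rewrite mulrA -/C2; lra.
Unshelve. all: by end_near. Qed.

End ApproximateIdentity.

Section ComplexMeasures.
Context {R : realType}.

(** The two measures may have different bases, so the real and imaginary densities are compared
    separately by [transfer_bounded] along the identity. *)
Lemma cm_int_eq (nu nu' : @cmeasure R) (f : R -> R[i]) :
  cm_eq nu nu' -> cbmeas f -> cm_int nu f = cm_int nu' f.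
Proof.
move=> E [[mf1 mf2] [M fM]].
have Ere C : measurable C -> \int[cm_base nu]_(x in id @^-1` C) complex.Re (cm_dens nu x) =
    \int[cm_base nu']_(x in id @^-1` C) complex.Re (cm_dens nu' x).
  by move=> mC; have [] := E _ mC.
have Eim C : measurable C -> \int[cm_base nu]_(x in id @^-1` C) complex.Im (cm_dens nu x) =
    \int[cm_base nu']_(x in id @^-1` C) complex.Im (cm_dens nu' x).
  by move=> mC; have [] := E _ mC.
have f1 x : `|complex.Re (f x)| <= M by case: (fM x).
have f2 x : `|complex.Im (f x)| <= M by case: (fM x).
have mid := @measurable_id _ R setT.
have r1 := transfer_bounded mid mid (cm_int_Re nu) (cm_int_Re nu') Ere mf1 f1.
have r2 := transfer_bounded mid mid (cm_int_Im nu) (cm_int_Im nu') Eim mf1 f1.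
have r3 := transfer_bounded mid mid (cm_int_Re nu) (cm_int_Re nu') Ere mf2 f2.
have r4 := transfer_bounded mid mid (cm_int_Im nu) (cm_int_Im nu') Eim mf2 f2.
apply: complexE => /=.
  under eq_Rintegral do rewrite ReM.
  under [RHS]eq_Rintegral do rewrite ReM.
  rewrite !RintegralB//.
  - by rewrite r1 r4.
  - exact: (integrable_bounded_mul mf1 f1 (cm_int_Re nu')).
  - exact: (integrable_bounded_mul mf2 f2 (cm_int_Im nu')).
  - exact: (integrable_bounded_mul mf1 f1 (cm_int_Re nu)).
  - exact: (integrable_bounded_mul mf2 f2 (cm_int_Im nu)).
under eq_Rintegral do rewrite ImM.
under [RHS]eq_Rintegral do rewrite ImM.
rewrite !RintegralD//.
- by rewrite r2 r3.
- exact: (integrable_bounded_mul mf1 f1 (cm_int_Im nu')).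
- exact: (integrable_bounded_mul mf2 f2 (cm_int_Re nu')).
- exact: (integrable_bounded_mul mf1 f1 (cm_int_Im nu)).
- exact: (integrable_bounded_mul mf2 f2 (cm_int_Re nu)).
Qed.

End ComplexMeasures.

(** * Independence and joint measurability *)

Section Independence.
Context {R : realType} d (Omega : measurableType d) (P : probability Omega R).

Lemma indep_Rintegral d1 d2 (T1 : measurableType d1) (T2 : measurableType d2)
    (X : Omega -> T1) (Y : Omega -> T2) (f : T1 * T2 -> R) (M : R) :
  measurable_fun setT X -> measurable_fun setT Y ->
  (forall A C, measurable A -> measurable C ->
    (P (X @^-1` A `&` Y @^-1` C) = P (X @^-1` A) * P (Y @^-1` C))%E) ->
  measurable_fun setT f -> (forall p, `|f p| <= M) ->
  \int[P]_w f (X w, Y w) = \int[P]_w1 \int[P]_w2 f (X w1, Y w2).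
Proof.
move=> mX mY XY mf fM.
pose X' : {mfun Omega >-> T1} := HB.pack X (isMeasurableFun.Build _ _ _ _ X mX).
pose Y' : {mfun Omega >-> T2} := HB.pack Y (isMeasurableFun.Build _ _ _ _ Y mY).
have mXY : measurable_fun setT (fun w => (X w, Y w)) by exact: measurable_fun_pair.
pose XY' : {mfun Omega >-> (T1 * T2)%type} :=
  HB.pack (fun w => (X w, Y w)) (isMeasurableFun.Build _ _ _ _ _ mXY).
transitivity (\int[distribution P XY']_p f p).
  by rewrite (Rintegral_distribution P XY' mf fM).
transitivity (\int[(distribution P X' \x distribution P Y')%E]_p f p).
  rewrite /Rintegral; congr fine; apply: eq_measure_integral => A mA _.
  apply/esym; by apply: product_measure_unique.
rewrite -(Rintegral_prod _ _ mf fM).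
transitivity (\int[distribution P X']_x \int[P]_w2 f (x, Y w2)).
  apply: eq_Rintegral => x _.
  by rewrite (Rintegral_distribution P Y' (measurableT_comp mf (pair1_measurable x)) (fun y => fM (x, y))).
have mg : measurable_fun setT (fun p : T1 * Omega => f (p.1, Y p.2)).
  apply: (measurableT_comp mf); apply: measurable_fun_pair => //.
  exact: (measurableT_comp mY).
have mh := @measurable_Rintegral_snd R _ _ T1 Omega (@dirac _ T1 point R) P _ M mg (fun p => fM _).
rewrite (Rintegral_distribution P X' mh (M := M))// => x.
apply: Rintegral_le_prob => //.
exact: (measurableT_comp mg (pair1_measurable x)).
Qed.

Lemma indep_cint d1 d2 (T1 : measurableType d1) (T2 : measurableType d2)
    (X : Omega -> T1) (Y : Omega -> T2) (f : T1 * T2 -> R[i]) :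
  measurable_fun setT X -> measurable_fun setT Y ->
  (forall A C, measurable A -> measurable C ->
    (P (X @^-1` A `&` Y @^-1` C) = P (X @^-1` A) * P (Y @^-1` C))%E) ->
  cbmeas f ->
  cint P setT (fun w => f (X w, Y w)) =
  cint P setT (fun w1 => cint P setT (fun w2 => f (X w1, Y w2))).
Proof.
move=> mX mY XY [[mf1 mf2] [M fM]]; apply: complexE => /=.
  by rewrite (indep_Rintegral mX mY XY mf1 (M := M))// => p; case: (fM p).
by rewrite (indep_Rintegral mX mY XY mf2 (M := M))// => p; case: (fM p).
Qed.

Lemma measurable_to_sigma (G : set (set Omega)) : G `<=` d.-measurable ->
  measurable_fun setT (id : Omega -> g_sigma_algebraType G).
Proof.
move=> Gm _ A mA; rewrite setTI.
have : <<s G >> `<=` d.-measurable.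
  apply: smallest_sub => //; split => //.
  - by move=> B mB; rewrite setTD; exact: measurableC.
  - by move=> B mB; exact: bigcup_measurable.
by move=> /(_ _ mA).
Qed.

Lemma measurable_sigma_fun (G : set (set Omega)) d' (T : measurableType d') (X : Omega -> T) :
  sigma_algebra setT G -> (forall C, measurable C -> G (X @^-1` C)) ->
  measurable_fun setT (X : g_sigma_algebraType G -> T).
Proof.
move=> sG XG _ C mC; rewrite setTI.
by apply: sub_sigma_algebra; exact: XG.
Qed.

(** The two independent variables are the identity maps of [Omega] into [Omega] equipped with [G]
    and with [H]. Independence of whole processes becomes the passage from the diagonal to two
    copies of [Omega], with no path space to introduce. *)
Lemma indep_sigma_cint (G H : set (set Omega))
    (f : g_sigma_algebraType G * g_sigma_algebraType H -> R[i]) :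
  sigma_algebra setT G -> sigma_algebra setT H ->
  G `<=` d.-measurable -> H `<=` d.-measurable -> indep_sigma P G H -> cbmeas f ->
  cint P setT (fun w => f (w, w)) =
  cint P setT (fun w1 => cint P setT (fun w2 => f (w1, w2))).
Proof.
move=> sG sH Gm Hm GH bf.
apply: (indep_cint (measurable_to_sigma Gm) (measurable_to_sigma Hm)) => // A C mA mC.
apply: GH.
  by have : <<s G >> A := mA; rewrite sigma_algebra_id.
by have : <<s H >> C := mC; rewrite sigma_algebra_id.
Qed.

(** Regular versions agree with the processes off null sets only, and [T] is adapted to a completed
    filtration, so the sigma-algebras generated by the processes are too small. The measurability
    clause keeps the completion inside the sets that [P] measures. *)
Definition completion (G : set (set Omega)) : set (set Omega) :=
  [set A | measurable A /\
    exists2 C, G C & P.-negligible ((A `\` C) `|` (C `\` A))].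

Lemma sub_completion (G : set (set Omega)) : G `<=` d.-measurable -> G `<=` completion G.
Proof.
move=> Gm A GA; split; first exact: Gm.
by exists A => //; rewrite !setDv setU0; exact: negligible_set0.
Qed.

Lemma completion_measurable (G : set (set Omega)) : completion G `<=` d.-measurable.
Proof. by move=> A []. Qed.

Lemma completion_mono (G H : set (set Omega)) : G `<=` H -> completion G `<=` completion H.
Proof. by move=> GH A [mA [C GC AC]]; split => //; exists C => //; exact: GH. Qed.

Lemma completion_null (G : set (set Omega)) (A : set Omega) : sigma_algebra setT G ->
  measurable A -> P.-negligible A -> completion G A.
Proof.
move=> [G0 _ _] mA nA; split => //; exists set0 => //.
by rewrite setD0 set0D setU0.
Qed.

Lemma sigma_algebra_completion (G : set (set Omega)) : sigma_algebra setT G ->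
  sigma_algebra setT (completion G).
Proof.
move=> [G0 GC GU]; split.
- by split => //; exists set0 => //; rewrite setDv setU0; exact: negligible_set0.
- move=> A [mA [C GCC AC]]; rewrite setTD; split; first exact: measurableC.
  exists (~` C); first by rewrite -setTD; exact: GC.
  apply: negligibleS AC => w [[nA nC]|[nC nA]].
    by right; split => //; exact: contrapT.
  by left; split => //; exact: contrapT.
- move=> A GA; have /choice[C hC] n : exists C, G C /\ P.-negligible ((A n `\` C) `|` (C `\` A n)).
    by have [_ [C ? ?]] := GA n; exists C.
  split; first by apply: bigcup_measurable => n _; case: (GA n).
  exists (\bigcup_n C n); first by apply: GU => n; case: (hC n).
  apply: negligibleS (negligible_bigcup (fun n => (hC n).2)).
  move=> w [[[n _ An] nC]|[[n _ Cn] nA]]; exists n => //.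
    by left; split => // Cn; apply: nC; exists n.
  by right; split => // An; apply: nA; exists n.
Qed.

Lemma measure_eq_negligible (A C : set Omega) : measurable A -> measurable C ->
  P.-negligible ((A `\` C) `|` (C `\` A)) -> P A = P C.
Proof.
move=> mA mC n.
have D0 B1 B2 : measurable B1 -> measurable B2 -> P.-negligible (B1 `\` B2) -> P (B1 `\` B2) = 0%E.
  by move=> m1 m2 /negligibleP; apply; exact: measurableD.
have z1 : P (A `\` C) = 0%E by apply: D0 => //; apply: negligibleS n; left.
have z2 : P (C `\` A) = 0%E by apply: D0 => //; apply: negligibleS n; right.
have e1 : P A = (P (A `\` C) + P (A `&` C))%E by exact: measureDI.
have e2 : P C = (P (C `\` A) + P (C `&` A))%E by exact: measureDI.
by rewrite e1 e2 z1 z2 setIC.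
Qed.

Lemma indep_completion (G H : set (set Omega)) : G `<=` d.-measurable -> H `<=` d.-measurable ->
  indep_sigma P G H -> indep_sigma P (completion G) (completion H).
Proof.
move=> Gm Hm GH A C [mA [A' GA nA]] [mC [C' HC nC]].
have mA' := Gm _ GA; have mC' := Hm _ HC.
rewrite (measure_eq_negligible mA mA' nA) (measure_eq_negligible mC mC' nC) -(GH _ _ GA HC).
apply: measure_eq_negligible; [exact: measurableI|exact: measurableI|].
apply: negligibleS (negligibleU nA nC).
move=> w [[[Aw Cw] nw]|[[Aw Cw] nw]].
  have [A'w|A'w] := pselect (A' w).
    by right; left; split => // C'w; exact: nw.
  by left; left.
have [A'w|A'w] := pselect (A w).
  by right; right; split => // C'w; exact: nw.
by left; right.
Qed.

End Independence.

(** * Jointly measurable versions of right-continuous processes *)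

Section JointMeasurability.
Context {R : realType} d (Omega : measurableType d) (P : probability Omega R).

(** For [s >= 0], the first multiple of [1 / (n + 1)] strictly beyond [s]; strictness is what a
    limit from the right asks for. *)
Definition grid (n : nat) (s : R) : R := (Num.truncn (n.+1%:R * s)).+1%:R / n.+1%:R.

Lemma grid_gt n s : 0 <= s -> s < grid n s.
Proof.
move=> s0; have n0 : 0 < n.+1%:R :> R by rewrite ltr0n.
rewrite /grid ltr_pdivlMr// mulrC.
by have /truncn_itv/andP[] : 0 <= n.+1%:R * s by rewrite mulr_ge0.
Qed.

Lemma grid_le n s : 0 <= s -> grid n s <= s + n.+1%:R^-1.
Proof.
move=> s0; have n0 : 0 < n.+1%:R :> R by rewrite ltr0n.
rewrite /grid ler_pdivrMr// mulrDl mulVf ?gt_eqF// -natr1 lerD2r mulrC.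
by have /truncn_itv/andP[] : 0 <= s * n.+1%:R by rewrite mulr_ge0.
Qed.

Lemma cvg_grid s : 0 <= s -> grid n s @[n --> \oo] --> s.
Proof.
move=> s0; apply: (@squeeze_cvgr _ _ _ _ (fun=> s) (fun n => s + n.+1%:R^-1)).
- by apply: nearW => n; rewrite grid_le// ltW// grid_gt.
- exact: cvg_cst.
- rewrite -[X in _ --> X]addr0; apply: cvgD; first exact: cvg_cst.
  exact: cvg_harmonic.
Qed.

(* By right continuity, [X s] is the limit of [X (grid n s)], which is jointly
   measurable in [(s, w)]. *)
Lemma joint_version (G : set (set Omega)) (X : R -> Omega -> R) :
  sigma_algebra setT G -> (forall A, P.-negligible A -> G A) ->
  (forall s C, 0 <= s -> measurable C -> G (X s @^-1` C)) ->
  (\forall w \ae P, forall s, 0 <= s -> X u w @[u --> s^'+] --> X s w) ->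
  exists2 Y : R * g_sigma_algebraType G -> R, measurable_fun setT Y &
    \forall w \ae P, forall s, 0 <= s -> Y (s, w) = X s w.
Proof.
move=> sG Gnull XG [N [mN N0 sN]].
pose D : set (R * g_sigma_algebraType G) := `[0, +oo[ `*` ~` N.
have mNG : G.-sigma.-measurable N.
  have GN : G N by apply: Gnull; exists N; split.
  by apply: sub_sigma_algebra; exact: GN.
have mD : measurable D.
  by apply: measurableX; [exact: measurable_itv|exact: measurableC].
(* Setting [Y] to 0 on the exceptional set [N], which [G] contains, and at negative times makes the
   grid approximation converge at every point. *)
pose Y (p : R * g_sigma_algebraType G) := if p \in D then X p.1 p.2 else 0.
exists Y; last first.
  exists N; split => // w /=; apply: contra_notP => Nw s s0.
  by rewrite /Y mem_set//; split => //=; rewrite in_itv/= s0.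
pose Yn n (p : R * g_sigma_algebraType G) := if p \in D then X (grid n p.1) p.2 else 0.
apply: (@measurable_fun_cvg _ _ _ setT Yn Y); last first.
  move=> [s w] _; rewrite /Y /Yn; case: ifPn => [/set_mem[/=]|_]; last exact: cvg_cst.
  rewrite in_itv/= andbT => s0 Nw.
  have rc : X u w @[u --> s^'+] --> X s w.
    by apply: contrapT => h; apply: Nw; apply: sN => /= /(_ s s0).
  move/cvg_at_rightP: rc => /(_ (grid ^~ s)); apply; split.
    by move=> n; exact: grid_gt.
  exact: cvg_grid.
move=> n; have n0 : 0 < n.+1%:R :> R by rewrite ltr0n.
(* On the [k]-th strip the grid point is constant, so [Yn n] is there the single random variable
   [X ((k + 1) / (n + 1))]. *)
pose I k : set R := [set` `[k%:R / n.+1%:R, k.+1%:R / n.+1%:R[].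
have cover : \bigcup_k ((I k `*` setT) `&` D) `|` ~` D = [set: R * g_sigma_algebraType G].
  apply/seteqP; split => // -[s w] _.
  have [Dsw|nD] := pselect (D (s, w)); last by right.
  left; exists (Num.truncn (n.+1%:R * s)) => //; split => //; split => //=.
  have [+ _] := Dsw; rewrite /= in_itv/= andbT => s0.
  have /truncn_itv : 0 <= n.+1%:R * s by rewrite mulr_ge0.
  by rewrite /I /= in_itv/= ler_pdivrMr// ltr_pdivlMr// mulrC.
have mI k : measurable ((I k `*` setT) `&` D).
  by apply: measurableI => //; apply: measurableX => //; exact: measurable_itv.
rewrite -cover; apply/measurable_funU => //.
- by apply: bigcup_measurable => k _; exact: mI.
- exact: measurableC.
split; last first.
  apply: (@eq_measurable_fun _ _ _ _ _ (fun _ : R * g_sigma_algebraType G => 0 : R)) => // p /set_mem /= nD.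
  by rewrite /Yn memNset.
apply/measurable_fun_bigcup => // k.
apply: (@eq_measurable_fun _ _ _ _ _ (fun p : R * g_sigma_algebraType G => X (k.+1%:R / n.+1%:R) p.2)).
  move=> [s w] /set_mem[[/= + _] Dsw]; rewrite /I /= in_itv/= => /andP[h1 h2].
  rewrite /Yn mem_set//= /grid (@truncn_def _ _ k)//.
  by rewrite mulrC -ler_pdivrMr// h1 -ltr_pdivlMr.
apply: measurable_funTS.
apply: (measurableT_comp (f := (X (k.+1%:R / n.+1%:R) : g_sigma_algebraType G -> R))) => //.
by apply: measurable_sigma_fun => // C mC; apply: XG => //; rewrite divr_ge0.
Qed.

Lemma right_continuous_paths (X : R -> Omega -> R) : 
  (\forall w \ae P, {within `[0, +oo[, continuous (fun t => X t w)}) ->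
  \forall w \ae P, forall s, 0 <= s -> X u w @[u --> s^'+] --> X s w.
Proof.
apply: filterS => w /continuous_within_itvcyP[ci c0] s.
rewrite le_eqVlt => /predU1P[<-//|s0].
apply: cvg_at_right_filter; apply: ci.
by rewrite in_itv/= s0.
Qed.

End JointMeasurability.

(** * Test functions *)

Section Smooth.
Context {R : realType}.
Implicit Types f g : R -> R.

Definition smooth f : Prop := forall n x, derivable (derive1n n f) x 1.

(** A class of differentiable functions closed under derivation stays closed under all iterated
    derivatives. Exhibiting such a class replaces explicit formulas for the higher derivatives. *)
Lemma smooth_coind (S : set (R -> R)) :
  (forall f, S f -> (forall x, derivable f x 1) /\ S (derive1 f)) ->
  forall f, S f -> smooth f.
Proof.
move=> Sd f Sf n x.
have : S (derive1n n f) by elim: n => // n IHn; rewrite derive1nS; exact: (Sd _ IHn).2.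
by move=> /Sd[+ _]; exact.
Qed.

Lemma smooth_derive1 f : smooth f -> smooth (derive1 f).
Proof. by move=> sf n x; rewrite -derive1Sn; exact: sf. Qed.

Lemma smooth_derive1n n f : smooth f -> smooth (derive1n n f).
Proof. by move=> sf; elim: n => [|n IHn]; [exact: sf|exact: (smooth_derive1 IHn)]. Qed.

Lemma smooth_derivable f : smooth f -> forall x, derivable f x 1.
Proof. by move=> sf x; exact: (sf 0%N). Qed.

Lemma smooth_is_derive f (x : R) : smooth f -> is_derive x (1 : R) f (derive1 f x).
Proof. by move=> sf; rewrite derive1E; apply: DeriveDef => //; exact: smooth_derivable. Qed.

Lemma smooth_continuous f : smooth f -> continuous f.
Proof. by move=> sf; exact: is_derive1_continuous (fun x => smooth_is_derive x sf). Qed.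

Lemma is_derive1_mul f g (x df dg : R) : is_derive x (1 : R) f df -> is_derive x (1 : R) g dg ->
  is_derive x (1 : R) (fun y => f y * g y) (df * g x + f x * dg).
Proof.
move=> hf hg; apply: (is_derive_ext (is_deriveM hf hg)) => //.
by rewrite /GRing.scale/=; ring.
Qed.

Lemma is_derive1_comp_affine f (c u w x df : R) : is_derive (u * x + w) (1 : R) f df ->
  is_derive x (1 : R) (fun y => c * f (u * y + w)) (c * u * df).
Proof.
move=> hf; apply: (is_derive_ext (is_deriveZ c (@is_derive1_comp R f (fun y => u * y + w) x df u hf (is_derive_affine u w x)))) => //.
by rewrite /GRing.scale/=; ring.
Qed.

(** Finite sums of products of smooth functions: products alone are not closed under derivation, by
    the Leibniz rule. *)
Inductive smooth_algebra : set (R -> R) :=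
| smooth_algebraM f g : smooth f -> smooth g -> smooth_algebra (fun x => f x * g x)
| smooth_algebraD f g : smooth_algebra f -> smooth_algebra g ->
    smooth_algebra (fun x => f x + g x).

Lemma smoothM f g : smooth f -> smooth g -> smooth (fun x => f x * g x).
Proof.
move=> sf sg; apply: (@smooth_coind smooth_algebra); last exact: smooth_algebraM.
move=> h; elim=> {f g h sf sg} [f g sf sg|f g _ [df Sf] _ [dg Sg]].
  have dM x := is_derive1_mul (smooth_is_derive x sf) (smooth_is_derive x sg).
  split; first by move=> x; exact: is_derive1_derivable (dM x).
  have -> : derive1 (fun x => f x * g x) = (fun x => derive1 f x * g x + f x * derive1 g x).
    by apply/funext => x; exact: is_derive1_val (dM x).
  exact: smooth_algebraD (smooth_algebraM (smooth_derive1 sf) sg)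
    (smooth_algebraM sf (smooth_derive1 sg)).
have dD (x : R) : is_derive x (1 : R) (fun y => f y + g y) (derive1 f x + derive1 g x).
  by rewrite !derive1E; apply: is_deriveD; exact: DeriveDef.
split; first by move=> x; exact: is_derive1_derivable (dD x).
have -> : derive1 (fun x => f x + g x) = (fun x => derive1 f x + derive1 g x).
  by apply/funext => x; exact: is_derive1_val (dD x).
exact: smooth_algebraD.
Qed.

(** The prefactor [c] absorbs the powers of [u] produced by successive derivations, which closes the
    class. *)
Lemma smooth_comp_affine f (c u w : R) : smooth f -> smooth (fun x => c * f (u * x + w)).
Proof.
move=> sf; apply: (@smooth_coind [set h | exists c f, smooth f /\ h = fun x => c * f (u * x + w)]);
  last by exists c, f.
move=> _ [{sf}c [{}f [sf ->]]].
have dh x := is_derive1_comp_affine c (smooth_is_derive (u * x + w) sf).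
split; first by move=> x; exact: is_derive1_derivable (dh x).
exists (c * u), (derive1 f); split; first exact: smooth_derive1.
by apply/funext => x; exact: is_derive1_val (dh x).
Qed.

(** Writing the derivative as a phase shift by [pi / 2] keeps every derivative within the cosines,
    so sines need no separate treatment. *)
Lemma is_derive_cos_shift (c u w x : R) :
  is_derive x (1 : R) (fun y => c * cos (u * y + w)) (c * u * cos (u * x + (w + pi / 2))).
Proof.
have := is_derive1_comp_affine c (is_derive_cos (u * x + w)).
by rewrite addrA cosD cos_pihalf sin_pihalf mulr0 mulr1 sub0r.
Qed.

Lemma smooth_cos (u w : R) : smooth (fun x => cos (u * x + w)).
Proof.
apply: (@smooth_coind [set h | exists c w, h = fun x => c * cos (u * x + w)]); last first.
  by exists 1, w; apply/funext => x; rewrite mul1r.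
move=> _ [c [{}w ->]].
have dh x := is_derive_cos_shift c u w x.
split; first by move=> x; exact: is_derive1_derivable (dh x).
by exists (c * u), (w + pi / 2); apply/funext => x; exact: is_derive1_val (dh x).
Qed.

Lemma test_fun_smooth f : test_fun f -> smooth f.
Proof. by case. Qed.

Lemma test_fun_derive1 f : test_fun f -> test_fun (derive1 f).
Proof.
move=> [sf [M fM]]; split; first exact: smooth_derive1.
exists M => x Mx.
have : derive1 f x = derive1 (fun=> 0 : R) x.
  rewrite !derive1E; apply: near_eq_derive.
  have : `|y| @[y --> x] --> `|x| by exact: norm_continuous.
  move=> /cvgr_gt/(_ _ Mx); apply: filterS => y; exact: fM.
by move=> ->; rewrite derive1_cst.
Qed.

Lemma test_fun_bounded f : test_fun f -> exists K : R, forall x : R, `|f x| <= K.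
Proof.
move=> tf; have [sf [M fM]] := tf.
pose N := `|M| + 1.
have N0 : - N <= N by rewrite ge0_cp// addr_ge0.
have cf : {within `[- N, N], continuous (fun x : R => `|f x|)}.
  apply: continuous_subspaceT => x.
  by apply: cvg_norm; exact: smooth_continuous.
have [c _ cmax] := EVT_max N0 cf.
exists `|f c| => x.
have [xN|xN] := leP `|x| N; first by apply: cmax; rewrite in_itv/= -ler_norml.
by rewrite fM ?normr0// (le_lt_trans (ler_norm M))// (lt_trans _ xN)// ltrDl.
Qed.

Lemma test_fun_lipschitz f : test_fun f ->
  exists2 L : R, 0 <= L & forall x y : R, `|f x - f y| <= L * `|x - y|.
Proof.
move=> tf; have [L hL] := test_fun_bounded (test_fun_derive1 tf).
have sf := test_fun_smooth tf.
exists L => [|x y]; first exact: le_trans (normr_ge0 _) (hL 0).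
wlog xy : x y / y <= x => [H|].
  have [/H//|/ltW/H] := leP y x.
  by rewrite distrC (distrC x).
have [c _ ->] := MVT_segment xy (fun z _ => smooth_is_derive z sf)
  (continuous_subspaceT (smooth_continuous sf)).
by rewrite normrM ler_wpM2r.
Qed.

(* The cutoff is a rescaled copy of a given non-zero test function, so that no
   bump function has to be constructed. *)
Lemma trig_cutoff (f : R -> R) (x0 u w : R) : test_fun f -> f x0 != 0 ->
  exists2 g_ : nat -> R -> R, forall n, test_fun (g_ n) & exists K : R,
    [/\ forall n y, `|g_ n y| <= K,
        forall n y, `|derive1 (g_ n) y| <= K,
        forall n y, `|derive1n 2 (g_ n) y| <= K &
        forall y, [/\ g_ n y @[n --> \oo] --> cos (u * y + w),
          derive1 (g_ n) y @[n --> \oo] --> u * cos (u * y + (w + pi / 2)) &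
          derive1n 2 (g_ n) y @[n --> \oo] --> u * u * cos (u * y + (w + pi / 2 + pi / 2))]].
Proof.
move=> tf fx0; have sf := test_fun_smooth tf.
have tf1 := test_fun_derive1 tf; have tf2 := test_fun_derive1 tf1.
pose a := (f x0)^-1; pose k (n : nat) : R := n.+1%:R^-1.
have k0 n : 0 < k n by rewrite invr_gt0 ltr0n.
have k1 n : k n <= 1 by rewrite invf_le1 ?ltr0n// ler1n.
have kcvg : k n @[n --> \oo] --> (0 : R) by exact: cvg_harmonic.
(* [chi n 0] is the bump [f (k y + x0) / f x0], which flattens to the constant 1 as the scale [k]
   tends to 0; [chi n i] is its [i]-th derivative, of order [k^i]. *)
pose chi n i y := a * k n ^+ i * derive1n i f (k n * y + x0).
pose c0 y := cos (u * y + w).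
pose c1 y := u * cos (u * y + (w + pi / 2)).
pose c2 y := u * u * cos (u * y + (w + pi / 2 + pi / 2)).
have dchi n i (y : R) : is_derive y (1 : R) (chi n i) (chi n i.+1 y).
  have sfi := @smooth_derive1n i f sf.
  have := is_derive1_comp_affine (a * k n ^+ i) (smooth_is_derive (k n * y + x0) sfi).
  by rewrite /chi derive1nS exprSr !mulrA.
have dc0 (y : R) : is_derive y (1 : R) c0 (c1 y).
  have := is_derive_cos_shift 1 u w y; rewrite mul1r.
  by move=> h; apply: (is_derive_ext h) => // z; rewrite mul1r.
have dc1 (y : R) : is_derive y (1 : R) c1 (c2 y) := is_derive_cos_shift u u (w + pi / 2) y.
pose g n y := chi n 0%N y * c0 y.
have g1 n : derive1 (g n) = (fun y => chi n 1%N y * c0 y + chi n 0%N y * c1 y).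
  by apply/funext => y; exact: is_derive1_val (is_derive1_mul (dchi n 0%N y) (dc0 y)).
have g2 n : derive1n 2 (g n) = (fun y => chi n 2%N y * c0 y + chi n 1%N y * c1 y
    + (chi n 1%N y * c1 y + chi n 0%N y * c2 y)).
  apply/funext => y; rewrite derive1nS /= g1; apply: is_derive1_val.
  apply: is_deriveD; first exact: is_derive1_mul (dchi n 1%N y) (dc0 y).
  exact: is_derive1_mul (dchi n 0%N y) (dc1 y).
have [K0 hK0] := test_fun_bounded tf; have [K1 hK1] := test_fun_bounded tf1.
have [K2 hK2] := test_fun_bounded tf2.
have chiK n i Ki y : (forall x, `|derive1n i f x| <= Ki) -> `|chi n i y| <= `|a| * Ki.
  move=> hK; rewrite /chi 2!normrM -mulrA ler_wpM2l// normrX (gtr0_norm (k0 n)).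
  by apply: le_trans (hK (k n * y + x0)); rewrite ler_piMl// exprn_ile1// ltW.
have chi0 n y := chiK n 0%N K0 y hK0; have chi1 n y := chiK n 1%N K1 y hK1.
have chi2 n y := chiK n 2%N K2 y hK2.
have b0 y : `|c0 y| <= 1 by exact: normr_cos_le1.
have b1 y : `|c1 y| <= `|u| by rewrite normrM ler_piMr// normr_cos_le1.
have b2 y : `|c2 y| <= `|u * u| by rewrite normrM ler_piMr// normr_cos_le1.
have chic0 y : chi n 0%N y @[n --> \oo] --> (1 : R).
  have -> : 1 = a * (f x0) by rewrite mulVf.
  under eq_fun do rewrite /chi expr0 mulr1.
  apply: cvgM; first exact: cvg_cst.
  apply: (@cvg_comp _ _ _ (fun n => k n * y + x0) f); last exact: smooth_continuous.
  have : k n * y + x0 @[n --> \oo] --> 0 * y + x0.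
    by apply: cvgD; [apply: cvgM => //; exact: cvg_cst|exact: cvg_cst].
  by rewrite mul0r add0r.
have chici i Ki y : (0 < i)%N -> (forall x, `|derive1n i f x| <= Ki) ->
    chi n i y @[n --> \oo] --> (0 : R).
  move=> i0 hK; apply/norm_cvg0P.
  apply: (@squeeze_cvgr _ _ _ _ (fun=> 0) (fun n => `|a| * Ki * k n)).
  - apply: nearW => n; rewrite normr_ge0/= /chi 2!normrM normrX (gtr0_norm (k0 n)).
    rewrite -!mulrA ler_wpM2l// mulrC; apply: ler_pM => //; first by rewrite exprn_ge0// ltW.
    by case: i i0 {hK} => // i _; rewrite exprSr ler_piMl ?(ltW (k0 n))// exprn_ile1// ltW.
  - exact: cvg_cst.
  - by rewrite -[X in _ --> X](mulr0 (`|a| * Ki)); apply: cvgM => //; exact: cvg_cst.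
have chic1 y := chici 1%N K1 y isT hK1; have chic2 y := chici 2%N K2 y isT hK2.
exists g.
  move=> n; split.
    apply: smoothM; last exact: smooth_cos.
    rewrite /chi expr0 mulr1; exact: smooth_comp_affine.
  have [_ [M fM]] := tf; exists ((`|M| + `|x0|) / k n) => y yM.
  rewrite /g /chi /= fM ?mulr0 ?mul0r//.
  apply: (le_lt_trans (ler_norm M)).
  have : `|M| + `|x0| < `|k n * y|.
    by rewrite normrM (gtr0_norm (k0 n)) mulrC -ltr_pdivrMr.
  have := ler_normD (k n * y + x0) (- x0); rewrite addrK normrN.
  by move: (`|k n * y + x0|) (`|x0|) (`|M|) (`|k n * y|) => p1 p2 p3 p4; lra.
(* The sum of the bounds on all products occurring in [g] and its first two derivatives, so that one
   constant serves for the three. *)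
pose A := `|a| * K0 * 1 + `|a| * K1 * 1 + `|a| * K0 * `|u| + (`|a| * K2 * 1 + `|a| * K1 * `|u|
  + (`|a| * K1 * `|u| + `|a| * K0 * `|u * u|)).
have nn0 : 0 <= K0 by exact: le_trans (normr_ge0 _) (hK0 0).
have nn1 : 0 <= K1 by exact: le_trans (normr_ge0 _) (hK1 0).
have nn2 : 0 <= K2 by exact: le_trans (normr_ge0 _) (hK2 0).
have p00 n y : `|chi n 0%N y * c0 y| <= `|a| * K0 * 1 by rewrite normrM ler_pM.
have p10 n y : `|chi n 1%N y * c0 y| <= `|a| * K1 * 1 by rewrite normrM ler_pM.
have p01 n y : `|chi n 0%N y * c1 y| <= `|a| * K0 * `|u| by rewrite normrM ler_pM.
have p20 n y : `|chi n 2%N y * c0 y| <= `|a| * K2 * 1 by rewrite normrM ler_pM.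
have p11 n y : `|chi n 1%N y * c1 y| <= `|a| * K1 * `|u| by rewrite normrM ler_pM.
have p02 n y : `|chi n 0%N y * c2 y| <= `|a| * K0 * `|u * u| by rewrite normrM ler_pM.
have q00 : 0 <= `|a| * K0 * 1 by rewrite !mulr_ge0.
have q10 : 0 <= `|a| * K1 * 1 by rewrite !mulr_ge0.
have q01 : 0 <= `|a| * K0 * `|u| by rewrite !mulr_ge0.
have q20 : 0 <= `|a| * K2 * 1 by rewrite !mulr_ge0.
have q11 : 0 <= `|a| * K1 * `|u| by rewrite !mulr_ge0.
have q02 : 0 <= `|a| * K0 * `|u * u| by rewrite !mulr_ge0.
exists A; split.
- by move=> n y; apply: (le_trans (p00 n y)); rewrite /A; lra.
- move=> n y; rewrite g1; apply: (le_trans (ler_normD _ _)).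
  by have := p10 n y; have := p01 n y; rewrite /A; lra.
- move=> n y; rewrite g2; apply: (le_trans (ler_normD _ _)).
  apply: (le_trans (lerD (ler_normD _ _) (ler_normD _ _))).
  by have := p20 n y; have := p11 n y; have := p02 n y; rewrite /A; lra.
- move=> y; split.
  + have : g n y @[n --> \oo] --> 1 * c0 y.
      by apply: cvgM; [exact: chic0|exact: cvg_cst].
    by rewrite mul1r.
  + have : chi n 1%N y * c0 y + chi n 0%N y * c1 y @[n --> \oo] --> 0 * c0 y + 1 * c1 y.
      by apply: cvgD; apply: cvgM => //; exact: cvg_cst.
    rewrite mul0r add0r mul1r => h.
    by under eq_fun do rewrite g1; exact: h.
  + have : chi n 2%N y * c0 y + chi n 1%N y * c1 y +
        (chi n 1%N y * c1 y + chi n 0%N y * c2 y) @[n --> \oo] -->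
        0 * c0 y + 0 * c1 y + (0 * c1 y + 1 * c2 y).
      by apply: cvgD; apply: cvgD; apply: cvgM => //; exact: cvg_cst.
    rewrite !mul0r !add0r mul1r => h.
    by under eq_fun do rewrite g2; exact: h.
Qed.

End Smooth.

(** * Image measures and Fubini for integrable functions *)

Section Laws.
Context {R : realType} d d' (X : measurableType d) (Y : measurableType d').
Variables (m : {measure set X -> \bar R}) (nu : {measure set Y -> \bar R}) (phi : X -> Y).
Hypothesis mphi : measurable_fun setT phi.
Hypothesis law : forall A, measurable A -> nu A = m (phi @^-1` A).

Lemma ge0_integral_law (D : set Y) (F : Y -> \bar R) : measurable D ->
  measurable_fun setT F -> (forall y, (0 <= F y)%E) ->
  (\int[nu]_(y in D) F y = \int[m]_(x in phi @^-1` D) F (phi x))%E.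
Proof.
move=> mD mF F0.
rewrite -(@ge0_integral_pushforward _ _ _ _ R phi mphi m D F mD)//.
  by apply: eq_measure_integral => A mA _; rewrite law.
exact: measurable_funTS.
Qed.

(** Positive and negative parts are moved separately, so the identity also covers divergent
    integrals: at exceptional times [fp_adjoint] may fail to be integrable. *)
Lemma Rintegral_law (G : Y -> R) : measurable_fun setT G ->
  \int[nu]_y G y = \int[m]_x G (phi x).
Proof.
move=> mG; have mG' : measurable_fun setT (EFin \o G) by exact/measurable_EFinP.
rewrite /Rintegral integralE [in RHS]integralE; congr (fine (_ - _)).
  rewrite (ge0_integral_law measurableT (measurable_funepos mG'))// preimage_setT.
  by apply: eq_integral => x _; rewrite !unlock.
rewrite (ge0_integral_law measurableT (measurable_funeneg mG'))// preimage_setT.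
by apply: eq_integral => x _; rewrite !unlock.
Qed.

End Laws.

Section IntegrableFubini.
Context {R : realType} d d' (X : measurableType d) (Y : measurableType d').
Variables (m1 : {sigma_finite_measure set X -> \bar R})
          (m2 : {sigma_finite_measure set Y -> \bar R}).

(** The inner integral is finite for almost every [x] only; on the exceptional null set [fine]
    replaces it by a default value, which [integral_eq_off_null] absorbs. *)
Lemma Rintegral_prod_integrable (f : X * Y -> R) :
  (m1 \x m2)%E.-integrable setT (EFin \o f) ->
  \int[m1]_x \int[m2]_y f (x, y) = \int[(m1 \x m2)%E]_p f p.
Proof.
move=> iF; rewrite /Rintegral -(integral12_prod_meas1 iF); congr fine.
have [N [mN N0 sN]] := integrable_ae measurableT (integrable_fubini_F iF).
apply: (integral_eq_off_null mN N0) => x Nx; rewrite fineK//.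
by apply: contrapT => h; apply: Nx; apply: sN => /= /(_ I).
Qed.

End IntegrableFubini.

(** The integral is a supremum over simple functions, and a simple function below [f] is below
    [g]. *)
Lemma ge0_le_integral_nomeas {R : realType} d (X : measurableType d)
    (m : {measure set X -> \bar R}) (D : set X) (f g : X -> \bar R) :
  (forall x, D x -> 0 <= f x)%E -> (forall x, D x -> f x <= g x)%E ->
  (\int[m]_(x in D) f x <= \int[m]_(x in D) g x)%E.
Proof.
move=> f0 fg; rewrite integral_mkcond [leRHS]integral_mkcond !ge0_integralTE; last 2 first.
- move=> x; rewrite patchE; case: ifPn => // /set_mem Dx.
  exact: le_trans (f0 _ Dx) (fg _ Dx).
- by move=> x; rewrite patchE; case: ifPn => // /set_mem Dx; exact: f0.
apply: ge_ereal_sup => _ [h hf <-]; apply: ereal_sup_ubound; exists h => // x.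
apply: (le_trans (hf x)); rewrite !patchE.
by case: ifPn => // /set_mem Dx; exact: fg.
Qed.

(** Constructs [A |-> E[exp (i th); V \in A]]: the base is the law of [V], the density is made of
    the conditional expectations of [cos th] and [sin th] given [V]. Both are bounded by 1, whence
    the factor 2. The second clause admits unbounded [f], because the adjoint operator has unbounded
    coefficients. *)
Lemma law_cmeasure {R : realType} d (X : measurableType d) (P : probability X R)
    (V : {mfun X >-> R}) (th : X -> R) : measurable_fun setT th ->
  exists nu : @cmeasure R,
    (forall D (f : R -> R), measurable D -> measurable_fun setT f -> (forall x, 0 <= f x) ->
       (cm_absint nu D f <= 2%:E * \int[P]_(w in V @^-1` D) (f (V w))%:E)%E) /\
    (forall f : R -> R[i], cmeasurable f ->
       P.-integrable setT (EFin \o (fun w => complex.Re (f (V w)))) ->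
       P.-integrable setT (EFin \o (fun w => complex.Im (f (V w)))) ->
       cm_int nu f = cint P setT (fun w => f (V w) * expi (th w))).
Proof.
move=> mth.
have mc : measurable_fun setT (fun w => cos (th w)).
  by apply: measurableT_comp => //; apply: continuous_measurable_fun; exact: continuous_cos.
have ms : measurable_fun setT (fun w => sin (th w)).
  by apply: measurableT_comp => //; apply: continuous_measurable_fun; exact: continuous_sin.
have [g1 [mg1 bg1 eg1]] := cond_density P V mc (fun x => normr_cos_le1 _).
have [g2 [mg2 bg2 eg2]] := cond_density P V ms (fun x => normr_sin_le1 _).
have i1 : (distribution P V).-integrable setT (EFin \o g1).
  exact: bounded_integrable mg1 bg1.
have i2 : (distribution P V).-integrable setT (EFin \o g2).
  exact: bounded_integrable mg2 bg2.
have ic : P.-integrable setT (EFin \o (fun w => cos (th w))).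
  by apply: (bounded_integrable _ mc) => x; exact: normr_cos_le1.
have is_ : P.-integrable setT (EFin \o (fun w => sin (th w))).
  by apply: (bounded_integrable _ ms) => x; exact: normr_sin_le1.
have mV : measurable_fun setT V by exact: measurable_funPT.
have law A : measurable A -> distribution P V A = P (V @^-1` A) by [].
have @nu : @cmeasure R.
  by apply: (@CMeasure R (distribution P V) (fun x => g1 x +i* g2 x)).
exists nu; split.
  move=> D f mD mf f0; rewrite -(ge0_integral_law mV law mD (F := fun x => (f x)%:E)); last 2 first.
  - exact/measurable_EFinP.
  - by move=> y; rewrite lee_fin.
  rewrite /cm_absint /= -ge0_integralZl//; last 2 first.
  - by apply: measurable_funTS; exact/measurable_EFinP.
  - by move=> x _; rewrite lee_fin.
  apply: ge0_le_integral_nomeas => x _; first by rewrite lee_fin mulr_ge0// addr_ge0.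
  rewrite -EFinM lee_fin mulrC ler_wpM2r//.
  by rewrite (_ : 2 = 1 + 1)//; apply: lerD.
move=> f [mf1 mf2] if1 if2.
have push (h : R -> R) : measurable_fun setT h -> P.-integrable setT (EFin \o (h \o V)) ->
    (distribution P V).-integrable setT (EFin \o h).
  move=> mh /integrableP[_ ih]; apply/integrableP; split; first exact/measurable_EFinP.
  rewrite (ge0_integral_law mV law measurableT)//.
  by apply/measurable_EFinP; exact: measurableT_comp.
have bd d0 (Z : measurableType d0) (m : {measure set Z -> \bar R}) (h g : Z -> R) :
    measurable_fun setT g -> (forall x, `|g x| <= 1) -> m.-integrable setT (EFin \o h) ->
    m.-integrable setT (EFin \o (fun x => h x * g x)).
  move=> mg bg ih; have mh := measurable_int_EFin ih.
  apply: (le_integrable measurableT _ _ ih); first by apply/measurable_EFinP; exact: measurable_funM.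
  by move=> x _ /=; rewrite lee_fin normrM ler_piMr.
have tr (h : R -> R) : measurable_fun setT h -> P.-integrable setT (EFin \o (h \o V)) ->
    \int[distribution P V]_x (h x * g1 x) = \int[P]_w (h (V w) * cos (th w)).
  move=> mh ih; apply: (transfer (@measurable_id _ _ setT) mV i1 ic) => //.
    exact: bd mg1 bg1 (push _ mh ih).
  by apply: (bd _ _ _ _ _ mc) => // x; exact: normr_cos_le1.
have tr' (h : R -> R) : measurable_fun setT h -> P.-integrable setT (EFin \o (h \o V)) ->
    \int[distribution P V]_x (h x * g2 x) = \int[P]_w (h (V w) * sin (th w)).
  move=> mh ih; apply: (transfer (@measurable_id _ _ setT) mV i2 is_) => //.
    exact: bd mg2 bg2 (push _ mh ih).
  by apply: (bd _ _ _ _ _ ms) => // x; exact: normr_sin_le1.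
have bc h : P.-integrable setT (EFin \o h) -> P.-integrable setT (EFin \o (fun w => h w * cos (th w))).
  by apply: bd => // x; exact: normr_cos_le1.
have bs h : P.-integrable setT (EFin \o h) -> P.-integrable setT (EFin \o (fun w => h w * sin (th w))).
  by apply: bd => // x; exact: normr_sin_le1.
apply: complexE => /=.
  under [LHS]eq_Rintegral do rewrite ReM /=.
  under [RHS]eq_Rintegral do rewrite ReM Re_expi Im_expi.
  rewrite RintegralB//; last 2 first.
  - exact: bd mg1 bg1 (push _ mf1 if1).
  - exact: bd mg2 bg2 (push _ mf2 if2).
  by rewrite RintegralB//; [rewrite tr// tr'//|exact: bc|exact: bs].
under [LHS]eq_Rintegral do rewrite ImM /=.
under [RHS]eq_Rintegral do rewrite ImM Re_expi Im_expi.
rewrite RintegralD//; last 2 first.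
- exact: bd mg2 bg2 (push _ mf1 if1).
- exact: bd mg1 bg1 (push _ mf2 if2).
by rewrite RintegralD//; [rewrite tr// tr'//|exact: bs|exact: bc].
Qed.

(** * Fourier transform of the Fokker-Planck equation *)

Section FokkerPlanckFourier.
Context {R : realType} d (Omega : measurableType d) (P : probability Omega R).
Variables (mu sigma : R -> R -> R) (q : R -> probability (R * R * R)%type R).
Variables (V T B : R * Omega -> R).
Hypothesis mmu : measurable_fun [set p : R * R | 0 <= p.1] (fun p => mu p.1 p.2).
Hypothesis msigma : measurable_fun [set p : R * R | 0 <= p.1] (fun p => sigma p.1 p.2).
Hypotheses (mV : measurable_fun setT V) (mT : measurable_fun setT T)
  (mB : measurable_fun setT B).
Hypothesis flow : forall s A, 0 <= s -> measurable A ->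
  q s A = P [set w | A (V (s, w), T (s, w), B (s, w))].
Hypothesis fps : fp_solution mu sigma q.
Notation leb := (@lebesgue_measure R).

(** [mu] and [sigma] are measurable on nonnegative times; clamping the time extends this to all of
    [R * R] and changes nothing on [[0, t]]. *)
Let clamp (s : R) : R := Num.max s 0.

Let clamp_ge0 s : 0 <= clamp s. Proof. by rewrite /clamp le_max lexx orbT. Qed.

Let clampK s : 0 <= s -> clamp s = s.
Proof. by move=> s0; rewrite /clamp max_l. Qed.

Let measurable_clamp_comp (f : R -> R -> R) :
  measurable_fun [set p : R * R | 0 <= p.1] (fun p => f p.1 p.2) ->
  measurable_fun setT (fun p : R * R => f (clamp p.1) p.2).
Proof.
move=> mf.
have mD : measurable [set p : R * R | 0 <= p.1].
  have -> : [set p : R * R | 0 <= p.1] = [set` `[0, +oo[] `*` setT.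
    by apply/seteqP; split => p /=; rewrite in_itv/= andbT => //; case.
  by apply: measurableX => //; exact: measurable_itv.
apply: (@measurable_comp _ _ _ _ _ _ _ _ setT (fun p : R * R => (clamp p.1, p.2)) mD _ mf).
  by move=> _ [p _ <-] /=; exact: clamp_ge0.
apply: measurable_fun_pair => //.
by apply: measurable_maxr => //; exact: measurable_fst.
Qed.

Let mmuC := measurable_clamp_comp mmu.
Let msigmaC := measurable_clamp_comp msigma.

Let state s w : R * R * R := (V (s, w), T (s, w), B (s, w)).

Let mstate s : measurable_fun setT (state s).
Proof.
have m1 (f : R * Omega -> R) : measurable_fun setT f -> measurable_fun setT (fun w => f (s, w)).
  by move=> mf; exact: (measurableT_comp mf (pair1_measurable s)).
by apply: measurable_fun_pair; [apply: measurable_fun_pair; exact: m1|exact: m1].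
Qed.

Let law_state s : 0 <= s -> forall A, measurable A -> q s A = P (state s @^-1` A).
Proof. by move=> s0 A mA; exact: flow. Qed.

Let I t : set R := [set` `[0, t]].

Let Ifun t (s : R) : R := \1_(I t) s.

Let Hj t (f g h : R -> R) (p : R * Omega) : R :=
  Ifun t p.1 * fp_adjoint mu sigma f g h (clamp p.1) (state p.1 p.2).

Let mIfun t : measurable_fun setT (fun p : R * Omega => Ifun t p.1).
Proof.
by apply: measurableT_comp => //; apply: measurable_indic; exact: measurable_itv.
Qed.

Let mmuJ : measurable_fun setT (fun p : R * Omega => mu (clamp p.1) (V p)).
Proof.
apply: (measurableT_comp mmuC (g := fun p : R * Omega => (p.1, V p))).
by apply: measurable_fun_pair.
Qed.

Let msigmaJ : measurable_fun setT (fun p : R * Omega => sigma (clamp p.1) (V p)).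
Proof.
apply: (measurableT_comp msigmaC (g := fun p : R * Omega => (p.1, V p))).
by apply: measurable_fun_pair.
Qed.

Lemma smooth_measurable (f : R -> R) : smooth f -> measurable_fun setT f.
Proof. by move=> sf; apply: continuous_measurable_fun; exact: smooth_continuous. Qed.

Let measurable_adjoint d0 (Z : measurableType d0) (a b x y z : Z -> R) (f g h : R -> R) :
  smooth f -> smooth g -> smooth h ->
  measurable_fun setT a -> measurable_fun setT b -> measurable_fun setT x ->
  measurable_fun setT y -> measurable_fun setT z ->
  measurable_fun setT (fun p =>
    b p ^+ 2 / 2 * derive1n 2 f (x p) * g (y p) * h (z p)
    + b p * derive1 f (x p) * g (y p) * derive1 h (z p)
    + f (x p) * g (y p) * derive1n 2 h (z p) / 2
    + a p * derive1 f (x p) * g (y p) * h (z p)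
    + x p * f (x p) * derive1 g (y p) * h (z p)).
Proof.
move=> sf sg sh ma mb mx my mz.
have mf := smooth_measurable sf; have mg := smooth_measurable sg.
have mh := smooth_measurable sh.
have mf1 := smooth_measurable (smooth_derive1 sf).
have mf2 := smooth_measurable (@smooth_derive1n _ 2 _ sf).
have mg1 := smooth_measurable (smooth_derive1 sg).
have mh1 := smooth_measurable (smooth_derive1 sh).
have mh2 := smooth_measurable (@smooth_derive1n _ 2 _ sh).
have c (u : R -> R) (v : Z -> R) : measurable_fun setT u -> measurable_fun setT v ->
  measurable_fun setT (fun p => u (v p)) by move=> mu_ mv; exact: (measurableT_comp mu_ mv).
have cf := c _ _ mf mx; have cf1 := c _ _ mf1 mx; have cf2 := c _ _ mf2 mx.
have cg := c _ _ mg my; have cg1 := c _ _ mg1 my.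
have ch := c _ _ mh mz; have ch1 := c _ _ mh1 mz; have ch2 := c _ _ mh2 mz.
have mb2 : measurable_fun setT (fun p => b p ^+ 2 / 2).
  by apply: measurable_funM => //; exact: measurable_funX.
have m4 (u1 u2 u3 u4 : Z -> R) : measurable_fun setT u1 -> measurable_fun setT u2 ->
    measurable_fun setT u3 -> measurable_fun setT u4 ->
    measurable_fun setT (fun p => u1 p * u2 p * u3 p * u4 p).
  move=> m1 m2 m3 m4.
  exact: measurable_funM (measurable_funM (measurable_funM m1 m2) m3) m4.
have t1 := m4 _ _ _ _ mb2 cf2 cg ch.
have t2 := m4 _ _ _ _ mb cf1 cg ch1.
have t3 : measurable_fun setT (fun p => f (x p) * g (y p) * derive1n 2 h (z p) / 2).
  by apply: m4 => //; exact: measurable_cst.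
have t4 := m4 _ _ _ _ ma cf1 cg ch.
have t5 := m4 _ _ _ _ mx cf cg1 ch.
exact: measurable_funD (measurable_funD (measurable_funD (measurable_funD t1 t2) t3) t4) t5.
Qed.

Let mHj t f g h : smooth f -> smooth g -> smooth h -> measurable_fun setT (Hj t f g h).
Proof.
move=> sf sg sh; apply: measurable_funM => //.
have eta (F : R * Omega -> R) : measurable_fun setT F ->
    measurable_fun setT (fun p : R * Omega => F (p.1, p.2)).
  by apply: eq_measurable_fun => -[].
exact: (@measurable_adjoint _ _ (fun p : R * Omega => mu (clamp p.1) (V (p.1, p.2)))
  (fun p => sigma (clamp p.1) (V (p.1, p.2))) (fun p => V (p.1, p.2))
  (fun p => T (p.1, p.2)) (fun p => B (p.1, p.2)) f g h sf sg sh
  (eta _ mmuJ) (eta _ msigmaJ) (eta _ mV) (eta _ mT) (eta _ mB)).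
Qed.

(** The integrand of the local integrability clause of [fp_solution], carried from the laws [q s] to
    [R * Omega]. It dominates the unbounded coefficients once [k] exceeds the support of the test
    function in [x]. *)
Let D2 t k (p : R * Omega) : R :=
  Ifun t p.1 * (\1_[set x | `|x| <= k] (V p)) *
  (`|mu (clamp p.1) (V p)| + sigma (clamp p.1) (V p) ^+ 2).

Let mk k : measurable [set x : R | `|x| <= k].
Proof.
have -> : [set x : R | `|x| <= k] = [set` `[- k, k]].
  by apply/seteqP; split => x /=; rewrite in_itv/= ler_norml.
exact: measurable_itv.
Qed.

Let mweight : measurable_fun setT
  (fun p : R * Omega => `|mu (clamp p.1) (V p)| + sigma (clamp p.1) (V p) ^+ 2).
Proof.
apply: measurable_funD; first exact: measurableT_comp.
exact: measurable_funX.
Qed.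

Let mindV k : measurable_fun setT (fun p : R * Omega => (\1_[set x | `|x| <= k] (V p) : R)).
Proof. by apply: measurableT_comp => //; apply: measurable_indic; exact: mk. Qed.

Let mD2 t k : measurable_fun setT (D2 t k).
Proof. by apply: measurable_funM => //; exact: measurable_funM. Qed.

Let D2_ge0 t k p : 0 <= D2 t k p.
Proof.
rewrite /D2; apply: mulr_ge0; last by apply: addr_ge0 => //; exact: sqr_ge0.
by apply: mulr_ge0; rewrite /Ifun indicE.
Qed.

Let D2_inner t k s : I t s ->
  (\int[P]_w (D2 t k (s, w))%:E =
   \int[q s]_(p in [set p | (`|p.1.1| <= k)%R]) (`|mu s p.1.1| + sigma s p.1.1 ^+ 2)%:E)%E.
Proof.
move=> Is; have s0 : 0 <= s by move: Is; rewrite /I /= in_itv/= => /andP[].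
have mG : measurable_fun setT (fun p : R * R * R => (`|mu s p.1.1| + sigma s p.1.1 ^+ 2)%:E).
  apply/measurable_EFinP; apply: measurable_funD.
    apply: measurableT_comp => //.
    have := measurableT_comp mmuC (g := fun p : R * R * R => (s, p.1.1)).
    rewrite /comp /= clampK//; apply.
    by apply: measurable_fun_pair => //; exact: measurableT_comp.
  apply: measurable_funX.
  have := measurableT_comp msigmaC (g := fun p : R * R * R => (s, p.1.1)).
  rewrite /comp /= clampK//; apply.
  by apply: measurable_fun_pair => //; exact: measurableT_comp.
have mD : measurable [set p : R * R * R | `|p.1.1| <= k].
  have -> : [set p : R * R * R | `|p.1.1| <= k] = ([set x | `|x| <= k] `*` setT) `*` setT.
    by apply/seteqP; split => [[[x y] z]|[[x y] z] [[]]].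
  by apply: measurableX => //; apply: measurableX => //; exact: mk.
rewrite (ge0_integral_law (mstate s) (law_state s0) mD mG); last first.
  by move=> p; rewrite lee_fin addr_ge0// sqr_ge0.
rewrite [RHS]integral_mkcond; apply: eq_integral => w _.
rewrite /D2 /Ifun /= indicE mem_set// mul1r clampK// patchE indicE.
have -> : (w \in state s @^-1` [set p | `|p.1.1| <= k]) = (V (s, w) \in [set x | `|x| <= k]).
  by apply/idP/idP => /set_mem h; apply/mem_set; exact: h.
by case: ifPn => _; rewrite ?mul1r ?mul0r.
Qed.

Let integrable_D2 t k : 0 <= t -> (leb \x P)%E.-integrable setT (EFin \o D2 t k).
Proof.
move=> t0; have mD2' : measurable_fun setT (EFin \o D2 t k) by exact/measurable_EFinP.
apply: (@integrable12ltyP _ _ _ _ R leb P _ mD2').2.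
have := fps.1 t k t0; apply: le_lt_trans.
rewrite [leRHS]integral_mkcond; apply: ge0_le_integral_nomeas.
  by move=> s _; apply: integral_ge0 => w _; exact: abse_ge0.
move=> s _; rewrite patchE; case: ifPn => [/set_mem Is|/negP nIs].
  rewrite -(@D2_inner t k s Is); apply: ge0_le_integral_nomeas => w _; first exact: abse_ge0.
  by rewrite gee0_abs// lee_fin.
rewrite integral0_eq// => w _; rewrite /= /D2 /Ifun indicE memNset ?mul0r ?normr0//.
by move=> Is; apply: nIs; exact/mem_set.
Qed.

Let integrable_Ifun t : (leb \x P)%E.-integrable setT (EFin \o (fun p => Ifun t p.1)).
Proof.
have m1 : measurable_fun setT (EFin \o (fun p : R * Omega => Ifun t p.1)) by exact/measurable_EFinP.
apply: (@integrable12ltyP _ _ _ _ R leb P _ m1).2.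
apply: (@le_lt_trans _ _ (\int[leb]_s (\1_(I t) s)%:E)%E).
  apply: ge0_le_integral_nomeas => s _; first by apply: integral_ge0 => w _; exact: abse_ge0.
  have -> : (\int[P]_y `|(EFin \o (fun p : R * Omega => Ifun t p.1)) (s, y)| = \int[P]_y (\1_(I t) s)%:E)%E.
    by apply: eq_integral => w _; rewrite /= ger0_norm// /Ifun indicE.
  rewrite integral_cst//.
  rewrite [X in (_ * X <= _)%E](_ : _ = 1%E) ?mule1//.
  exact: probability_setT.
rewrite integral_indic//; last exact: measurable_itv.
rewrite setIT; have : (lebesgue_measure (I t) < +oo)%E; last by [].
by rewrite /I lebesgue_measure_itv/=; case: ifP => // _; rewrite -EFinB ltry.
Qed.

Let weight t k C (p : R * Omega) : R := C * (Ifun t p.1 + D2 t k p).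

Let integrable_weight t k C : 0 <= t -> (leb \x P)%E.-integrable setT (EFin \o weight t k C).
Proof.
move=> t0; exact: (integrableZl measurableT C
  (integrableD measurableT (integrable_Ifun t) (integrable_D2 k t0))).
Qed.

(** The order of quantifiers matters: [k] depends on [f] only, and [C] on [f] and on the common
    bound [K] of [g], [h] and their derivatives. A whole sequence of cutoffs thus shares one
    dominating function. *)
Let adjoint_bound (f : R -> R) : test_fun f -> exists k, forall K, 0 <= K -> exists C,
  forall t (g h : R -> R) p,
    (forall y, `|g y| <= K) -> (forall y, `|derive1 g y| <= K) ->
    (forall y, `|h y| <= K) -> (forall y, `|derive1 h y| <= K) ->
    (forall y, `|derive1n 2 h y| <= K) ->
    `|Hj t f g h p| <= weight t k C p.
Proof.
move=> tf; have tf1 := test_fun_derive1 tf; have tf2 := test_fun_derive1 tf1.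
have [F0 hF0] := test_fun_bounded tf; have [F1 hF1] := test_fun_bounded tf1.
have [F2 hF2] := test_fun_bounded tf2.
have [_ [M0 hM0]] := tf; have [_ [M1 hM1]] := tf1; have [_ [M2 hM2]] := tf2.
pose k := `|M0| + `|M1| + `|M2|.
have kM0 : M0 <= k by rewrite /k (le_trans (ler_norm _))// -addrA lerDl addr_ge0.
have kM1 : M1 <= k by rewrite /k (le_trans (ler_norm _))// addrAC lerDr addr_ge0.
have kM2 : M2 <= k by rewrite /k (le_trans (ler_norm _))// lerDr addr_ge0.
have k0 : 0 <= k by rewrite /k !addr_ge0.
exists k => K K0.
(* Bounds [f], its first two derivatives and [x * f x]; the last term accounts for [|x| <= k] on the
   support. *)
pose F := F0 + F1 + F2 + k * F0.
have f00 : 0 <= F0 by exact: le_trans (normr_ge0 _) (hF0 0).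
have f10 : 0 <= F1 by exact: le_trans (normr_ge0 _) (hF1 0).
have f20 : 0 <= F2 by exact: le_trans (normr_ge0 _) (hF2 0).
have kF0 : 0 <= k * F0 by rewrite mulr_ge0.
exists (2 * (F * (K * K))) => t g h p bg bg1 bh bh1 bh2.
rewrite /Hj /weight /D2 normrM.
have I0 : 0 <= Ifun t p.1 by rewrite /Ifun indicE.
rewrite (ger0_norm I0).
set x := V p; set s := clamp p.1; set m := mu s x; set b := sigma s x.
have -> : 2 * (F * (K * K)) * (Ifun t p.1 + Ifun t p.1 * \1_[set x0 | `|x0| <= k] x * (`|m| + b ^+ 2)) =
    Ifun t p.1 * (F * (K * K) * (2 + 2 * \1_[set x0 | `|x0| <= k] x * (`|m| + b ^+ 2))).
  by ring.
rewrite ler_wpM2l//.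
have FK0 : 0 <= F * (K * K) by rewrite !mulr_ge0// /F !addr_ge0.
have Vp : V (p.1, p.2) = x by rewrite /x -surjective_pairing.
rewrite /fp_adjoint /state /= Vp -/s -/m -/b.
have [xk|xk] := leP `|x| k; last first.
  have z0 : f x = 0 by apply: hM0; exact: le_lt_trans xk.
  have z1 : derive1 f x = 0 by apply: hM1; exact: le_lt_trans xk.
  have z2 : derive1 (derive1 f) x = 0 by apply: hM2; exact: le_lt_trans xk.
  rewrite z0 z1 z2 !(mulr0, mul0r) !addr0 normr0 mulr_ge0//.
  by rewrite addr_ge0// mulr_ge0 ?addr_ge0 ?sqr_ge0// mulr_ge0// indicE.
rewrite indicE mem_set//= mulr1.
have b0 := bg (T (p.1, p.2)); have b1 := bg1 (T (p.1, p.2)).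
have c0 := bh (B (p.1, p.2)); have c1 := bh1 (B (p.1, p.2)); have c2 : `|derive1 (derive1 h) (B (p.1, p.2))| <= K := bh2 _.
move: b0 b1 c0 c1 c2; move: (g _) (derive1 g _) (h _) (derive1 h _) (derive1 (derive1 h) _).
move=> g0 g1 h0 h1 h2 b0 b1 c0 c1 c2.
have FF0 : F0 <= F by rewrite /F; lra.
have FF1 : F1 <= F by rewrite /F; lra.
have FF2 : F2 <= F by rewrite /F; lra.
have FFk : k * F0 <= F by rewrite /F; lra.
have d0 : `|f x| <= F := le_trans (hF0 x) FF0.
have d1 : `|derive1 f x| <= F := le_trans (hF1 x) FF1.
have d2 : `|derive1 (derive1 f) x| <= F := le_trans (hF2 x) FF2.
have d3 : `|x * f x| <= F by rewrite normrM; apply: le_trans FFk; exact: ler_pM.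
have tri (c y1 y2 y3 : R) : `|y1| <= F -> `|y2| <= K -> `|y3| <= K ->
    `|c * y1 * y2 * y3| <= `|c| * (F * (K * K)).
  move=> h1' h2' h3'; rewrite -!mulrA normrM ler_wpM2l// !normrM.
  by apply: ler_pM => //; apply: ler_pM.
have e1 := tri (b ^+ 2 / 2) _ _ _ d2 b0 c0.
have e2 := tri b _ _ _ d1 b0 c1.
have e3 := tri (2^-1) _ _ _ d0 b0 c2.
have e4 := tri m _ _ _ d1 b0 c0.
have e5 := tri 1 _ _ _ d3 b1 c0.
rewrite (_ : f x * g0 * h2 / 2 = 2^-1 * f x * g0 * h2); last by ring.
rewrite -(mul1r (x * f x)).
apply: (le_trans (ler_normD _ _)); apply: (le_trans (lerD (ler_normD _ _) (lexx _))).
apply: (le_trans (lerD (lerD (ler_normD _ _) (lexx _)) (lexx _))).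
apply: (le_trans (lerD (lerD (lerD (ler_normD _ _) (lexx _)) (lexx _)) (lexx _))).
apply: (le_trans (lerD (lerD (lerD (lerD e1 e2) e3) e4) e5)).
rewrite -!mulrDl mulrC ler_wpM2l//.
(* With this the five coefficients add up to at most [2 + b^2 + |m|], which explains the factor 2 in
   the chosen constant. *)
have bb : `|b| <= (1 + b ^+ 2) / 2.
  rewrite -(real_normK (num_real b)); have := sqr_ge0 (`|b| - 1); rewrite sqrrB1.
  by move: (`|b|) => z; lra.
rewrite (ger0_norm (_ : 0 <= b ^+ 2 / 2)); last by rewrite divr_ge0 ?sqr_ge0.
rewrite (ger0_norm (_ : 0 <= 2^-1)); last by rewrite invr_ge0.
by rewrite normr1; have := normr_ge0 m; have := sqr_ge0 b; lra.
Qed.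


Let measurable_fp_adjoint f g h s : 0 <= s -> smooth f -> smooth g -> smooth h ->
  measurable_fun setT (fp_adjoint mu sigma f g h s).
Proof.
move=> s0 sf sg sh.
have m11 : measurable_fun setT (fun p : R * R * R => p.1.1) by exact: measurableT_comp.
have m12 : measurable_fun setT (fun p : R * R * R => p.1.2) by exact: measurableT_comp.
have mm : measurable_fun setT (fun p : R * R * R => mu s p.1.1).
  have := measurableT_comp mmuC (g := fun p : R * R * R => (s, p.1.1)).
  by rewrite /comp /= clampK//; apply; exact: measurable_fun_pair.
have ms : measurable_fun setT (fun p : R * R * R => sigma s p.1.1).
  have := measurableT_comp msigmaC (g := fun p : R * R * R => (s, p.1.1)).
  by rewrite /comp /= clampK//; apply; exact: measurable_fun_pair.
exact: (@measurable_adjoint _ _ (fun p : R * R * R => mu s p.1.1)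
  (fun p => sigma s p.1.1) (fun p => p.1.1) (fun p => p.1.2) (fun p => p.2) f g h sf sg sh
  mm ms m11 m12 (@measurable_snd _ _ _ _)).
Qed.

Let integrable_Hj t f g h K : 0 <= t -> test_fun f -> smooth g -> smooth h -> 0 <= K ->
  (forall y, `|g y| <= K) -> (forall y, `|derive1 g y| <= K) ->
  (forall y, `|h y| <= K) -> (forall y, `|derive1 h y| <= K) ->
  (forall y, `|derive1n 2 h y| <= K) ->
  (leb \x P)%E.-integrable setT (EFin \o Hj t f g h).
Proof.
move=> t0 tf sg sh K0 b0 b1 c0 c1 c2.
have [k /(_ K K0)[C hC]] := adjoint_bound tf.
apply: (le_integrable measurableT _ _ (integrable_weight k C t0)).
  by apply/measurable_EFinP; exact: (mHj t (test_fun_smooth tf) sg sh).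
by move=> p _ /=; rewrite lee_fin (le_trans (hC t g h p b0 b1 c0 c1 c2))// ler_norm.
Qed.

Let fp_prod t f g h K : 0 <= t -> test_fun f -> test_fun g -> test_fun h -> 0 <= K ->
  (forall y, `|g y| <= K) -> (forall y, `|derive1 g y| <= K) ->
  (forall y, `|h y| <= K) -> (forall y, `|derive1 h y| <= K) ->
  (forall y, `|derive1n 2 h y| <= K) ->
  \int[P]_w (f (V (t, w)) * g (T (t, w)) * h (B (t, w))) =
  f 1 * g 0 * h 0 + \int[(leb \x P)%E]_p Hj t f g h p.
Proof.
move=> t0 tf tg th K0 b0 b1 c0 c1 c2.
have [sf [sg sh]] := (test_fun_smooth tf, (test_fun_smooth tg, test_fun_smooth th)).
have mfgh : measurable_fun setT (fun p : R * R * R => f p.1.1 * g p.1.2 * h p.2).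
  apply: measurable_funM; last exact: (measurableT_comp (smooth_measurable sh)).
  apply: measurable_funM; apply: (measurableT_comp (smooth_measurable _)) => //;
    exact: measurableT_comp.
have := fps.2 f g h t tf tg th t0.
rewrite (Rintegral_law (mstate t) (law_state t0) mfgh) => ->; congr (_ + _).
rewrite -(Rintegral_prod_integrable (integrable_Hj t0 tf sg sh K0 b0 b1 c0 c1 c2)).
rewrite Rintegral_mkcond; apply: eq_Rintegral => s _; rewrite patchE.
case: ifPn => [/set_mem Is|/negP nIs].
  have s0 : 0 <= s by move: Is; rewrite /= in_itv/= => /andP[].
  rewrite (Rintegral_law (mstate s) (law_state s0) (measurable_fp_adjoint s0 sf sg sh)).
  by apply: eq_Rintegral => w _; rewrite /Hj /Ifun indicE mem_set// mul1r clampK.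
have -> : \int[P]_y Hj t f g h (s, y) = \int[P]_y (cst 0 y).
  apply: eq_Rintegral => w _; rewrite /Hj /Ifun indicE memNset ?mul0r// => Is.
  by apply: nIs; exact/mem_set.
by rewrite Rintegral_cst// mul0r.
Qed.

Lemma derive1_cos_shift (u w y : R) :
  derive1 (fun y => cos (u * y + w)) y = u * cos (u * y + (w + pi / 2)).
Proof.
apply: is_derive1_val; have := is_derive_cos_shift 1 u w y; rewrite mul1r => h.
by apply: (is_derive_ext h) => // z; rewrite mul1r.
Qed.

Lemma derive1n2_cos_shift (u w y : R) :
  derive1n 2 (fun y => cos (u * y + w)) y = u * u * cos (u * y + (w + pi / 2 + pi / 2)).
Proof.
have E : derive1 (fun y => cos (u * y + w)) = fun z => u * cos (u * z + (w + pi / 2)).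
  by apply/funext => z; exact: derive1_cos_shift.
rewrite derive1nS /= E.
exact: is_derive1_val (is_derive_cos_shift u u (w + pi / 2) y).
Qed.

Let trig_bounds (u w : R) (K := 1 + `|u| + `|u * u|) :
  [/\ 0 <= K, forall y, `|cos (u * y + w)| <= K,
      forall y, `|derive1 (fun y => cos (u * y + w)) y| <= K &
      forall y, `|derive1n 2 (fun y => cos (u * y + w)) y| <= K].
Proof.
have u0 := normr_ge0 u; have uu0 := normr_ge0 (u * u).
split; first by rewrite /K; lra.
- by move=> y; apply: (le_trans (normr_cos_le1 _)); rewrite /K; lra.
- move=> y; rewrite derive1_cos_shift normrM; apply: (@le_trans _ _ `|u|).
    by rewrite ler_piMr// normr_cos_le1.
  by rewrite /K; lra.
- move=> y; rewrite derive1n2_cos_shift normrM; apply: (@le_trans _ _ `|u * u|).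
    by rewrite ler_piMr// normr_cos_le1.
  by rewrite /K; lra.
Qed.

Let integrable_Htrig t f xi w1 eta w2 : 0 <= t -> test_fun f ->
  (leb \x P)%E.-integrable setT
    (EFin \o Hj t f (fun y => cos (xi * y + w1)) (fun z => cos (eta * z + w2))).
Proof.
move=> t0 tf.
have [k1 b0 b1 _] := trig_bounds xi w1; have [k2 c0 c1 c2] := trig_bounds eta w2.
apply: (@integrable_Hj t f _ _ (1 + `|xi| + `|xi * xi| + (1 + `|eta| + `|eta * eta|))) => //.
- exact: smooth_cos.
- exact: smooth_cos.
- by move=> y; rewrite (le_trans (b0 y))// lerDl.
- by move=> y; rewrite (le_trans (b1 y))// lerDl.
- by move=> y; rewrite (le_trans (c0 y))// lerDr.
- by move=> y; rewrite (le_trans (c1 y))// lerDr.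
- by move=> y; rewrite (le_trans (c2 y))// lerDr.
Qed.

Let measurable_prod3 t (u1 u2 u3 : R -> R) :
  measurable_fun setT u1 -> measurable_fun setT u2 -> measurable_fun setT u3 ->
  measurable_fun setT (fun w => u1 (V (t, w)) * u2 (T (t, w)) * u3 (B (t, w))).
Proof.
have m1 (G : R * Omega -> R) (u : R -> R) : measurable_fun setT G -> measurable_fun setT u ->
    measurable_fun setT (fun w => u (G (t, w))).
  move=> mG mu_; exact: (measurableT_comp mu_ (measurableT_comp mG (pair1_measurable t))).
move=> h1 h2 h3; exact: measurable_funM (measurable_funM (m1 _ _ mV h1) (m1 _ _ mT h2)) (m1 _ _ mB h3).
Qed.

(** The cosines in [y] and [z] are limits of test functions, and both sides converge by domination.
    The test function [f] in [x] also supplies the bump for these cutoffs, hence the condition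
    [f x0 != 0]. *)
Let fp_trig t f x0 xi w1 eta w2 : 0 <= t -> test_fun f -> f x0 != 0 ->
  \int[P]_w (f (V (t, w)) * cos (xi * T (t, w) + w1) * cos (eta * B (t, w) + w2)) =
  f 1 * cos w1 * cos w2 +
  \int[(leb \x P)%E]_p Hj t f (fun y => cos (xi * y + w1)) (fun z => cos (eta * z + w2)) p.
Proof.
move=> t0 tf fx0; have sf := test_fun_smooth tf.
have [g_ tg [Kg [bg0 bg1 _ cg]]] := trig_cutoff xi w1 tf fx0.
have [h_ th [Kh [bh0 bh1 bh2 ch]]] := trig_cutoff eta w2 tf fx0.
have Kg0 : 0 <= Kg by exact: le_trans (normr_ge0 _) (bg0 0%N 0).
have Kh0 : 0 <= Kh by exact: le_trans (normr_ge0 _) (bh0 0%N 0).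
pose K := Kg + Kh; have K0 : 0 <= K by rewrite addr_ge0.
have b0 n y : `|g_ n y| <= K by rewrite (le_trans (bg0 n y))// lerDl.
have b1 n y : `|derive1 (g_ n) y| <= K by rewrite (le_trans (bg1 n y))// lerDl.
have c0 n y : `|h_ n y| <= K by rewrite (le_trans (bh0 n y))// lerDr.
have c1 n y : `|derive1 (h_ n) y| <= K by rewrite (le_trans (bh1 n y))// lerDr.
have c2 n y : `|derive1n 2 (h_ n) y| <= K by rewrite (le_trans (bh2 n y))// lerDr.
have [F hF] := test_fun_bounded tf.
have F0 : 0 <= F by exact: le_trans (normr_ge0 _) (hF 0).
have E n := fp_prod t0 tf (tg n) (th n) K0 (b0 n) (b1 n) (c0 n) (c1 n) (c2 n).
have lhs : \int[P]_w (f (V (t, w)) * g_ n (T (t, w)) * h_ n (B (t, w))) @[n --> \oo] -->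
    \int[P]_w (f (V (t, w)) * cos (xi * T (t, w) + w1) * cos (eta * B (t, w) + w2)).
  apply: (@bounded_dct _ _ _ P (fun n w => f (V (t, w)) * g_ n (T (t, w)) * h_ n (B (t, w)))
    (fun w => f (V (t, w)) * cos (xi * T (t, w) + w1) * cos (eta * B (t, w) + w2)) (F * K * K)).
  - move=> n; exact: measurable_prod3 (smooth_measurable sf)
      (smooth_measurable (test_fun_smooth (tg n))) (smooth_measurable (test_fun_smooth (th n))).
  - exact: measurable_prod3 (smooth_measurable sf) (measurable_cos_affine xi w1)
      (measurable_cos_affine eta w2).
  - by move=> n w; rewrite !normrM; apply: ler_pM => //; apply: ler_pM.
  - apply: aeW => w; apply: cvgM; last by case: (ch (B (t, w))).
    by apply: cvgM; [exact: cvg_cst|case: (cg (T (t, w)))].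
have [k /(_ K K0)[C hC]] := adjoint_bound tf.
have rhs : \int[(leb \x P)%E]_p Hj t f (g_ n) (h_ n) p @[n --> \oo] -->
    \int[(leb \x P)%E]_p Hj t f (fun y => cos (xi * y + w1)) (fun z => cos (eta * z + w2)) p.
  apply: (@dct R _ _ (leb \x P)%E (fun n => Hj t f (g_ n) (h_ n))
    (Hj t f (fun y => cos (xi * y + w1)) (fun z => cos (eta * z + w2))) (weight t k C)).
  - by move=> n; exact: (mHj t sf (test_fun_smooth (tg n)) (test_fun_smooth (th n))).
  - exact: (mHj t sf (@smooth_cos R xi w1) (@smooth_cos R eta w2)).
  - by move=> n p; exact: hC.
  - exact: integrable_weight.
  - apply: aeW => p; apply: cvgM; first exact: cvg_cst.
    rewrite /fp_adjoint derive1n2_cos_shift !derive1_cos_shift.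
    have [cg0 cg1 _] := cg (state p.1 p.2).1.2.
    have [ch0 ch1 ch2] := ch (state p.1 p.2).2.
    by apply: cvgD; [apply: cvgD; [apply: cvgD; [apply: cvgD|]|]|];
      repeat first [exact: cg0|exact: cg1|exact: ch0|exact: ch1|exact: ch2|exact: cvg_cst|apply: cvgM].
have cst0 : f 1 * g_ n 0 * h_ n 0 @[n --> \oo] --> f 1 * cos w1 * cos w2.
  have [cg0 _ _] := cg 0; have [ch0 _ _] := ch 0.
  move: cg0 ch0; rewrite !mulr0 !add0r => cg0 ch0.
  by apply: cvgM => //; apply: cvgM => //; exact: cvg_cst.
rewrite -(cvg_lim _ lhs)//; under eq_fun do rewrite E.
by apply: (@cvg_lim _ _ _ \oo) => //; apply: cvgD; [exact: cst0|exact: rhs].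
Qed.

(* The phases [c = 0] and [c = pi / 2] give the real and imaginary parts of the
   transformed equation. *)
Let Lc t f xi eta c (p : R * Omega) : R :=
  let x := V p in let s := clamp p.1 in let th := xi * T p + eta * B p + c in
  Ifun t p.1 *
  ((sigma s x ^+ 2 / 2 * derive1n 2 f x + mu s x * derive1 f x - eta ^+ 2 / 2 * f x) * cos th
   - (eta * sigma s x * derive1 f x + x * xi * f x) * sin th).

(** Product test functions give products of trigonometric functions; the phase of the sum
    [xi T + eta B + c] is recovered by the addition formula, the product of sines being a product of
    cosines shifted by [pi / 2]. *)
Let LcE t f xi eta c p :
  Hj t f (fun y => cos (xi * y + 0)) (fun z => cos (eta * z + c)) p
  - Hj t f (fun y => cos (xi * y + (0 + pi / 2))) (fun z => cos (eta * z + (c + pi / 2))) p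
  = Lc t f xi eta c p.
Proof.
have shift (x w : R) : cos (x + (w + pi / 2)) = - sin (x + w).
  by rewrite addrA cosD cos_pihalf sin_pihalf; ring.
have shifts (x w : R) : sin (x + (w + pi / 2)) = cos (x + w).
  by rewrite addrA sinD cos_pihalf sin_pihalf; ring.
rewrite /Hj /Lc -mulrBr; congr (_ * _).
rewrite /fp_adjoint !derive1n2_cos_shift !derive1_cos_shift /state /= -!surjective_pairing.
rewrite !(shift, shifts) !addr0 -(addrA (xi * T p)) (cosD (xi * T p)) (sinD (xi * T p)).
move: (derive1 (derive1 f) _) (derive1 f _) (f _) => f2 f1 f0.
move: (V p) (sigma _ _) (mu _ _) => x b a.
move: (cos (xi * T p)) (sin (xi * T p)) (cos (eta * B p + c)) (sin (eta * B p + c)) => y1 y2 y3 y4.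
by ring.
Qed.

Let fp_phase t f x0 xi eta c : 0 <= t -> test_fun f -> f x0 != 0 ->
  \int[P]_w (f (V (t, w)) * cos (xi * T (t, w) + eta * B (t, w) + c)) =
  f 1 * cos c + \int[(leb \x P)%E]_p Lc t f xi eta c p.
Proof.
move=> t0 tf fx0.
have e1 := fp_trig xi 0 eta c t0 tf fx0.
have e2 := fp_trig xi (0 + pi / 2) eta (c + pi / 2) t0 tf fx0.
have i1 := integrable_Htrig xi 0 eta c t0 tf.
have i2 := integrable_Htrig xi (0 + pi / 2) eta (c + pi / 2) t0 tf.
under [X in _ + X]eq_Rintegral do rewrite -LcE.
rewrite (RintegralB measurableT i1 i2).
have [F hF] := test_fun_bounded tf; have mf := smooth_measurable (test_fun_smooth tf).
have it a b : P.-integrable setT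
    (EFin \o (fun w => f (V (t, w)) * cos (xi * T (t, w) + a) * cos (eta * B (t, w) + b))).
  apply: (@bounded_integrable _ _ _ P _ (F * 1 * 1)); last first.
    move=> w; rewrite !normrM; apply: ler_pM => //; last exact: normr_cos_le1.
    by apply: ler_pM => //; exact: normr_cos_le1.
  exact: measurable_prod3 mf (measurable_cos_affine xi a) (measurable_cos_affine eta b).
transitivity (\int[P]_w (f (V (t, w)) * cos (xi * T (t, w) + 0) * cos (eta * B (t, w) + c))
  - \int[P]_w (f (V (t, w)) * cos (xi * T (t, w) + (0 + pi / 2)) * cos (eta * B (t, w) + (c + pi / 2)))).
  rewrite -(RintegralB measurableT (it _ _) (it _ _)); apply: eq_Rintegral => w _.
  have shift (x a : R) : cos (x + (a + pi / 2)) = - sin (x + a).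
    by rewrite addrA cosD cos_pihalf sin_pihalf; ring.
  rewrite !shift !addr0 -(addrA (xi * T (t, w))) cosD.
  by ring.
rewrite e1 e2 !add0r cos0 cos_pihalf; ring.
Qed.

Let theta xi eta (p : R * Omega) : R := - (xi * T p) - eta * B p.

Let integrand t f xi eta (p : R * Omega) : R[i] :=
  (Ifun t p.1)%:C * (fphat_adjoint mu sigma xi eta f (clamp p.1) (V p) * expi (theta xi eta p)).

Let adjointE f xi eta s x : fphat_adjoint mu sigma xi eta f s x =
  (sigma s x ^+ 2 / 2 * derive1n 2 f x + mu s x * derive1 f x - eta ^+ 2 / 2 * f x)
    +i* (- (eta * sigma s x * derive1 f x + x * xi * f x)).
Proof.
rewrite /fphat_adjoint; move: (derive1n 2 f x) (derive1 f x) => d2 d1.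
by apply: complexE; rewrite /= ?mul0r ?mulr0; ring.
Qed.

Let cos_shift (x : R) : cos (x + pi / 2) = - sin x.
Proof. by rewrite cosD cos_pihalf sin_pihalf; ring. Qed.

Let sin_shift (x : R) : sin (x + pi / 2) = cos x.
Proof. by rewrite sinD cos_pihalf sin_pihalf; ring. Qed.

Let theta_opp xi eta p : theta xi eta p = - (xi * T p + eta * B p).
Proof. by rewrite /theta opprD. Qed.

Let integrandE t f xi eta p :
  complex.Re (integrand t f xi eta p) = Lc t f xi eta 0 p /\
  complex.Im (integrand t f xi eta p) = Lc t f xi eta (pi / 2) p.
Proof.
rewrite /integrand adjointE theta_opp ReM !ImM ReM Re_expi Im_expi cosN sinN /= mul0r subr0 mul0r addr0.
by rewrite /Lc addr0 cos_shift sin_shift /=; split; congr (_ * _); ring.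
Qed.

Let weak_equation t f xi eta : 0 <= t -> test_fun f ->
  cint P setT (fun w => (f (V (t, w)))%:C * expi (- (xi * T (t, w)) - eta * B (t, w))) =
  (f 1)%:C + cint (leb \x P)%E setT (integrand t f xi eta).
Proof.
move=> t0 tf.
(* For [f = 0] no cutoff can be built from [f], but both sides are 0. *)
have [[x0 fx0]|f0] := pselect (exists x0, f x0 != 0); last first.
  have {}f0 : f = cst 0.
    by apply/funext => x; apply/eqP/negP => /negP fx; apply: f0; exists x.
  have f1 : derive1 f = cst 0 by apply/funext => x; rewrite f0 derive1_cst.
  have f2 : derive1n 2 f = cst 0 by apply/funext => x; rewrite derive1nS /= f1 derive1_cst.
  rewrite /integrand /fphat_adjoint f2 f1 f0.
  transitivity (cint P setT (fun w => 0 : R[i])).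
    by apply: eq_cint => w _; apply: complexE; rewrite ?ReM ?ImM/= !mul0r ?subr0 ?addr0.
  have z d0 (Z : measurableType d0) (m : {measure set Z -> \bar R}) :
      cint m setT (fun _ : Z => 0 : R[i]) = 0.
    by apply: complexE => /=; rewrite /Rintegral integral0.
  rewrite z; apply/esym; rewrite add0r -[RHS](z _ _ (leb \x P)%E).
  by apply: eq_cint => p _; rewrite /= !mulr0 addr0 subr0 mul0r mulr0.
have e1 := fp_phase xi eta 0 t0 tf fx0; have e2 := fp_phase xi eta (pi / 2) t0 tf fx0.
apply: complexE; rewrite ?ReD ?ImD [LHS]/= [in RHS]/=.
  under [in RHS]eq_Rintegral do rewrite (integrandE _ _ _ _ _).1.
  move: e1; rewrite cos0 mulr1 => <-; apply: eq_Rintegral => w _.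
  by rewrite ReM Re_expi -/(theta xi eta (t, w)) theta_opp cosN /= mul0r subr0 addr0.
under [in RHS]eq_Rintegral do rewrite (integrandE _ _ _ _ _).2.
move: e2; rewrite cos_pihalf mulr0 => <-; apply: eq_Rintegral => w _.
by rewrite ImM Im_expi -/(theta xi eta (t, w)) theta_opp sinN cos_shift /= mul0r addr0.
Qed.

Let integrable_integrand t f xi eta : 0 <= t -> test_fun f ->
  (leb \x P)%E.-integrable setT (EFin \o (fun p => complex.Re (integrand t f xi eta p))) /\
  (leb \x P)%E.-integrable setT (EFin \o (fun p => complex.Im (integrand t f xi eta p))).
Proof.
move=> t0 tf.
have iL c : (leb \x P)%E.-integrable setT (EFin \o Lc t f xi eta c).
  have := integrableB measurableT (integrable_Htrig xi 0 eta c t0 tf)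
    (integrable_Htrig xi (0 + pi / 2) eta (c + pi / 2) t0 tf).
  by apply: eq_integrable => // p _; rewrite /= -LcE.
by split; [apply: eq_integrable (iL 0)|apply: eq_integrable (iL (pi / 2))] => // p _ /=;
  rewrite ?(integrandE _ _ _ _ _).1 ?(integrandE _ _ _ _ _).2.
Qed.

Let mtheta xi eta : measurable_fun setT (theta xi eta).
Proof.
apply: measurable_funB; last exact: measurable_funM.
by apply: measurableT_comp => //; exact: measurable_funM.
Qed.

Let cmeasurable_adjoint s f xi eta : 0 <= s -> test_fun f ->
  cmeasurable (fphat_adjoint mu sigma xi eta f s).
Proof.
move=> s0 tf; have sf := test_fun_smooth tf.
have mb : measurable_fun setT (sigma s).
  by have := measurableT_comp msigmaC (pair1_measurable s); rewrite /comp/= clampK.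
have ma : measurable_fun setT (mu s).
  by have := measurableT_comp mmuC (pair1_measurable s); rewrite /comp/= clampK.
have mf0 := smooth_measurable sf; have mf1 := smooth_measurable (smooth_derive1 sf).
have mf2 := smooth_measurable (@smooth_derive1n _ 2 _ sf).
split; under eq_fun do rewrite adjointE.
  have mb2 : measurable_fun setT (fun x => sigma s x ^+ 2 / 2).
    by apply: measurable_funM => //; exact: measurable_funX.
  exact: measurable_funB (measurable_funD (measurable_funM mb2 mf2) (measurable_funM ma mf1))
    (measurable_funM (measurable_cst _) mf0).
exact: measurableT_comp (measurable_funD
  (measurable_funM (measurable_funM (measurable_cst _) mb) mf1)
  (measurable_funM (measurable_funM (@measurable_id _ _ _) (measurable_cst _)) mf0)).
Qed.

(* [p s] is the complex measure [A |-> E[exp (- i xi T_s - i eta B_s); V_s \in A]]. *)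
Lemma fphat_solution_law xi eta : exists p : R -> @cmeasure R,
  fphat_solution mu sigma xi eta p /\
  forall s f, 0 <= s -> cbmeas f ->
    cm_int (p s) f =
    cint P setT (fun w => f (V (s, w)) * expi (- (xi * T (s, w)) - eta * B (s, w))).
Proof.
have m1 (G : R * Omega -> R) s : measurable_fun setT G -> measurable_fun setT (fun w => G (s, w)).
  by move=> mG; exact: (measurableT_comp mG (pair1_measurable s)).
have ex s : exists nu : @cmeasure R,
    (forall D (f : R -> R), measurable D -> measurable_fun setT f -> (forall x, 0 <= f x) ->
       (cm_absint nu D f <= 2%:E * \int[P]_(w in (fun w => V (s, w)) @^-1` D) (f (V (s, w)))%:E)%E) /\
    (forall f : R -> R[i], cmeasurable f ->
       P.-integrable setT (EFin \o (fun w => complex.Re (f (V (s, w))))) ->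
       P.-integrable setT (EFin \o (fun w => complex.Im (f (V (s, w))))) ->
       cm_int nu f = cint P setT (fun w => f (V (s, w)) * expi (theta xi eta (s, w)))).
  pose Vs : {mfun Omega >-> R} := mfun_Sub (mem_set (m1 V s mV)).
  exact: (law_cmeasure P Vs (m1 _ s (mtheta xi eta))).
have [p hp] := choice ex.
exists p.
have pb s f : cbmeas f ->
    cm_int (p s) f = cint P setT (fun w => f (V (s, w)) * expi (- (xi * T (s, w)) - eta * B (s, w))).
  move=> bf; apply: (hp s).2; first exact: bf.1.
    have [M mf fM] := cbmeas_Re bf.
    by apply: (bounded_integrable _ (measurableT_comp mf (m1 _ s mV))) => w; exact: fM.
  have [M mf fM] := cbmeas_Im bf.
  by apply: (bounded_integrable _ (measurableT_comp mf (m1 _ s mV))) => w; exact: fM.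
split; last by move=> s f _; exact: pb.
split.
- move=> t; exists 2 => s _ _.
  apply: le_trans ((hp s).1 setT (fun=> 1) measurableT (measurable_cst _) (fun=> ler01)) _.
  rewrite preimage_setT integral_cst// mul1e.
  by rewrite [X in (_ * X <= _)%E](_ : _ = 1%E) ?mule1//; exact: probability_setT.
- move=> t k t0.
  have mD2' : measurable_fun setT (EFin \o D2 t k) by exact/measurable_EFinP.
  (* The factor 2 is the one between [cm_absint] and the law of [V] in [law_cmeasure]. *)
  have iD : (leb \x P)%E.-integrable setT (fun p => (2%:E * (EFin \o D2 t k) p)%E).
    exact: (integrableZl measurableT 2 (integrable_D2 k t0)).
  have := (@integrable12ltyP _ _ _ _ R leb P _ (measurable_int _ iD)).1 iD.
  apply: le_lt_trans; rewrite [leLHS]integral_mkcond; apply: ge0_le_integral_nomeas.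
    move=> s _; rewrite patchE; case: ifPn => // _; apply: integral_ge0 => x _.
    by rewrite lee_fin mulr_ge0// addr_ge0// sqr_ge0.
  move=> s _; rewrite patchE; case: ifPn => [/set_mem Is|_]; last first.
    by apply: integral_ge0 => w _; exact: abse_ge0.
  have s0 : 0 <= s by move: Is; rewrite /= in_itv/= => /andP[].
  have mw : measurable_fun setT (fun x => `|mu s x| + sigma s x ^+ 2).
    have e (f : R -> R -> R) : measurable_fun setT (fun p : R * R => f (clamp p.1) p.2) ->
        measurable_fun setT (f s).
      by move=> /measurableT_comp/(_ (pair1_measurable s)); rewrite /comp/= clampK.
    apply: measurable_funD; first exact: measurableT_comp (e _ mmuC).
    exact: measurable_funX (e _ msigmaC).
  apply: (le_trans ((hp s).1 _ _ (measurable_itv _) mw _)).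
    by move=> x; rewrite addr_ge0// sqr_ge0.
  rewrite integral_mkcond -ge0_integralZl//; last 2 first.
  + apply/(measurable_restrictT _ _).1.
      rewrite -[X in measurable X]setTI; exact: m1.
    by apply/measurable_EFinP; apply: measurable_funTS; exact: measurableT_comp mw (m1 _ s mV).
  + move=> w _; rewrite patchE; case: ifPn => // _.
    by rewrite lee_fin addr_ge0// sqr_ge0.
  apply: ge0_le_integral_nomeas => w _.
    rewrite mule_ge0// patchE; case: ifPn => // _.
    by rewrite lee_fin addr_ge0// sqr_ge0.
  rewrite abseM [X in (_ <= X * _)%E]gee0_abs ?lee_fin//; apply: lee_wpmul2l; first by rewrite lee_fin.
  rewrite /=.
  have W0 : 0 <= `|mu s (V (s, w))| + sigma s (V (s, w)) ^+ 2 by rewrite addr_ge0// sqr_ge0.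
  rewrite /D2 /Ifun /= indicE mem_set// mul1r clampK// patchE indicE.
  have -> : (w \in (fun w => V (s, w)) @^-1` [set` `[- k, k]]) = (V (s, w) \in [set x | `|x| <= k]).
    by apply/idP/idP => /set_mem h; apply/mem_set; move: h; rewrite /= in_itv/= ler_norml.
  by case: ifPn => _; rewrite ?mul1r ?mul0r ?normr0// (ger0_norm W0).
move=> f t tf t0.
have [F hF] := test_fun_bounded tf; have sf := test_fun_smooth tf.
rewrite pb; last exact: cbmeas_real (smooth_measurable sf) hF.
rewrite weak_equation//; congr (_ + _).
have [iG1 iG2] := integrable_integrand xi eta t0 tf.
(* By Fubini the integrand is [P]-integrable at almost every time; only there does the second clause
   of [law_cmeasure] apply to the unbounded adjoint. *)
have key : \forall s \ae leb, s \in `[0, t] ->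
    cm_int (p s) (fphat_adjoint mu sigma xi eta f s) =
    cint P setT (fun w => integrand t f xi eta (s, w)).
  have i1 := ae_integrable1 iG1; have i2 := ae_integrable1 iG2.
  apply: filterS2 i1 i2 => s i1 i2 Is.
  have s0 : 0 <= s by move: Is; rewrite in_itv/= => /andP[].
  have GE w : integrand t f xi eta (s, w) =
      fphat_adjoint mu sigma xi eta f s (V (s, w)) * expi (theta xi eta (s, w)).
    by rewrite /integrand /= /Ifun indicE mem_set// mul1r clampK.
  (* [law_cmeasure] asks for integrability without the phase. Multiplying by the opposite phase, of
     modulus one, recovers it from the integrability of [integrand]. *)
  have invE w : fphat_adjoint mu sigma xi eta f s (V (s, w)) =
      integrand t f xi eta (s, w) * expi (- theta xi eta (s, w)).
    by rewrite GE -mulrA -expiD subrr expi0 mulr1.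
  have mth : measurable_fun setT (fun w => - theta xi eta (s, w)).
    by apply: measurableT_comp => //; exact: m1 (mtheta xi eta).
  have mc : measurable_fun setT (fun w => complex.Re (expi (- theta xi eta (s, w)))).
    by have [[]] := cbmeas_expi mth.
  have ms : measurable_fun setT (fun w => complex.Im (expi (- theta xi eta (s, w)))).
    by have [[]] := cbmeas_expi mth.
  have bc w : `|complex.Re (expi (- theta xi eta (s, w)))| <= 1 by rewrite Re_expi normr_cos_le1.
  have bs w : `|complex.Im (expi (- theta xi eta (s, w)))| <= 1 by rewrite Im_expi normr_sin_le1.
  rewrite (hp s).2//; [by apply: eq_cint => w _; rewrite GE|exact: cmeasurable_adjoint| |].
    under eq_fun do rewrite invE ReM mulrC [X in _ - X]mulrC.
    exact: (integrableB measurableT (integrable_bounded_mul mc bc i1) (integrable_bounded_mul ms bs i2)).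
  under eq_fun do rewrite invE ImM mulrC [X in _ + X]mulrC.
  exact: (integrableD measurableT (integrable_bounded_mul ms bs i1) (integrable_bounded_mul mc bc i2)).
have out s w : s \notin [set` `[0, t]] -> integrand t f xi eta (s, w) = 0.
  by move=> nI; rewrite /integrand /Ifun indicE (negbTE nI) mul0r.
apply: complexE => /=.
  rewrite -(Rintegral_prod_integrable iG1) [RHS](_ : _ = \int[leb]_(s in `[0, t])
    \int[P]_w complex.Re (integrand t f xi eta (s, w))).
    rewrite [RHS]Rintegral_mkcond; apply: eq_Rintegral => s _; rewrite patchE.
    case: ifPn => // nI; rewrite /Rintegral integral0_eq// => w _; by rewrite out.
  apply: Rintegral_eq_off_null; first exact: measurable_itv.
  have [N [mN N0 sN]] := key; exists N; split => // s h; apply: sN => /= k1; apply: h => Is.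
  exact: (congr1 (fun z : R[i] => complex.Re z) (k1 Is)).
rewrite -(Rintegral_prod_integrable iG2) [RHS](_ : _ = \int[leb]_(s in `[0, t])
  \int[P]_w complex.Im (integrand t f xi eta (s, w))).
  rewrite [RHS]Rintegral_mkcond; apply: eq_Rintegral => s _; rewrite patchE.
  case: ifPn => // nI; rewrite /Rintegral integral0_eq// => w _; by rewrite out.
apply: Rintegral_eq_off_null; first exact: measurable_itv.
  have [N [mN N0 sN]] := key; exists N; split => // s h; apply: sN => /= k1; apply: h => Is.
  exact: (congr1 (fun z : R[i] => complex.Im z) (k1 Is)).
Qed.

Lemma fphat_law qhat xi eta s f : fphat_unique_solution mu sigma qhat -> 0 <= s -> cbmeas f ->
  cm_int (qhat s xi eta) f =
  cint P setT (fun w => f (V (s, w)) * expi (- (xi * T (s, w)) - eta * B (s, w))).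
Proof.
move=> uq s0 bf; have [p [sp <-//]] := fphat_solution_law xi eta.
by apply/esym; apply: cm_int_eq => //; exact: (uq xi eta).2.
Qed.


End FokkerPlanckFourier.

(** * Characteristic function of the time change and the Brownian motion *)

Section Versions.
Context {R : realType} d (Omega : measurableType d) (P : probability Omega R).
Notation leb := (@lebesgue_measure R).

Lemma integral_right_continuous (f : R -> R) : {within `[0, +oo[, continuous f} ->
  forall s, 0 <= s ->
  \int[leb]_(x in `[0, u]) f x @[u --> s^'+] --> \int[leb]_(x in `[0, s]) f x.
Proof.
move=> cf s s0; have s1 : 0 < s + 1 by rewrite ltr_wpDl.
have cf' : {within `[0, s + 1], continuous f}.
  by apply: continuous_subspaceW cf => x /=; rewrite !in_itv/= andbT => /andP[].
have := parameterized_integral_continuous (ltW s1) (continuous_compact_integrable (@segment_compact _ _ _) cf').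
move=> /(continuous_within_itvP _ s1)[ci c0 _].
move: s0; rewrite le_eqVlt => /predU1P[<-//|s0].
by apply: cvg_at_right_filter; apply: ci; rewrite in_itv/= s0/= ltrDl.
Qed.

Lemma cint_law d' (Y : measurableType d') (nu : {measure set Y -> \bar R}) (phi : Omega -> Y)
    (f : Y -> R[i]) : measurable_fun setT phi ->
  (forall A, measurable A -> nu A = P (phi @^-1` A)) -> cbmeas f ->
  cint nu setT f = cint P setT (fun w => f (phi w)).
Proof.
move=> mphi law [[m1 m2] _]; apply: complexE => /=.
  by rewrite (Rintegral_law mphi law m1).
by rewrite (Rintegral_law mphi law m2).
Qed.

Lemma cint_ae_eq d' (Y : measurableType d') (m : {measure set Y -> \bar R}) (f g : Y -> R[i]) :
  (\forall w \ae m, f w = g w) -> cint m setT f = cint m setT g.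
Proof.
by move=> fg; apply: complexE => /=; apply: Rintegral_eq_off_null => //;
  apply: filterS fg => w ->.
Qed.

Lemma fhatE (X Y : {RV P >-> R}) xi eta :
  fhat X Y xi eta = cint P setT (fun w => expi (- (xi * X w) - eta * Y w)).
Proof.
rewrite /fhat; under eq_cint do rewrite -expiE.
rewrite (cint_distribution P (rv_pair X Y))//.
apply: cbmeas_expi; apply: measurable_funB; last by apply: measurable_funM.
by apply: measurableT_comp => //; apply: measurable_funM.
Qed.

Lemma negligible_measurable (F : R -> set (set Omega)) (A : set Omega) :
  usual_filtration P F -> P.-negligible A -> measurable A.
Proof. by move=> [_ Fm _ Fn _] /Fn; exact: Fm. Qed.

Lemma joint_version_measurable (F : R -> set (set Omega)) (X : R -> {RV P >-> R}) :
  usual_filtration P F ->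
  (\forall w \ae P, forall s, 0 <= s -> X u w @[u --> s^'+] --> X s w) ->
  exists2 Y : R * Omega -> R, measurable_fun setT Y &
    \forall w \ae P, forall s, 0 <= s -> Y (s, w) = X s w.
Proof.
move=> uF rc; have [] := @joint_version _ _ _ P d.-measurable X _ _ _ rc.
- exact: sigma_algebra_measurable.
- by move=> A; exact: negligible_measurable uF.
- by move=> s C _ mC; rewrite -[X in measurable X]setTI; exact: measurable_funPT.
move=> Y mY eY; exists (fun p => Y (p.1, p.2)) => //.
apply: (measurableT_comp mY); apply: measurable_fun_pair => //.
have Gm : d.-measurable `<=` (d.-measurable : set (set Omega)) by [].
exact: (measurableT_comp (measurable_to_sigma Gm) (@measurable_snd _ _ _ _)).
Qed.

(** A set of the completed filtration differs from a set generated by [B] up to time [t] by two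
    negligible sets, and the usual conditions put all negligible sets into [F t]. *)
Lemma natural_filtration_sub (F : R -> set (set Omega)) (B : R -> {RV P >-> R}) t :
  usual_filtration P F -> adapted F B -> 0 <= t -> natural_filtration B t `<=` F t.
Proof.
move=> [Fs Fm Fmono Fn _] aB t0 A [C sC nAC].
have nF D : P.-negligible D -> F t D by move=> /Fn; exact: Fmono.
have sF := Fs _ t0.
have FC : F t C.
  move: C sC {nAC}; apply: smallest_sub => // D [s [E [+ mE ->]]].
  rewrite /= in_itv/= => /andP[s0 st]; apply: (Fmono s t) => //; exact: aB.
have mF D : F t D -> (F t).-sigma.-measurable D by exact: sub_sigma_algebra.
rewrite -(sigma_algebra_id sF).
have -> : A = (C `\` (C `\` A)) `|` (A `\` C).
  apply/seteqP; split => w /=.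
    by move=> Aw; have [Cw|nC] := pselect (C w); [left; split => // -[]|right].
  by case=> [[Cw /not_andP[//|/contrapT]]|[]].
apply: (@measurableU _ (g_sigma_algebraType (F t))).
  apply: (@measurableD _ (g_sigma_algebraType (F t))); first exact: mF.
  by apply: mF; apply: nF; apply: negligibleS nAC; right.
by apply: mF; apply: nF; apply: negligibleS nAC; left.
Qed.

Lemma ae_measure_eq (A C : set Omega) : measurable A -> measurable C ->
  (\forall w \ae P, A w <-> C w) -> P A = P C.
Proof.
move=> mA mC AC; apply: measure_eq_negligible => //.
apply: negligibleS AC => w h; rewrite /= => AC.
by case: h => -[h1 h2]; apply: h2; apply/AC.
Qed.

End Versions.

Section Characteristic.
Context {R : realType} d (Omega : measurableType d) (P : probability Omega R).
Variables (F : R -> set (set Omega)) (B v T : R -> {RV P >-> R}) (mu sigma : R -> R -> R).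
Variables (q : R -> probability (R * R * R)%type R) (qhat : R -> R -> R -> @cmeasure R).
Hypotheses (uF : usual_filtration P F) (bB : brownian F B).
Hypothesis mmu : measurable_fun [set p : R * R | 0 <= p.1] (fun p => mu p.1 p.2).
Hypothesis msigma : measurable_fun [set p : R * R | 0 <= p.1] (fun p => sigma p.1 p.2).
Hypothesis sol : strong_solution F B mu sigma v T.
Hypotheses (flow : law_flow v T B q) (fps : fp_solution mu sigma q).
Hypothesis fphat : fphat_unique_solution mu sigma qhat.
Notation leb := (@lebesgue_measure R).

Lemma T_right_continuous :
  \forall w \ae P, forall s, 0 <= s -> T u w @[u --> s^'+] --> T s w.
Proof.
have [_ cv _ _ eT] := sol.
apply: filterS2 cv eT => w cv eT s s0; rewrite eT//.
apply: cvg_trans (integral_right_continuous cv s0); apply: near_eq_cvg.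
near=> u; rewrite eT//.
by apply: le_trans s0 _; near: u; exact: nbhs_right_ge.
Unshelve. all: by end_near. Qed.

(** [fphat_law] works with functions jointly measurable in [(s, w)]. Versions of [v], [T] and [B]
    provide them and have the same joint law at each time, so [q] is also their flow of laws. *)
Lemma qhat_law s xi eta f : 0 <= s -> cbmeas f ->
  cm_int (qhat s xi eta) f =
  cint P setT (fun w => f (v s w) * expi (- (xi * T s w) - eta * B s w)).
Proof.
move=> s0 bf; have [_ _ _ _ cB] := bB; have [_ cv _ _ _] := sol.
have [V' mV eV] := joint_version_measurable uF (right_continuous_paths cv).
have [B' mB eB] := joint_version_measurable uF (right_continuous_paths cB).
have [T' mT eT] := joint_version_measurable uF T_right_continuous.
have m1 u (G : R * Omega -> R) : measurable_fun setT G -> measurable_fun setT (fun w => G (u, w)).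
  by move=> mG; exact: (measurableT_comp mG (pair1_measurable u)).
have flow' u A : 0 <= u -> measurable A -> q u A = P [set w | A (V' (u, w), T' (u, w), B' (u, w))].
  move=> u0 mA; rewrite flow//; apply: ae_measure_eq.
  - have mphi : measurable_fun setT (fun w => (v u w, T u w, B u w)).
      by apply: measurable_fun_pair => //; exact: measurable_fun_pair.
    by rewrite -[X in measurable X]setTI; exact: mphi.
  - have mphi : measurable_fun setT (fun w => (V' (u, w), T' (u, w), B' (u, w))).
      by apply: measurable_fun_pair; [apply: measurable_fun_pair|]; exact: m1.
    by rewrite -[X in measurable X]setTI; exact: mphi.
  - apply: filterS3 eV eB eT => w e1 e2 e3.
    by rewrite /= e1// e2// e3.
rewrite (fphat_law mmu msigma mV mT mB flow' fps xi eta fphat s0 bf).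
apply: cint_ae_eq; apply: filterS3 eV eB eT => w e1 e2 e3.
by rewrite e1// e2// e3.
Qed.

Lemma T_adapted : adapted F T.
Proof.
have [_ aB _ _ _] := bB; have [[_ aT] _ _ _ _] := sol.
move=> t A t0 mA; apply: (natural_filtration_sub uF aB t0); exact: aT.
Qed.

Lemma fhat_early t j xi eta : 0 <= t -> t <= j ->
  fhat (T t) (B j) xi eta =
  (expR (- ((j - t) * eta ^+ 2 / 2)))%:C * cm_int (qhat t xi eta) (fun=> 1).
Proof.
move=> t0; have [_ aB iB nB _] := bB.
have cb1 : cbmeas (fun _ : R => 1 : R[i]) by exact: cbmeas_cst.
rewrite fhatE qhat_law// le_eqVlt => /predU1P[<-|tj].
  (* The law of increments is given for [t < j] only; at [t = j] there is no increment and the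
     Gaussian factor is 1. *)
  rewrite subrr !mul0r oppr0 expR0 mul1r.
  by apply: eq_cint => w _; rewrite mul1r.
have [Fs Fm _ _ _] := uF.
have sF := Fs _ t0; have mF := measurable_to_sigma (Fm _ t0).
have mX (X : R -> {RV P >-> R}) : adapted F X ->
    measurable_fun setT (X t : g_sigma_algebraType (F t) -> R).
  by move=> aX; apply: measurable_sigma_fun => // C mC; exact: aX.
pose Y w := B j w - B t w.
have mY : measurable_fun setT Y by exact: measurable_funB.
pose f (p : g_sigma_algebraType (F t) * R) : R[i] :=
  expi (- (xi * T t p.1) - eta * B t p.1) * expi (p.2 * - eta).
have bf1 : cbmeas (fun w : g_sigma_algebraType (F t) => expi (- (xi * T t w) - eta * B t w)).
  apply: cbmeas_expi; apply: measurable_funB; last by apply: measurable_funM => //; exact: mX.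
  apply: measurableT_comp => //; apply: measurable_funM => //; exact: mX T_adapted.
have bf2 : cbmeas (fun y : R => expi (y * - eta)).
  by apply: cbmeas_expi; exact: measurable_funM.
have bf : cbmeas f.
  apply: cbmeasM; first exact: (cbmeas_comp (@measurable_fst _ _ _ _) bf1).
  exact: (cbmeas_comp (@measurable_snd _ _ _ _) bf2).
transitivity (cint P setT (fun w => f (w, Y w))).
  apply: eq_cint => w _; rewrite /f -expiD; congr expi; rewrite /Y /=; ring.
rewrite (@indep_cint _ _ _ P _ _ (g_sigma_algebraType (F t)) _ id Y)//; last first.
  move=> A C mA mC; apply: iB => //.
  by move: mA; rewrite /measurable/= (sigma_algebra_id sF).
have E : cint P setT (fun w => expi (Y w * - eta)) = (expR (- ((j - t) * eta ^+ 2 / 2)))%:C.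
  have jt : 0 < Num.sqrt (j - t) by rewrite sqrtr_gt0 subr_gt0.
  rewrite -(@cint_law _ _ _ P _ _ (normal_prob 0 (Num.sqrt (j - t))) Y (fun y => expi (y * - eta)))//; last first.
    by move=> A mA; exact: esym (nB _ _ _ t0 tj mA).
  by rewrite normal_expi// sqr_sqrtr ?subr_ge0 ?ltW// sqrrN.
have bf3 : cbmeas (fun w => expi (- (xi * T t w) - eta * B t w)).
  apply: cbmeas_expi; apply: measurable_funB; last by apply: measurable_funM.
  by apply: measurableT_comp => //; apply: measurable_funM.
rewrite -E mulrC -cintZr.
  apply: eq_cint => w1 _; rewrite /f /= mul1r cintZl//.
  exact: (cbmeas_comp mY bf2).
under eq_fun do rewrite mul1r; exact: bf3.
Qed.

End Characteristic.

(** * Fourier inversion with Gaussian cutoffs *)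

Section GaussianInversion.
Context {R : realType}.
Notation leb := (@lebesgue_measure R).

(** Reduction to sequences, the form in which dominated convergence is applied. *)
Lemma ccvg_at_right0 (f : R -> R[i]) l :
  (forall e_ : nat -> R, (forall n, 0 < e_ n) -> e_ n @[n --> \oo] --> (0 : R) ->
    ccvg \oo (fun n => f (e_ n)) l) -> ccvg 0^'+ f l.
Proof.
move=> h; split; apply/cvg_at_rightP => e_ [e0 ecv];
  by have [] := h e_ e0 ecv.
Qed.

Lemma Re_real_mul (c : R) (z : R[i]) : complex.Re (c%:C * z) = c * complex.Re z.
Proof. by rewrite ReM /= mul0r subr0. Qed.

Lemma Im_real_mul (c : R) (z : R[i]) : complex.Im (c%:C * z) = c * complex.Im z.
Proof. by rewrite ImM /= mul0r addr0. Qed.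

(** The two masses come from the frequency integral and from the integral in [y]. One, with
    [1 / (2 pi)] and [gkernel], makes the normal density of mean [a] and variance [e]; the other
    turns the normal law of variance [1 / e] back into [gauss e y dy]. *)
Let real_inversion e a (f : R -> R) M : 0 < e -> measurable_fun setT f -> (forall x, `|f x| <= M) ->
  (2 * pi)^-1 * gauss_mass e ^+ 2 * \int[normal_prob 0 (Num.sqrt e)^-1]_y (gkernel e a y * f y) =
  \int[normal_prob a (Num.sqrt e)]_y (gauss e y * f y).
Proof.
move=> e0 mf fM.
have M0 : 0 <= M by exact: le_trans (normr_ge0 _) (fM 0).
have s0 : Num.sqrt e != 0 by rewrite gt_eqF// sqrtr_gt0.
have mg := measurable_gauss e.
have bk y : `|gkernel e a y * f y| <= M.
  by rewrite normrM -[M]mul1r; apply: ler_pM => //; exact: gkernel_le1.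
have mk : measurable_fun setT (fun y => gkernel e a y * f y).
  by apply: measurable_funM => //; exact: measurable_gkernel.
have bg y : `|gauss e y * f y| <= M.
  rewrite normrM -[M]mul1r; apply: ler_pM => //.
  by rewrite ger0_norm ?gauss_ge0// gauss_le1// ltW.
have mgf : measurable_fun setT (fun y => gauss e y * f y) by exact: measurable_funM.
rewrite (Rintegral_normal _ _ mgf bg) expr2 mulrA -mulrA -(Rintegral_gauss e0 mk bk).
have ig : leb.-integrable setT (EFin \o (fun y => gauss e y * (gkernel e a y * f y))).
  have := normal_integrableM 0 (Num.sqrt e)^-1 mk bk.
  move/(integrableZl measurableT (gauss_mass e)); apply: eq_integrable => // y _ /=.
  by rewrite gaussE// -EFinM; congr (_%:E); ring.
rewrite -RintegralZl//; apply: eq_Rintegral => y _.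
rewrite -(gauss_mass_pdf a y e0); move: (pi) => p; ring.
Qed.

Lemma gauss_inversion e a (g : R -> R[i]) : 0 < e -> cbmeas g ->
  ((2 * pi)^-1 * gauss_mass e ^+ 2)%:C *
    cint (normal_prob 0 (Num.sqrt e)^-1) setT
      (fun y => (gkernel e a y)%:C * g y) =
  cint (normal_prob a (Num.sqrt e)) setT (fun y => (gauss e y)%:C * g y).
Proof.
move=> e0 bg; have [M1 m1 b1] := cbmeas_Re bg; have [M2 m2 b2] := cbmeas_Im bg.
apply: complexE; rewrite ?Re_real_mul ?Im_real_mul /=.
  under eq_Rintegral do rewrite Re_real_mul.
  under [RHS]eq_Rintegral do rewrite Re_real_mul.
  exact: real_inversion m1 b1.
under eq_Rintegral do rewrite Im_real_mul.
under [RHS]eq_Rintegral do rewrite Im_real_mul.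
exact: real_inversion m2 b2.
Qed.

Lemma cint_approximate_identity (a : R) (g : R -> R[i]) (e_ : nat -> R) :
  cbmeas g -> ccvg (nbhs a) g (g a) -> (forall n, 0 < e_ n) -> e_ n @[n --> \oo] --> (0 : R) ->
  ccvg \oo (fun n => cint (normal_prob a (Num.sqrt (e_ n))) setT
                      (fun y => (gauss (e_ n) y)%:C * g y)) (g a).
Proof.
move=> bg [c1 c2] e0 ecv.
have [M1 m1 b1] := cbmeas_Re bg; have [M2 m2 b2] := cbmeas_Im bg.
split => /=.
  under eq_fun => n do under eq_Rintegral do rewrite Re_real_mul.
  exact: approximate_identity m1 b1 c1 e0 ecv.
under eq_fun => n do under eq_Rintegral do rewrite Im_real_mul.
exact: approximate_identity m2 b2 c2 e0 ecv.
Qed.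

End GaussianInversion.

(** * Characteristic function for [j <= t] *)

Section LateTimes.
Context {R : realType} d (Omega : measurableType d) (P : probability Omega R).
Variables (F : R -> set (set Omega)) (B v T : R -> {RV P >-> R}).
Variables (Phi : R -> R -> R -> R -> R -> R[i]) (qhat : R -> R -> R -> @cmeasure R).
Hypotheses (aB : adapted F B) (cPhi : char_exponent F v T Phi).
Variables (t j xi eta : R).
Hypotheses (j0 : 0 <= j) (jt : j <= t).
Hypothesis qhat_law : forall zeta f, cbmeas f ->
  cm_int (qhat j zeta eta) f =
  cint P setT (fun w => f (v j w) * expi (- (zeta * T j w) - eta * B j w)).
Notation leb := (@lebesgue_measure R).

Let E (x y : R) : R[i] := cexp (Phi t j (- xi) x y).

Let bE : cbmeas (fun p : R * R => E p.1 p.2).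
Proof.
have [mE _ reE _] := cPhi (- xi) j0 jt; split; first exact: mE.
exists 1 => -[x y]; rewrite /E /cexp /=.
have e1 : 0 <= expR (complex.Re (Phi t j (- xi) x y)) <= 1.
  by rewrite expR_ge0 -[leRHS]expR0 ler_expR reE.
have [e0 {}e1] := andP e1.
by split; rewrite normrM ger0_norm// -[leRHS]mul1r; apply: ler_pM => //;
  [exact: normr_cos_le1|exact: normr_sin_le1].
Qed.

Let h (p : Omega * R) : R[i] := E (v j p.1) p.2 * expi (- (eta * B j p.1)).

Let bh : cbmeas h.
Proof.
apply: cbmeasM.
  apply: (cbmeas_comp (h := fun p : Omega * R => (v j p.1, p.2)) _ bE).
  by apply: measurable_fun_pair => //; exact: measurableT_comp.
apply: cbmeas_expi; apply: measurableT_comp => //; apply: measurable_funM => //.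
exact: measurableT_comp.
Qed.

Let kernel (e : R) (p : Omega * R) : R[i] :=
  (gkernel e (T j p.1) p.2)%:C * h p.

Let smoothed (e : R) (w : Omega) : R[i] :=
  cint (normal_prob (T j w) (Num.sqrt e)) setT (fun y => (gauss e y)%:C * h (w, y)).

Let bkernel e : cbmeas (kernel e).
Proof.
apply: cbmeasM => //; apply: (@cbmeas_real _ _ _ _ 1).
  by apply: measurable_gkernel => //; exact: measurableT_comp.
by move=> p; exact: gkernel_le1.
Qed.

Let smoothedE e w : 0 < e -> smoothed e w =
  ((2 * pi)^-1 * gauss_mass e ^+ 2)%:C *
    cint (normal_prob 0 (Num.sqrt e)^-1) setT (fun y => kernel e (w, y)).
Proof.
move=> e0; rewrite /smoothed -gauss_inversion//.
exact: (cbmeas_comp (pair1_measurable w) bh).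
Qed.

(** At frequency [zeta], [qhat_law] contributes the phase [- zeta T_j], which joins [zeta y] into
    [zeta (y - T_j)]. The cutoffs bound everything, so the [zeta] integral can be done first; it
    yields [gkernel] centred at [T_j]. *)
Let fhat_late_smoothed e : 0 < e ->
  fhat_late_rhs Phi qhat t j xi eta e = cint P setT (smoothed e).
Proof.
move=> e0; have s0 : 0 < (Num.sqrt e)^-1 by rewrite invr_gt0 sqrtr_gt0.
pose N := normal_prob 0 (Num.sqrt e)^-1.
pose K (p : R * (Omega * R)) : R[i] := expi (p.1 * (p.2.2 - T j p.2.1)) * h p.2.
have bK : cbmeas K.
  apply: cbmeasM; last exact: (cbmeas_comp (@measurable_snd _ _ _ _) bh).
  apply: cbmeas_expi; apply: measurable_funM => //.
  apply: measurable_funB; first exact: measurableT_comp.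
  by apply: measurableT_comp => //; exact: measurableT_comp.
pose K2 (p : R * Omega) := cint N setT (fun y => K (p.1, (p.2, y))).
have bK2 : cbmeas K2.
  apply: (@cbmeas_cint _ _ _ _ _ N (fun q : (R * Omega) * R => K (q.1.1, (q.1.2, q.2)))).
  apply: (cbmeas_comp _ bK).
  apply: measurable_fun_pair; first exact: measurableT_comp.
  by apply: measurable_fun_pair => //; exact: measurableT_comp.
have inner zeta : cm_int (qhat j zeta eta) (fun x => cint leb setT (fun y =>
      (gauss e y)%:C * cexp (Phi t j (- xi) x y + (0 +i* (zeta * y))))) =
    (gauss_mass e)%:C * cint P setT (fun w => K2 (zeta, w)).
  pose G (q : R * R) : R[i] := E q.1 q.2 * expi (zeta * q.2).
  have bG : cbmeas G.
    by apply: cbmeasM => //; apply: cbmeas_expi; exact: measurable_funM.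
  have bG1 x : cbmeas (fun y => G (x, y)) by exact: (cbmeas_comp (pair1_measurable x) bG).
  have eG x : cint leb setT (fun y => (gauss e y)%:C *
      cexp (Phi t j (- xi) x y + (0 +i* (zeta * y)))) =
      (gauss_mass e)%:C * cint N setT (fun y => G (x, y)).
    rewrite -cint_gauss//; apply: eq_cint => y _.
    by rewrite cexpD -expiE.
  under [X in cm_int _ X]eq_fun do rewrite eG.
  rewrite qhat_law; last by apply: cbmeasM; [exact: cbmeas_cst|exact: cbmeas_cint].
  rewrite -cintZl; last exact: (cbmeas_comp (pair1_measurable zeta) bK2).
  apply: eq_cint => w _; rewrite -mulrA; congr (_ * _).
  rewrite -(cintZr N _ (bG1 (v j w))); apply: eq_cint => y _.
  rewrite /G /K /h /= -mulrA [RHS]mulrCA; congr (_ * _); rewrite -!expiD.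
  by congr expi; ring.
rewrite /fhat_late_rhs.
have -> : cint leb setT (fun zeta => (gauss e zeta)%:C * cm_int (qhat j zeta eta) (fun x =>
      cint leb setT (fun y => (gauss e y)%:C * cexp (Phi t j (- xi) x y + (0 +i* (zeta * y)))))) =
    (gauss_mass e)%:C * ((gauss_mass e)%:C *
      cint N setT (fun zeta => cint P setT (fun w => K2 (zeta, w)))).
  under eq_cint do rewrite inner.
  rewrite cint_gauss//; last by apply: cbmeasM; [exact: cbmeas_cst|exact: cbmeas_cint].
  by rewrite cintZl//; exact: cbmeas_cint.
rewrite cint_swap// !mulrA.
have -> : ((2 * pi)^-1)%:C * (gauss_mass e)%:C * (gauss_mass e)%:C =
    ((2 * pi)^-1 * gauss_mass e ^+ 2)%:C :> R[i].
  by rewrite expr2 mulrA !rmorphM.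
rewrite -cintZl; last first.
  apply: (@cbmeas_cint _ _ _ _ _ N (fun p : Omega * R => K2 (p.2, p.1))).
  by apply: (cbmeas_comp _ bK2); exact: measurable_fun_pair.
apply: eq_cint => w _; rewrite smoothedE//; congr (_ * _).
have bKw : cbmeas (fun p : R * R => K (p.1, (w, p.2))).
  by apply: (cbmeas_comp _ bK); apply: measurable_fun_pair => //; exact: measurable_fun_pair.
rewrite /K2 (cint_swap N N bKw); apply: eq_cint => y _.
transitivity (cint N setT (fun z => expi (z * (y - T j w))) * h (w, y)).
  rewrite -(cintZr N (h (w, y)) (f := fun z => expi (z * (y - T j w))))//.
  by apply: cbmeas_expi; exact: measurable_funM.
by rewrite normal_expi.
Qed.

(** For each [w] this is an approximate identity at [y = T_j], which uses the continuity of
    [exp Phi] in [y]; the modulus bound on [exp Phi] dominates the integral in [w]. *)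
Let smoothed_cvg :
  ccvg 0^'+ (fun e => cint P setT (smoothed e)) (cint P setT (fun w => h (w, T j w))).
Proof.
apply: ccvg_at_right0 => e_ e0 ecv.
have [_ [M hM]] := bh.
have mh : cmeasurable (fun w => h (w, T j w)).
  have mp : measurable_fun setT (fun w => (w, T j w)) by exact: measurable_fun_pair.
  exact: (cbmeas_comp mp bh).1.
have bs e : 0 < e -> cbmeas (smoothed e).
  move=> ep0; rewrite (_ : smoothed e = fun w => ((2 * pi)^-1 * gauss_mass e ^+ 2)%:C *
      cint (normal_prob 0 (Num.sqrt e)^-1) setT (fun y => kernel e (w, y))); last first.
    by apply/funext => w; exact: smoothedE.
  by apply: cbmeasM; [exact: cbmeas_cst|exact: (@cbmeas_cint _ _ _ _ _ (normal_prob 0 (Num.sqrt e)^-1) _ (bkernel e))].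
apply: (cint_dct (M := M)) => //.
- by move=> n; exact: (bs _ (e0 n)).1.
- move=> n w.
  have bg : cbmeas (fun y => (gauss (e_ n) y)%:C * h (w, y)).
    apply: cbmeasM; last exact: (cbmeas_comp (pair1_measurable w) bh).
    apply: (@cbmeas_real _ _ _ _ 1); first exact: measurable_gauss.
    by move=> y; rewrite ger0_norm ?gauss_ge0// gauss_le1// ltW.
  have gb y z : `|z| <= M -> `|gauss (e_ n) y * z| <= M.
    move=> zM; rewrite normrM -[M]mul1r; apply: ler_pM => //.
    by rewrite ger0_norm ?gauss_ge0// gauss_le1// ltW.
  split; apply: Rintegral_le_prob => /=; [exact: bg.1.1| |exact: bg.1.2|] => y.
    by rewrite Re_real_mul; apply: gb; have [] := hM (w, y).
  by rewrite Im_real_mul; apply: gb; have [] := hM (w, y).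
- apply: aeW => w; rewrite /smoothed.
  apply: (@cint_approximate_identity _ (T j w) (fun y => h (w, y))) => //.
    exact: (cbmeas_comp (pair1_measurable w) bh).
  have [_ _ _ /(_ (v j w))[c1 c2]] := cPhi (- xi) j0 jt.
  split.
    under eq_fun do rewrite /h ReM /=.
    by rewrite /h ReM; apply: cvgB; apply: cvgM; first [exact: c1|exact: c2|exact: cvg_cst].
  under eq_fun do rewrite /h ImM /=.
  by rewrite /h ImM; apply: cvgD; apply: cvgM; first [exact: c1|exact: c2|exact: cvg_cst].
Qed.

(** Conditioning on [F j]: the defining identity of the conditional expectation is tested on the
    events [B_j \in C], which belong to [F j], and [transfer_bounded] extends it to the cosine and
    sine of [eta B_j]. *)
Let smoothed_limit : cint P setT (fun w => h (w, T j w)) = fhat (T t) (B j) xi eta.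
Proof.
have [_ [[_ iE1 eE1] [_ iE2 eE2]] _ _] := cPhi (- xi) j0 jt.
pose Y w : R[i] := expi (- xi * T t w).
have bY : cbmeas Y by apply: cbmeas_expi; exact: measurable_funM.
have [M1 mY1 bY1] := cbmeas_Re bY; have [M2 mY2 bY2] := cbmeas_Im bY.
have iY1 := bounded_integrable P mY1 bY1; have iY2 := bounded_integrable P mY2 bY2.
have mB : measurable_fun setT (B j) by exact: measurable_funPT.
have YE w : cexp (0 +i* (- xi * T t w)) = Y w by rewrite /Y expiE.
have tr1 (f : R -> R) : measurable_fun setT f -> (forall x, `|f x| <= 1) ->
    \int[P]_w (f (B j w) * complex.Re (E (v j w) (T j w))) = \int[P]_w (f (B j w) * complex.Re (Y w)).
  move=> mf fM; apply: (transfer_bounded mB mB iE1 iY1 _ mf fM) => C mC.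
  rewrite eE1; last exact: aB.
  by apply: eq_Rintegral => w _; rewrite YE.
have tr2 (f : R -> R) : measurable_fun setT f -> (forall x, `|f x| <= 1) ->
    \int[P]_w (f (B j w) * complex.Im (E (v j w) (T j w))) = \int[P]_w (f (B j w) * complex.Im (Y w)).
  move=> mf fM; apply: (transfer_bounded mB mB iE2 iY2 _ mf fM) => C mC.
  rewrite eE2; last exact: aB.
  by apply: eq_Rintegral => w _; rewrite YE.
pose c x : R := cos (- (eta * x)); pose s x : R := sin (- (eta * x)).
have ma : measurable_fun setT (fun x : R => - (eta * x)).
  by apply: measurableT_comp => //; exact: measurable_funM.
have mc : measurable_fun setT c.
  by apply: measurableT_comp => //; apply: continuous_measurable_fun; exact: continuous_cos.
have ms : measurable_fun setT s.
  by apply: measurableT_comp => //; apply: continuous_measurable_fun; exact: continuous_sin.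
have bc x : `|c x| <= 1 by exact: normr_cos_le1.
have bs x : `|s x| <= 1 by exact: normr_sin_le1.
have int (f g : _ -> R) : measurable_fun setT f -> (forall x, `|f x| <= 1) ->
    P.-integrable setT (EFin \o g) -> P.-integrable setT (EFin \o (fun w => f (B j w) * g w)).
  move=> mf fM ig; apply: (@integrable_bounded_mul _ _ _ P (f \o B j) _ 1) => //.
    exact: measurableT_comp.
  by move=> w; exact: fM.
rewrite fhatE; transitivity (cint P setT (fun w => Y w * expi (- (eta * B j w)))); last first.
  by apply: eq_cint => w _; rewrite /Y -expiD; congr expi; ring.
apply: complexE => /=.
  under eq_Rintegral do rewrite /h ReM Re_expi Im_expi -/(c _) -/(s _) mulrC [_ * s _]mulrC.
  under [RHS]eq_Rintegral do rewrite ReM Re_expi Im_expi -/(c _) -/(s _) mulrC [_ * s _]mulrC.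
  by rewrite RintegralB ?tr1 ?tr2 -?RintegralB//; exact: int.
under eq_Rintegral do rewrite /h ImM Re_expi Im_expi -/(c _) -/(s _) mulrC [_ * c _]mulrC.
under [RHS]eq_Rintegral do rewrite ImM Re_expi Im_expi -/(c _) -/(s _) mulrC [_ * c _]mulrC.
by rewrite RintegralD ?tr1 ?tr2 -?RintegralD//; exact: int.
Qed.

Lemma fhat_late : ccvg 0^'+ (fhat_late_rhs Phi qhat t j xi eta) (fhat (T t) (B j) xi eta).
Proof.
rewrite -smoothed_limit; apply: ccvg_at_right0 => e_ e0 ecv.
under [X in ccvg _ X]eq_fun do rewrite fhat_late_smoothed//.
have [/cvg_at_rightP c1 /cvg_at_rightP c2] := smoothed_cvg.
by split; [apply: c1|apply: c2].
Qed.

End LateTimes.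

(** * The density *)

Section Processes.
Context {R : realType} d (Omega : measurableType d) (P : probability Omega R).
Variable (F : R -> set (set Omega)).
Hypothesis uF : usual_filtration P F.
Implicit Types X Y : R -> {RV P >-> R}.

Lemma sigma_proc_measurable X (D : set R) : sigma_proc X D `<=` d.-measurable.
Proof.
apply: smallest_sub; first exact: sigma_algebra_measurable.
by move=> _ [s [C [_ mC ->]]]; rewrite -[X in measurable X]setTI; exact: measurable_funPT.
Qed.

Lemma sigma_proc2_measurable X Y (D : set R) : sigma_proc2 X Y D `<=` d.-measurable.
Proof.
apply: smallest_sub; first exact: sigma_algebra_measurable.
by move=> A []; exact: sigma_proc_measurable.
Qed.

Lemma sigma_proc_preimage X (D : set R) s C : D s -> measurable C -> sigma_proc X D (X s @^-1` C).
Proof. by move=> Ds mC; apply: sub_sigma_algebra; exists s, C. Qed.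

Lemma sigma_procS X (D D' : set R) : D `<=` D' -> sigma_proc X D `<=` sigma_proc X D'.
Proof.
move=> DD'; apply: sub_smallest2r; first exact: smallest_sigma_algebra.
by move=> _ [s [C [Ds mC ->]]]; exists s, C; split => //; exact: DD'.
Qed.

Lemma completion_negligible (G : set (set Omega)) (A : set Omega) : sigma_algebra setT G ->
  P.-negligible A -> completion P G A.
Proof.
by move=> sG nA; apply: completion_null => //; exact: negligible_measurable uF nA.
Qed.

Lemma natural_filtration_completion X (t : R) (A : set Omega) : 
  measurable A -> natural_filtration X t A -> completion P (sigma_proc X `[0, +oo[) A.
Proof.
move=> mA [C sC nC]; split => //; exists C => //.
by apply: sigma_procS sC => x /=; rewrite !in_itv/= andbT => /andP[].
Qed.

(* [J y - J (y - del)] has the law of [J del], which tends to [0] with [del]. *)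
Lemma levy_no_fixed_jump (J : R -> {RV P >-> R}) (y : R) : levy F J -> nondecreasing_paths J -> 0 < y ->
  \forall w \ae P, J u w @[u --> y] --> J y w.
Proof.
move=> [J0 aJ iJ sJ cJ] mJ y0.
pose del n : R := y / n.+1%:R.
have del0 n : 0 < del n by rewrite divr_gt0.
have dely n : del n <= y by rewrite ler_pdivrMr// ler_peMr ?(ltW y0)// ler1n.
have cdel : del n @[n --> \oo] --> (0 : R).
  by rewrite -[X in _ --> X](mulr0 y); apply: cvgM; [exact: cvg_cst|exact: cvg_harmonic].
pose a k : R := k.+1%:R^-1.
(* The increments just before [y] all exceed [1 / (k + 1)]. Stationarity bounds the probability by
   that of [J (del n) > 1 / (k + 1)], which tends to 0 by right continuity at time 0. *)
pose A k := [set w | forall n, a k < J y w - J (y - del n) w].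
have mS k n : measurable [set w | a k < J y w - J (y - del n) w].
  have mf : measurable_fun setT (fun w => J y w - J (y - del n) w) by exact: measurable_funB.
  have -> : [set w | a k < J y w - J (y - del n) w] =
    (fun w => J y w - J (y - del n) w) @^-1` [set` `]a k, +oo[].
    by apply/seteqP; split => w /=; rewrite in_itv/= andbT.
  by rewrite -[X in measurable X]setTI; apply: mf => //; exact: measurable_itv.
have mJ' k n : measurable [set w | a k < J (del n) w].
  have -> : [set w | a k < J (del n) w] = J (del n) @^-1` [set` `]a k, +oo[].
    by apply/seteqP; split => w /=; rewrite in_itv/= andbT.
  by rewrite -[X in measurable X]setTI; exact: measurable_funPT.
have PS k n : P [set w | a k < J y w - J (y - del n) w] = P [set w | a k < J (del n) w].
  have y1 : 0 <= y - del n by rewrite subr_ge0.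
  have y2 : y - del n < y by rewrite gtrBl.
  have := sJ _ _ [set` `]a k, +oo[] y1 y2 (measurable_itv _).
  rewrite (_ : y - (y - del n) = del n); last by rewrite opprB addrC subrK.
  have e (f : Omega -> R) : [set w | [set` `]a k, +oo[] (f w)] = [set w | a k < f w].
    by apply/seteqP; split => w /=; rewrite in_itv/= andbT.
  by rewrite !e.
have P0 k : fine (P [set w | a k < J (del n) w]) @[n --> \oo] --> (0 : R).
  have E n : fine (P [set w | a k < J (del n) w]) = \int[P]_w \1_[set w | a k < J (del n) w] w.
    by rewrite /Rintegral integral_indic// setIT.
  under eq_fun do rewrite E.
  have <- : \int[P]_w cst 0 w = 0 :> R by rewrite Rintegral_cst// mul0r.
  apply: (@bounded_dct _ _ _ P (fun n w => \1_[set w | a k < J (del n) w] w) (cst 0) 1) => //.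
  - by move=> n; exact: measurable_indic.
  - by move=> n w; rewrite indicE; case: (_ \in _); rewrite ?normr1 ?normr0.
  - apply: filterS2 J0 cJ => w j0 [/(_ _ (lexx 0)) rc _].
  have /cvg_at_rightP/(_ del)/(_ (conj del0 cdel)) c := rc.
  rewrite j0 in c.
  have a0 : 0 < a k by rewrite invr_gt0.
  apply: cvg_near_cst; near=> n; rewrite indicE memNset//= ltNge.
  apply/negP/negPn; near: n; move/cvgrPdist_le: c => /(_ _ a0).
  by apply: filterS => n; rewrite sub0r normrN; exact: le_trans (ler_norm _).
have PA k : P.-negligible (A k).
  have mA : measurable (A k).
    have -> : A k = \bigcap_n [set w | a k < J y w - J (y - del n) w].
      by apply/seteqP; split => w /= h n; [move=> _; exact: h|exact: h].
    by apply: bigcap_measurable => // n _; exact: mS.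
  apply/negligibleP => //.
  have PAn n : fine (P (A k)) <= fine (P [set w | a k < J (del n) w]).
    rewrite -PS; apply: fine_le; [exact: fin_num_measure|exact: fin_num_measure|].
    by apply: le_measure; [exact: mem_set|exact: mem_set (mS k n)|move=> w; exact].
  have PA0 : fine (P (A k)) <= 0.
    by rewrite -(cvg_lim _ (P0 k))//; apply: limr_ge; [exact: cvgP (P0 k)|exact: nearW].
  have fA : P (A k) \is a fin_num by exact: fin_num_measure.
  by apply/eqP; rewrite eq_le measure_ge0 andbT; move: PA0; rewrite -lee_fin fineK.
have nA : P.-negligible (\bigcup_k A k) by exact: negligible_bigcup.
have notA : \forall w \ae P, ~ (\bigcup_k A k) w.
  by apply: negligibleS nA => w /=; exact: contrapT.
apply: filterS3 notA mJ cJ => w nAw mono [rc _].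
apply/cvgrPdist_le => eps eps0.
have [k keps] : exists k, a k <= eps.
  have : a n @[n --> \oo] --> (0 : R) by exact: cvg_harmonic.
  move=> /cvgrPdist_le/(_ _ eps0)[k _ /(_ k (leqnn k))]; rewrite sub0r normrN => h.
  by exists k; exact: le_trans (ler_norm _) h.
(* By monotonicity this single increment controls all [u] between [y - del n] and [y]; to the right
   of [y] right continuity is enough. *)
have [n hn] : exists n, J y w - J (y - del n) w <= a k.
  apply: contrapT => h; apply: nAw; exists k => // n; rewrite /A/= ltNge.
  by apply/negP => h'; apply: h; exists n.
have rcy : \forall u \near y^'+, `|J y w - J u w| <= eps.
  by have /cvgrPdist_le/(_ _ eps0) := rc _ (ltW y0).
have [e /= e0 he] := rcy.
near=> u.
have [uy|yu|->] := ltgtP u y; last by rewrite subrr normr0 ltW.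
  have yu : y - del n <= u.
    near: u; exists (del n) => [|u /=]; first exact: del0.
    by rewrite ltr_distlC => /andP[/ltW].
  have u0 : 0 <= u by apply: le_trans yu; rewrite subr_ge0.
  rewrite ger0_norm; last by rewrite subr_ge0; exact: mono (ltW uy).
  apply: le_trans keps; apply: le_trans hn; rewrite lerD2l lerN2.
  by apply: mono => //; rewrite subr_ge0.
apply: he => //=; near: u; exact: nbhsx_ballx.
Unshelve. all: by end_near. Qed.

(** Simple integrals vanish at time 0, so [|I_0| >= 1 / (k + 1)] has a probability that is a
    constant sequence with limit 0. Needed to read [v_0 = 1] off the equation. *)
Lemma ito_integral0 (X : R -> {RV P >-> R}) (H I : R -> Omega -> R) : ito_integral F X H I ->
  \forall w \ae P, I 0 w = 0.
Proof.
move=> [aI _ [S hS]]; have [_ Fm _ _ _] := uF.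
have [_ c0] := hS 0 (lexx 0).
have sp0 n w : sp_integral (S n) X 0 w = 0.
  have st k : 0 <= sp_time (S n) k.
    by elim: k => [|k IH]; [exact: sp_time0|exact: le_trans IH (sp_time_le _ _)].
  by rewrite /sp_integral big1// => k _; rewrite !min_r// subrr mulr0.
have mI : measurable_fun setT (I 0).
  by move=> _ C mC; rewrite setTI; apply: (Fm 0) => //; exact: aI.
pose A k := [set w | k.+1%:R^-1 <= `|I 0 w|].
have mA k : measurable (A k).
  have -> : A k = (fun w => `|I 0 w|) @^-1` [set` `[k.+1%:R^-1, +oo[].
    by apply/seteqP; split => w /=; rewrite in_itv/= andbT.
  rewrite -[X in measurable X]setTI; apply: measurableT_comp => //; exact: measurable_itv.
have nA k : P.-negligible (A k).
  apply/negligibleP => //.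
  have a0 : 0 < k.+1%:R^-1 :> R by rewrite invr_gt0.
  have := c0 _ a0; under eq_fun => n.
    under [X in P X]eq_set do rewrite sp0 sub0r normrN lee_fin.
    over.
  by move=> /(cvg_lim _) <-//; rewrite lim_cst.
have nU : P.-negligible (\bigcup_k A k) by exact: negligible_bigcup.
apply: negligibleS nU => w /= /eqP I0.
have I0' : 0 < `|I 0 w| by rewrite normr_gt0.
have : (n.+1%:R^-1 : R) @[n --> \oo] --> (0 : R) by exact: cvg_harmonic.
move=> /cvgrPdist_le/(_ _ I0')[k _ /(_ k (leqnn k))]; rewrite sub0r normrN => h.
by exists k => //; exact: le_trans (ler_norm _) h.
Qed.

(** Right continuity at 0 keeps [f] above half its initial value on some [[0, dl]], and [f]
    dominates the corresponding step function on [[0, t]]. *)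
Lemma integral_gt0 (f : R -> R) (t : R) : 0 < t -> {within `[0, +oo[, continuous f} ->
  (forall s, 0 <= s -> 0 <= f s) -> 0 < f 0 ->
  0 < \int[lebesgue_measure]_(s in `[0, t]) f s.
Proof.
move=> t0 cf f0 f00; pose a := f 0 / 2; have a0 : 0 < a by rewrite divr_gt0.
have [_ /cvgrPdist_le/(_ _ a0)[e /= e0 he]] := (continuous_within_itvcyP _ _).1 cf.
pose dl := Num.min (e / 2) t; have d0 : 0 < dl by rewrite lt_min divr_gt0.
have dt : dl <= t by rewrite ge_min lexx orbT.
have de : dl < e by rewrite gt_min gtr_pMr// invf_lt1// ltr1n.
have fa s : 0 <= s -> s <= dl -> a <= f s.
  rewrite le_eqVlt => /predU1P[<- _|s0 sd]; first by rewrite ler_pdivrMr// ler_peMr ?(ltW f00)// ler1n.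
  have := he s; rewrite /ball_/= sub0r normrN gtr0_norm// => /(_ (le_lt_trans sd de) s0).
  by move=> /(le_trans (ler_norm _)); rewrite /a; lra.
have cf' : {within `[0, t], continuous f}.
  by apply: continuous_subspaceW cf => x /=; rewrite !in_itv/= andbT => /andP[].
have it := continuous_compact_integrable (@segment_compact _ _ _) cf'.
have mI : measurable [set` `[0, t]] by exact: measurable_itv.
have mD : measurable [set` `[0, dl]] by exact: measurable_itv.
have iD : (@lebesgue_measure R).-integrable [set` `[0, t]] (EFin \o (\1_[set` `[0, dl]] : R -> R)).
  by apply: (integrableS measurableT) => //; exact: (@integrable_indic_itv R 0 dl true false).
have iaD : (@lebesgue_measure R).-integrable [set` `[0, t]]
    (EFin \o (fun s => a * \1_[set` `[0, dl]] s)).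
  have h := @integrableZl _ _ R (@lebesgue_measure R) _ (measurable_itv _) a _ iD.
  by move: h; congr (integrable _ _ _); apply/funext => s; rewrite /= EFinM.
have E : \int[lebesgue_measure]_(s in `[0, t]) (a * \1_[set` `[0, dl]] s) = a * dl.
  rewrite RintegralZl//; congr (_ * _); rewrite /Rintegral integral_indic// setIidl; last first.
    by move=> s /=; rewrite !in_itv/= => /andP[-> /le_trans->].
  transitivity (fine (@lebesgue_measure R [set` `[0%R, dl]])) => //.
  by rewrite lebesgue_measure_itv/= lte_fin d0 oppr0 adde0.
apply: (@lt_le_trans _ _ (a * dl)); first by rewrite mulr_gt0.
rewrite -E; apply: le_Rintegral => //.
move=> s /=; rewrite in_itv/= => /andP[s0 st]; rewrite indicE.
case: (boolP (_ \in _)) => [/set_mem|_]; last by rewrite mulr0 f0.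
by rewrite /= in_itv/= mulr1 => /andP[_]; exact: fa.
Qed.

Lemma T_gt0 (B v T : R -> {RV P >-> R}) mu sigma (t : R) : strong_solution F B mu sigma v T ->
  (\forall w \ae P, forall s, 0 <= s -> 0 <= v s w) -> 0 < t ->
  \forall w \ae P, 0 < T t w.
Proof.
move=> [_ cv _ [I iI eI] eT] v0 t0.
have v1 : \forall w \ae P, v 0 w = 1.
  apply: filterS2 (ito_integral0 iI) eI => w I0 /(_ 0 (lexx 0)) ->.
  by rewrite I0 set_itv1 Rintegral_set1 !addr0.
have v2 : \forall w \ae P, 0 < v 0 w /\ {within `[0, +oo[, continuous (fun u => v u w)}.
  by apply: filterS2 v1 cv => w ->.
apply: filterS3 v2 eT v0 => w [v0w cw] -> //; last exact: ltW.
by move=> vp; exact: integral_gt0 t0 cw vp v0w.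
Qed.

End Processes.

Section BrownianFourier.
Context {R : realType} d (Omega : measurableType d) (P : probability Omega R).
Variable F : R -> set (set Omega).

Lemma brownian_fourier (X : R -> {RV P >-> R}) (j u : R) : brownian F X -> 0 <= j ->
  cint P setT (fun w => expi (X j w * u)) = (expR (- (j * u ^+ 2 / 2)))%:C.
Proof.
move=> [X0 _ _ nX _] j0.
have bu : cbmeas (fun y : R => expi (y * u)) by apply: cbmeas_expi; exact: measurable_funM.
transitivity (cint P setT (fun w => expi ((X j w - X 0 w) * u))).
  by apply: cint_ae_eq; apply: filterS X0 => w ->; rewrite subr0.
move: j0; rewrite le_eqVlt => /predU1P[<-|j0].
  rewrite !mul0r oppr0 expR0 [LHS](_ : _ = cint P setT (fun _ : Omega => (1 : R)%:C)).
    by rewrite cint_real Rintegral_cst// mul1r /= (@probability_setT _ _ _ P).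
  by apply: eq_cint => w _; rewrite subrr mul0r expi0.
have sj : 0 < Num.sqrt (j - 0) by rewrite subr0 sqrtr_gt0.
rewrite -(@cint_law _ _ _ P _ _ (normal_prob 0 (Num.sqrt (j - 0))) (fun w => X j w - X 0 w)
  (fun y => expi (y * u)))//; last 2 first.
- exact: measurable_funB.
- by move=> A mA; exact: esym (nX _ _ _ (lexx 0) j0 mA).
by rewrite normal_expi// sqr_sqrtr subr0// ltW.
Qed.

Variables (B W v T : R -> {RV P >-> R}) (mu sigma : R -> R -> R) (rho : R).
Hypothesis bW : brownian F W.
Hypothesis iBW : indep_sigma P (sigma_proc B `[0, +oo[) (sigma_proc W `[0, +oo[).
Hypothesis sol : strong_solution F B mu sigma v T.
Hypotheses (rho1 : -1 <= rho <= 1) (rho0 : rho != 0).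

(** The frequency [eta] of [B_j] is the frequency [eta / rho] of [Z_j]. The part of [Z_j] carried by
    [W] then has characteristic function equal to the Gaussian factor, and it splits off because a
    strong solution makes [T_t] measurable for the completed sigma-algebra of [B] alone. *)
Lemma fhat_correlated (t j xi eta : R) : 0 <= t -> 0 <= j ->
  fhat (T t) (B j) xi eta * (expR (- ((1 - rho ^+ 2) * eta ^+ 2 * j / (2 * rho ^+ 2))))%:C =
  cint P setT (fun w => expi (- (xi * T t w)
    - eta / rho * (rho * B j w + Num.sqrt (1 - rho ^+ 2) * W j w))).
Proof.
move=> t0 j0; set r := Num.sqrt _.
have r2 : r ^+ 2 = 1 - rho ^+ 2.
  rewrite sqr_sqrtr// subr_ge0 -[leRHS](expr1n _ 2) -[leLHS]real_normK ?num_real//.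
  by rewrite lerXn2r ?nnegrE// ler_norml.
pose u := - (eta / rho * r).
have sGB : sigma_algebra setT (sigma_proc B `[0, +oo[) by exact: smallest_sigma_algebra.
have sGW : sigma_algebra setT (sigma_proc W `[0, +oo[) by exact: smallest_sigma_algebra.
have cB := sigma_algebra_completion P sGB; have cW := sigma_algebra_completion P sGW.
pose GB := completion P (sigma_proc B `[0, +oo[); pose GW := completion P (sigma_proc W `[0, +oo[).
have mT : measurable_fun setT (T t : g_sigma_algebraType GB -> R).
  apply: measurable_sigma_fun => // C mC; have [[_ aT] _ _ _ _] := sol.
  apply: natural_filtration_completion; last exact: aT.
  by rewrite -[X in measurable X]setTI; exact: measurable_funPT.
have mB : measurable_fun setT (B j : g_sigma_algebraType GB -> R).
  apply: measurable_sigma_fun => // C mC; apply: sub_completion; first exact: sigma_proc_measurable.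
  by apply: sigma_proc_preimage => //=; rewrite in_itv/= j0.
have mW : measurable_fun setT (W j : g_sigma_algebraType GW -> R).
  apply: measurable_sigma_fun => // C mC; apply: sub_completion; first exact: sigma_proc_measurable.
  by apply: sigma_proc_preimage => //=; rewrite in_itv/= j0.
pose f (p : g_sigma_algebraType GB * g_sigma_algebraType GW) : R[i] :=
  expi (- (xi * T t p.1) - eta * B j p.1) * expi (W j p.2 * u).
have b1 : cbmeas (fun w : g_sigma_algebraType GB => expi (- (xi * T t w) - eta * B j w)).
  apply: cbmeas_expi; apply: measurable_funB; last exact: measurable_funM.
  by apply: measurableT_comp => //; exact: measurable_funM.
have b2 : cbmeas (fun w : g_sigma_algebraType GW => expi (W j w * u)).
  by apply: cbmeas_expi; exact: measurable_funM.
have bf : cbmeas f.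
  apply: cbmeasM; first exact: (cbmeas_comp (@measurable_fst _ _ _ _) b1).
  exact: (cbmeas_comp (@measurable_snd _ _ _ _) b2).
have b3 : cbmeas (fun w => expi (- (xi * T t w) - eta * B j w)).
  apply: cbmeas_expi; apply: measurable_funB; last by apply: measurable_funM.
  by apply: measurableT_comp => //; apply: measurable_funM.
have b4 : cbmeas (fun w => expi (W j w * u)) by apply: cbmeas_expi; apply: measurable_funM.
transitivity (cint P setT (fun w => f (w, w))); last first.
  apply: eq_cint => w _; rewrite /f -expiD; congr expi; rewrite /u /=.
  by field.
rewrite (indep_sigma_cint cB cW (@completion_measurable _ _ _ P _) (@completion_measurable _ _ _ P _) _ bf); last first.
  by apply: indep_completion => //; exact: sigma_proc_measurable.
rewrite fhatE -cintZr//; apply: eq_cint => w _.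
rewrite /f /= cintZl//; congr (_ * _); rewrite brownian_fourier//; congr ((expR _)%:C).
rewrite /u sqrrN exprMn r2 exprMn exprVn; field.
exact: rho0.
Qed.

End BrownianFourier.

(** * Iterated integrals against Gaussian weights *)

Section IteratedIntegrals.
Context {R : realType}.
Notation leb := (@lebesgue_measure R).

(** Packs the product as a probability, so that lemmas about probabilities can be applied to it
    again. *)
Definition prodP d1 d2 (X1 : measurableType d1) (X2 : measurableType d2)
  (m1 : probability X1 R) (m2 : probability X2 R) : probability (X1 * X2)%type R := (m1 \x m2)%E.

Lemma cint_prod d1 d2 (X1 : measurableType d1) (X2 : measurableType d2)
    (m1 : probability X1 R) (m2 : probability X2 R) (f : X1 * X2 -> R[i]) : cbmeas f ->
  cint m1 setT (fun x => cint m2 setT (fun y => f (x, y))) = cint (prodP m1 m2) setT f.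
Proof.
move=> bf; have [M1 mf1 b1] := cbmeas_Re bf; have [M2 mf2 b2] := cbmeas_Im bf.
by apply: complexE => /=; [rewrite (Rintegral_prod m1 m2 mf1 b1)|rewrite (Rintegral_prod m1 m2 mf2 b2)].
Qed.

Lemma cint_rotate d1 d2 d3 (X1 : measurableType d1) (X2 : measurableType d2)
    (X3 : measurableType d3) (m1 : probability X1 R) (m2 : probability X2 R)
    (m3 : probability X3 R) (f : X1 * X2 * X3 -> R[i]) : cbmeas f ->
  cint m1 setT (fun x => cint m2 setT (fun y => cint m3 setT (fun z => f (x, y, z)))) =
  cint m3 setT (fun z => cint m1 setT (fun x => cint m2 setT (fun y => f (x, y, z)))).
Proof.
move=> bf; rewrite (@cint_prod _ _ _ _ m1 m2 (fun p => cint m3 setT (fun z => f (p, z)))); last first.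
  exact: cbmeas_cint.
rewrite (cint_swap (prodP m1 m2) m3 bf); apply: eq_cint => z _.
rewrite (@cint_prod _ _ _ _ m1 m2 (fun p => f (p, z)))//.
exact: (cbmeas_comp (pair2_measurable z) bf).
Qed.

Lemma cint_gauss3 (e : R) (H : R * R * R -> R[i]) (N := normal_prob 0 (Num.sqrt e)^-1) :
  0 < e -> cbmeas H ->
  cint leb setT (fun x => cint leb setT (fun y => cint leb setT (fun z =>
    (gauss e x * gauss e y * gauss e z)%:C * H (x, y, z)))) =
  (gauss_mass e ^+ 3)%:C *
  cint N setT (fun x => cint N setT (fun y => cint N setT (fun z => H (x, y, z)))).
Proof.
move=> e0 bH.
have bH1 p : cbmeas (fun z => H (p, z)) by exact: (cbmeas_comp (pair1_measurable p) bH).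
have bH2 : cbmeas (fun p => cint N setT (fun z => H (p, z))) by exact: (@cbmeas_cint _ _ _ _ _ N).
have bH3 x : cbmeas (fun y => cint N setT (fun z => H (x, y, z))).
  exact: (cbmeas_comp (pair1_measurable x) bH2).
have bH4 : cbmeas (fun x => cint N setT (fun y => cint N setT (fun z => H (x, y, z)))).
  exact: (@cbmeas_cint _ _ _ _ _ N _ bH2).
have bc c d0 (X0 : measurableType d0) (f : X0 -> R[i]) : cbmeas f -> cbmeas (fun x => c * f x).
  by apply: cbmeasM; exact: cbmeas_cst.
have s1 x y : cint leb setT (fun z => (gauss e x * gauss e y * gauss e z)%:C * H (x, y, z)) =
    (gauss e y)%:C * (((gauss e x)%:C * (gauss_mass e)%:C) * cint N setT (fun z => H (x, y, z))).
  transitivity (cint leb setT (fun z => (gauss e z)%:C * ((gauss e x * gauss e y)%:C * H (x, y, z)))).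
    by apply: eq_cint => z _; rewrite mulrA -rmorphM [_ * gauss e z]mulrC.
  rewrite cint_gauss//; last exact: bc.
  rewrite (cintZl N _ (bH1 (x, y))); move: (cint N _ _) => I.
  by rewrite rmorphM; ring.
have s2 x : cint leb setT (fun y => cint leb setT (fun z =>
      (gauss e x * gauss e y * gauss e z)%:C * H (x, y, z))) =
    (gauss e x)%:C * (((gauss_mass e)%:C * (gauss_mass e)%:C) *
      cint N setT (fun y => cint N setT (fun z => H (x, y, z)))).
  under eq_cint do rewrite s1.
  rewrite cint_gauss//; last exact: bc.
  rewrite (cintZl N _ (bH3 x)); move: (cint N _ _) => I.
  by ring.
under eq_cint do rewrite s2.
rewrite cint_gauss//; last exact: bc.
rewrite (cintZl N _ bH4); move: (cint N _ _) => I.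
by rewrite exprS expr2 !rmorphM; ring.
Qed.

End IteratedIntegrals.

Lemma measurable_parameter_integral {R : realType} d1 d2 (X : measurableType d1) (Y : measurableType d2)
    (m : probability Y R) (f : X * Y -> R) M :
  measurable_fun setT f -> (forall p, `|f p| <= M) ->
  measurable_fun setT (fun x => \int[m]_y f (x, y)).
Proof. by move=> mf fM; have [[]] := cbmeas_cint m (cbmeas_real mf fM). Qed.

Section GaussianAverage.
Context {R : realType} d (X : measurableType d).

(** The measure of integration moves with [x]; [gauss_inversion] rewrites it as a fixed normal law
    with a jointly measurable kernel. *)
Lemma measurable_gauss_average (a : X -> R) (G : X * R -> R) (M e : R) : 0 < e ->
  measurable_fun setT a -> measurable_fun setT G -> (forall p, `|G p| <= M) ->
  measurable_fun setT (fun x => \int[normal_prob (a x) (Num.sqrt e)]_y (gauss e y * G (x, y))).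
Proof.
move=> e0 ma mG GM.
pose k (p : X * R) : R := gkernel e (a p.1) p.2 * G p.
have mk : measurable_fun setT k.
  by apply: measurable_funM => //; apply: measurable_gkernel => //; exact: measurableT_comp.
have kM p : `|k p| <= M.
  by rewrite normrM -[M]mul1r; apply: ler_pM => //; exact: gkernel_le1.
rewrite (_ : (fun x => _) = fun x => (2 * pi)^-1 * gauss_mass e ^+ 2 *
    \int[normal_prob 0 (Num.sqrt e)^-1]_y k (x, y)); last first.
  apply/funext => x.
  have bG : cbmeas (fun y : R => (G (x, y))%:C).
    apply: (@cbmeas_real _ _ _ _ M) => //.
    exact: (measurableT_comp mG (pair1_measurable x)).
  have := gauss_inversion (a x) e0 bG.
  under [X in _ * X]eq_cint do rewrite -rmorphM.
  under [X in _ = X]eq_cint do rewrite -rmorphM.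
  by rewrite !cint_real -rmorphM => -[].
apply: measurable_funM => //.
exact: (measurable_parameter_integral (normal_prob 0 (Num.sqrt e)^-1) mk kM).
Qed.

End GaussianAverage.

(** * Regularized density tested against a smooth function *)

Section Smoothing.
Context {R : realType} d (Omega : measurableType d) (P : probability Omega R).
Notation leb := (@lebesgue_measure R).
Variables (Tt : Omega -> R) (U : R * (Omega * Omega) -> R) (rho : R).
Hypotheses (mT : measurable_fun setT Tt) (mU : measurable_fun setT U) (rho0 : rho != 0).

Let ind (y : R) : R := \1_[set` `[0, +oo[] y.

Let mind : measurable_fun setT ind.
Proof. by apply: measurable_indic; exact: measurable_itv. Qed.

Let ind_le1 y : `|ind y| <= 1.
Proof. by rewrite /ind indicE; case: (_ \in _); rewrite ?normr1 ?normr0. Qed.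

Let cbmeas_ind : cbmeas (fun y => (ind y)%:C).
Proof. exact: cbmeas_real mind ind_le1. Qed.

Let N e : probability _ R := normal_prob 0 (Num.sqrt e)^-1.
Let M e := prodP (N e) (prodP P P).
Let weight e (m : R * (Omega * Omega)) : R := ind m.1 * gkernel e (Tt m.2.2) m.1.

Let mweight e : measurable_fun setT (weight e).
Proof.
apply: measurable_funM; first exact: measurableT_comp.
apply: measurable_gkernel => //.
by apply: measurableT_comp => //; exact: measurableT_comp.
Qed.

Let weight_bound e m : `|weight e m| <= 1.
Proof.
by rewrite normrM -[leRHS]mul1r; apply: ler_pM => //; exact: gkernel_le1.
Qed.

(* [U (y, (w1, w2))] stands for [Z_{J_y(w1)}(w2)] and [Tt w2] for [T_t(w2)]; by
   independence, the path [w1] of [J] and the path [w2] of [(B, W)] may be taken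
   on two copies of [Omega]. *)
Definition spectral_integral (e z : R) : R[i] :=
  cint (N e) setT (fun xi => cint (N e) setT (fun eta => cint (N e) setT (fun y =>
    (ind y)%:C * cint P setT (fun w1 => cint P setT (fun w2 =>
      expi (xi * (y - Tt w2)) * expi (eta * ((z - U (y, (w1, w2))) / rho))))))).

(** The [eta] integral sees [(z - U) / rho], so the cutoff of parameter [e] acts in the variable [z]
    as a Gaussian of variance [rho^2 e]. *)
Let e' e := rho ^+ 2 * e.
Let C0 e : R := (2 * pi)^-1 * gauss_mass (e' e).
Let C1 e : R := (2 * pi)^-1 * gauss_mass e ^+ 2.

Let gauss_mass_scale e : 0 < e -> gauss_mass (e' e) = gauss_mass e / `|rho|.
Proof.
move=> e0; have pi0 := pi_gt0 R.
rewrite /gauss_mass /normal_peak !invrK /e' sqrtrM ?sqr_ge0// sqrtr_sqr invfM exprMn.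
have h (a b p : R) : a * b * p *+ 2 = a * (b * p *+ 2) by ring.
rewrite h (sqrtrM _ (sqr_ge0 `|rho|^-1)) sqrtr_sqr mulrC.
by rewrite ger0_norm// invr_ge0.
Qed.

(** Once [xi] and [eta] are integrated first, each frequency integral is a normal characteristic
    function, that is a [gkernel]: one centred at [T_t] in [y], the other at [U] in [z]. *)
Lemma spectral_integralE e z : 0 < e ->
  spectral_integral e z = cint (M e) setT (fun m => (weight e m * gkernel (e' e) (U m) z)%:C).
Proof.
move=> e0; have s0 : 0 < (Num.sqrt e)^-1 by rewrite invr_gt0 sqrtr_gt0.
pose f (p : R * R * (R * (Omega * Omega))) : R[i] := (ind p.2.1)%:C *
  (expi (p.1.1 * (p.2.1 - Tt p.2.2.2)) * expi (p.1.2 * ((z - U p.2) / rho))).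
have bf : cbmeas f.
  apply: cbmeasM.
    apply: (cbmeas_comp (h := fun p : R * R * (R * (Omega * Omega)) => p.2.1) _ cbmeas_ind).
    exact: measurableT_comp.
  apply: cbmeasM; apply: cbmeas_expi; apply: measurable_funM; try exact: measurableT_comp.
    apply: measurable_funB; first exact: measurableT_comp.
    by apply: measurableT_comp => //; do 2 apply: measurableT_comp => //.
  by apply: measurable_funM => //; apply: measurable_funB => //; exact: measurableT_comp.
transitivity (cint (N e) setT (fun xi => cint (N e) setT (fun eta => cint (M e) setT (fun m => f (xi, eta, m))))).
  apply: eq_cint => xi _; apply: eq_cint => eta _.
  have bf1 : cbmeas (fun m => f (xi, eta, m)) by exact: (cbmeas_comp (pair1_measurable (xi, eta)) bf).
  rewrite -(cint_prod (N e) (prodP P P) bf1); apply: eq_cint => y _.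
  have bf2 : cbmeas (fun w : Omega * Omega => f (xi, eta, (y, w))).
    exact: (cbmeas_comp (pair1_measurable y) bf1).
  rewrite -(cint_prod P P bf2).
  have bg : cbmeas (fun w : Omega * Omega =>
      expi (xi * (y - Tt w.2)) * expi (eta * ((z - U (y, w)) / rho))).
    apply: cbmeasM; apply: cbmeas_expi; apply: measurable_funM => //.
      by apply: measurable_funB => //; exact: measurableT_comp.
    apply: measurable_funM => //; apply: measurable_funB => //.
    exact: (measurableT_comp mU (pair1_measurable y)).
  have bg1 : cbmeas (fun w1 => cint P setT (fun w2 =>
      expi (xi * (y - Tt w2)) * expi (eta * ((z - U (y, (w1, w2))) / rho)))).
    exact: (@cbmeas_cint _ _ _ _ _ P _ bg).
  rewrite -(cintZl P _ bg1); apply: eq_cint => w1 _.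
  by rewrite -(cintZl P _ (cbmeas_comp (pair1_measurable w1) bg)).
rewrite (cint_rotate (N e) (N e) (M e) bf); apply: eq_cint => m _.
have be c : cbmeas (fun x : R => expi (x * c)) by apply: cbmeas_expi; exact: measurable_funM.
transitivity (cint (N e) setT (fun xi => (ind m.1)%:C * (expi (xi * (m.1 - Tt m.2.2)) *
    (gkernel (e' e) (U m) z)%:C))).
  apply: eq_cint => xi _; rewrite /f /= (cintZl (N e)); last first.
    by apply: cbmeasM; [exact: cbmeas_cst|exact: be].
  rewrite (cintZl (N e) _ (be _)); congr (_ * (_ * _)).
  rewrite normal_expi//; congr ((expR (- _))%:C).
  rewrite /e' sqrtrM ?sqr_ge0// sqrtr_sqr invfM !exprMn !exprVn real_normK ?num_real//.
  by move: (Num.sqrt e ^+ 2)^-1 => c; field.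
rewrite (cintZl (N e)); last by apply: cbmeasM; [exact: be|exact: cbmeas_cst].
by rewrite (cintZr (N e) _ (be _)) normal_expi// -!rmorphM mulrA.
Qed.

Variables (phi : R -> R) (K Kc L : R).
Hypotheses (mphi : measurable_fun setT phi) (phiK : forall x, `|phi x| <= K).
Hypothesis phi0 : forall x, Kc < `|x| -> phi x = 0.

(** What integration in [z] makes of [phi] when the process [Z] sits at [u]. *)
Definition smoothed_test (e u : R) : R := \int[normal_prob u (Num.sqrt (rho ^+ 2 * e))]_z phi z.

(* Writes [phi dz] as a bounded function times a finite measure. *)
Let psi z : R := phi z * expR (z ^+ 2 / 2).

Let psiE z : phi z = gauss 1 z * psi z.
Proof. by rewrite /gauss mul1r mulrCA -expRD addNr expR0 mulr1. Qed.

Let psi_bound z : `|psi z| <= K * expR (Kc ^+ 2 / 2).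
Proof.
have K0 : 0 <= K by exact: le_trans (normr_ge0 _) (phiK 0).
have [zK|/phi0 z0] := leP `|z| Kc; last first.
  by rewrite /psi z0 mul0r normr0 mulr_ge0// expR_ge0.
rewrite normrM; apply: ler_pM => //; rewrite ger0_norm ?expR_ge0// ler_expR.
rewrite ler_pM2r ?invr_gt0// -real_normK ?num_real// lerXn2r ?nnegrE//.
exact: le_trans (normr_ge0 _) zK.
Qed.

Let mpsi : measurable_fun setT psi.
Proof.
apply: measurable_funM => //; apply: measurableT_comp => //.
by apply: measurable_funM => //; exact: measurable_funX.
Qed.

Let e'_gt0 e : 0 < e -> 0 < e' e.
Proof. by move=> e0; rewrite mulr_gt0// exprn_even_gt0. Qed.

Let psi_gkernel_bound e u z : `|psi z * gkernel e u z| <= K * expR (Kc ^+ 2 / 2).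
Proof.
by rewrite normrM -[leRHS]mulr1; apply: ler_pM => //; exact: gkernel_le1.
Qed.

Let N1 : probability _ R := normal_prob 0 (Num.sqrt 1)^-1.

Let smoothed_testE e u : 0 < e -> smoothed_test e u =
  gauss_mass 1 * C0 e * \int[N1]_z (psi z * gkernel (e' e) u z).
Proof.
move=> /e'_gt0 e0; rewrite /smoothed_test -/(e' e).
rewrite (Rintegral_normal _ _ mphi phiK).
have mg : measurable_fun setT (fun z => psi z * gkernel (e' e) u z).
  by apply: measurable_funM => //; exact: measurable_gkernel.
have mg0 : measurable_fun setT (fun z => C0 e * (psi z * gkernel (e' e) u z)).
  exact: measurable_funM.
have C00 : 0 <= C0 e.
  by rewrite /C0 mulr_ge0// ?invr_ge0 ?mulr_ge0 ?pi_ge0// invr_ge0 normal_peak_ge0.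
have bg0 z : `|C0 e * (psi z * gkernel (e' e) u z)| <= C0 e * (K * expR (Kc ^+ 2 / 2)).
  by rewrite normrM ger0_norm// ler_wpM2l.
have iN : N1.-integrable setT (EFin \o (fun z => psi z * gkernel (e' e) u z)).
  by apply: (bounded_integrable N1 mg) => z; exact: psi_gkernel_bound.
rewrite -mulrA -RintegralZl// -(Rintegral_gauss ltr01 mg0 bg0).
apply: eq_Rintegral => z _; rewrite psiE -(gauss_mass_pdf u z e0) -/(C0 e).
by rewrite -/(gauss_mass _); ring.
Qed.

Let smoothed_test_bound e u : `|smoothed_test e u| <= K.
Proof. exact: (Rintegral_le_prob (normal_prob u _) mphi phiK). Qed.

Let measurable_smoothed_test e : 0 < e -> measurable_fun setT (smoothed_test e).
Proof.
move=> e0; rewrite (_ : smoothed_test e = fun u => gauss_mass 1 * C0 e *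
  \int[N1]_z (psi z * gkernel (e' e) u z)); last first.
  by apply/funext => u; exact: smoothed_testE.
apply: measurable_funM => //.
apply: (@measurable_parameter_integral _ _ _ _ _ N1 (fun p : R * R => psi p.2 * gkernel (e' e) p.1 p.2)
  (K * expR (Kc ^+ 2 / 2))) => [|p]; last exact: psi_gkernel_bound.
apply: measurable_funM; first exact: measurableT_comp.
exact: measurable_gkernel.
Qed.

(** The three masses are shared out: two with one factor [1 / (2 pi)] normalize the [xi] and [y]
    integrals, the third with [1 / (2 pi |rho|)] the [eta] integral. The [|rho|] of the density
    formula comes from the rescaling in [gauss_mass_scale]. *)
Let C10 e : 0 < e -> ((2 * pi) ^+ 2 * `|rho|)^-1 * gauss_mass e ^+ 3 = C1 e * C0 e.
Proof.
move=> e0; rewrite /C1 /C0 gauss_mass_scale// invfM -exprVn.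
by move: (gauss_mass e) (2 * pi)^-1 => g p; ring.
Qed.

(** Fubini lets [z] be integrated first, which replaces the kernel around [U] by [smoothed_test];
    [gauss_inversion] then turns the kernel around [T_t] into a normal law in [y], inside the
    integral over [w2]. *)
Lemma spectral_test e : 0 < e ->
  cint leb setT (fun z => (phi z)%:C *
    ((((2 * pi) ^+ 2 * `|rho|)^-1 * gauss_mass e ^+ 3)%:C * spectral_integral e z)) =
  (\int[P]_w2 \int[normal_prob (Tt w2) (Num.sqrt e)]_y
    (gauss e y * (ind y * \int[P]_w1 smoothed_test e (U (y, (w1, w2))))))%:C.
Proof.
move=> e0; rewrite C10//.
pose h (p : R * (R * (Omega * Omega))) : R[i] :=
  (psi p.1 * (weight e p.2 * gkernel (e' e) (U p.2) p.1))%:C.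
have bwk z : cbmeas (fun m : R * (Omega * Omega) => (weight e m * gkernel (e' e) (U m) z)%:C).
  apply: (@cbmeas_real _ _ _ _ 1) => [|m].
    apply: measurable_funM; first exact: mweight.
    by apply: measurable_gkernel => //; exact: measurable_cst.
  by rewrite normrM -[leRHS]mulr1; apply: ler_pM => //; exact: gkernel_le1.
have bh : cbmeas h.
  apply: (@cbmeas_real _ _ _ _ (K * expR (Kc ^+ 2 / 2))) => [|p].
    apply: measurable_funM; first exact: measurableT_comp.
    apply: measurable_funM; first exact: (measurableT_comp (mweight e) (@measurable_snd _ _ _ _)).
    apply: measurable_gkernel => //; exact: (measurableT_comp mU (@measurable_snd _ _ _ _)).
  by rewrite mulrCA normrM -[leRHS]mul1r; apply: ler_pM.
have bh1 : cbmeas (fun z => cint (M e) setT (fun m => h (z, m))).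
  exact: (@cbmeas_cint _ _ _ _ _ (M e) _ bh).
have bh2 : cbmeas (fun m => cint N1 setT (fun z => h (z, m))).
  apply: (@cbmeas_cint _ _ _ _ _ N1 (fun p => h (p.2, p.1))).
  by apply: (cbmeas_comp _ bh); exact: measurable_fun_pair.
transitivity (cint leb setT (fun z => (gauss 1 z)%:C *
    ((C1 e * C0 e)%:C * cint (M e) setT (fun m => h (z, m))))).
  apply: eq_cint => z _; rewrite spectral_integralE// psiE rmorphM -!mulrA; congr (_ * _).
  rewrite mulrCA; congr (_ * _); rewrite -(cintZl (M e)).
    by apply: eq_cint => m _; rewrite -rmorphM.
  exact: bwk.
rewrite cint_gauss//; last by apply: cbmeasM; [exact: cbmeas_cst|].
rewrite (cintZl N1 _ bh1) (cint_swap N1 (M e) bh).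
pose g (p : R * Omega * Omega) : R[i] :=
  (weight e (p.1.1, (p.1.2, p.2)))%:C * (smoothed_test e (U (p.1.1, (p.1.2, p.2))))%:C.
have mre : measurable_fun setT (fun p : R * Omega * Omega => (p.1.1, (p.1.2, p.2))).
  apply: measurable_fun_pair; first exact: measurableT_comp.
  by apply: measurable_fun_pair => //; exact: measurableT_comp.
have bs : cbmeas (fun m : R * (Omega * Omega) => (smoothed_test e (U m))%:C).
  by apply: (@cbmeas_real _ _ _ _ K) => //; exact: (measurableT_comp (measurable_smoothed_test e0) mU).
have bw : cbmeas (fun m : R * (Omega * Omega) => (weight e m)%:C).
  by apply: (@cbmeas_real _ _ _ _ 1) => //; exact: mweight.
have bg0 : cbmeas (fun m : R * (Omega * Omega) => (weight e m)%:C * (smoothed_test e (U m))%:C).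
  exact: cbmeasM.
have bg : cbmeas g by exact: (cbmeas_comp mre bg0).
transitivity ((C1 e)%:C * cint (M e) setT
    (fun m => (weight e m)%:C * (smoothed_test e (U m))%:C)).
  have reorder (a b c : R) (I : R[i]) : a%:C * ((b * c)%:C * I) = b%:C * ((a * c)%:C * I).
    by rewrite !rmorphM; ring.
  rewrite reorder; congr (_ * _).
  rewrite -(cintZl (M e) _ bh2); apply: eq_cint => m _.
  have -> : (smoothed_test e (U m))%:C = (gauss_mass 1 * C0 e)%:C *
      cint N1 setT (fun z => (psi z * gkernel (e' e) (U m) z)%:C).
    by rewrite cint_real -rmorphM smoothed_testE.
  rewrite [RHS]mulrCA; congr (_ * _).
  rewrite -(cintZl N1); last first.
    apply: (@cbmeas_real _ _ _ _ (K * expR (Kc ^+ 2 / 2))) => [|z]; last exact: psi_gkernel_bound.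
    by apply: measurable_funM => //; exact: measurable_gkernel.
  by apply: eq_cint => z _; rewrite /h /= mulrCA rmorphM.
rewrite -(cint_prod (N e) (prodP P P) bg0).
have -> : cint (N e) setT (fun y => cint (prodP P P) setT
      (fun w => (weight e (y, w))%:C * (smoothed_test e (U (y, w)))%:C)) =
    cint (N e) setT (fun y => cint P setT (fun w1 => cint P setT (fun w2 => g (y, w1, w2)))).
  apply: eq_cint => y _.
  by rewrite -(cint_prod P P (cbmeas_comp (pair1_measurable y) bg0)).
rewrite (cint_rotate (N e) P P bg).
pose S (p : R * Omega) := cint P setT (fun w1 => (smoothed_test e (U (p.1, (w1, p.2))))%:C).
have bS : cbmeas S.
  apply: (@cbmeas_cint _ _ _ _ _ P
    (fun p : R * Omega * Omega => (smoothed_test e (U (p.1.1, (p.2, p.1.2))))%:C)).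
  apply: (cbmeas_comp (h := fun p : R * Omega * Omega => (p.1.1, (p.2, p.1.2))) _ bs).
  apply: measurable_fun_pair; first exact: measurableT_comp.
  by apply: measurable_fun_pair => //; exact: measurableT_comp.
have bG w2 : cbmeas (fun y => (ind y)%:C * S (y, w2)).
  have bS1 : cbmeas (fun y => S (y, w2)).
    exact: (cbmeas_comp (h := fun y : R => (y, w2)) (pair2_measurable w2) bS).
  exact: (cbmeasM cbmeas_ind bS1).
have inner w2 y : cint P setT (fun w1 => g (y, w1, w2)) =
    (gkernel e (Tt w2) y)%:C * ((ind y)%:C * S (y, w2)).
  have bs1 : cbmeas (fun w1 : Omega => (smoothed_test e (U (y, (w1, w2))))%:C).
    apply: (cbmeas_comp (h := fun w1 : Omega => (y, (w1, w2))) _ bs).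
    by apply: measurable_fun_pair => //; exact: measurable_fun_pair.
  by rewrite mulrA -rmorphM [_ * ind y]mulrC -(cintZl P _ bs1).
under eq_cint do under eq_cint do rewrite inner.
pose Q (w2 : Omega) := cint (N e) setT (fun y => (gkernel e (Tt w2) y)%:C * ((ind y)%:C * S (y, w2))).
have bQ : cbmeas Q.
  apply: (@cbmeas_cint _ _ _ _ _ (N e) (fun p : Omega * R =>
    (gkernel e (Tt p.1) p.2)%:C * ((ind p.2)%:C * S (p.2, p.1)))).
  apply: cbmeasM.
    apply: (@cbmeas_real _ _ _ _ 1) => [|p].
      by apply: measurable_gkernel => //; exact: measurableT_comp.
    exact: gkernel_le1.
  apply: cbmeasM; first exact: (cbmeas_comp (@measurable_snd _ _ _ _) cbmeas_ind).
  by apply: (cbmeas_comp (h := fun p : Omega * R => (p.2, p.1)) _ bS); exact: measurable_fun_pair.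
rewrite -cint_real -(cintZl P _ bQ); apply: eq_cint => w2 _.
rewrite /Q gauss_inversion// -cint_real; apply: eq_cint => y _.
by rewrite /S cint_real -!rmorphM.
Qed.

Hypotheses (L0 : 0 <= L) (lip : forall x y, `|phi x - phi y| <= L * `|x - y|).

Let smoothed_test_approx e u : 0 < e ->
  `|smoothed_test e u - phi u| <= L * (Num.sqrt 2 * Num.sqrt (rho ^+ 2 * e)).
Proof.
move=> /e'_gt0 e0; rewrite -[leRHS]add0r.
apply: (@normal_approx _ u _ 0 L (phi u) K) => //; first by rewrite sqrtr_gt0.
by move=> x; rewrite add0r.
Qed.

(** Two errors are separated: replacing [smoothed_test] by [phi] costs [O (sqrt e)] uniformly, by
    the Lipschitz bound, and the remaining average in [y] is an approximate identity at [T_t] for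
    each [w2]. *)
Lemma spectral_limit :
  (\forall w2 \ae P, 0 < Tt w2 /\
    \int[P]_w1 phi (U (y, (w1, w2))) @[y --> Tt w2] --> \int[P]_w1 phi (U (Tt w2, (w1, w2)))) ->
  ccvg 0^'+ (fun e => cint leb setT (fun z => (phi z)%:C *
    ((((2 * pi) ^+ 2 * `|rho|)^-1 * gauss_mass e ^+ 3)%:C * spectral_integral e z)))
    (\int[P]_w2 \int[P]_w1 phi (U (Tt w2, (w1, w2))))%:C.
Proof.
move=> cont; apply: ccvg_at_right0 => e_ e0 ecv.
under [X in ccvg _ X]eq_fun do rewrite spectral_test//.
split; last exact: cvg_cst.
have mavg (f : R -> R) : measurable_fun setT f -> (forall x, `|f x| <= K) ->
    measurable_fun setT (fun p : Omega * R => ind p.2 * \int[P]_w1 f (U (p.2, (w1, p.1)))).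
  move=> mf fK; apply: measurable_funM; first exact: measurableT_comp.
  apply: (@measurable_parameter_integral _ _ _ _ _ P (fun q : Omega * R * Omega => f (U (q.1.2, (q.2, q.1.1)))) K) => //.
  apply: (measurableT_comp mf); apply: (measurableT_comp mU).
  apply: measurable_fun_pair; first exact: measurableT_comp.
  by apply: measurable_fun_pair => //; exact: measurableT_comp.
have mfU (f : R -> R) y w2 : measurable_fun setT f ->
    measurable_fun setT (fun w1 => f (U (y, (w1, w2)))).
  move=> mf; apply: (measurableT_comp mf); apply: (measurableT_comp mU).
  by apply: measurable_fun_pair => //; exact: measurable_fun_pair.
have bavg (f : R -> R) y w2 c : measurable_fun setT f -> (forall x, `|f x| <= c) ->
    `|ind y * \int[P]_w1 f (U (y, (w1, w2)))| <= c.
  move=> mf fc; rewrite normrM -[leRHS]mul1r; apply: ler_pM => //.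
  exact: (Rintegral_le_prob P (mfU _ _ _ mf)).
have gauss_le c e y x : 0 < e -> `|x| <= c -> `|gauss e y * x| <= c.
  move=> e'0 xc; rewrite normrM -[leRHS]mul1r; apply: ler_pM => //.
  by rewrite ger0_norm ?gauss_ge0// gauss_le1// ltW.
have ms n := measurable_smoothed_test (e0 n).
have bs n := @smoothed_test_bound (e_ n).
apply: (@bounded_dct _ _ _ P (fun n w2 => \int[normal_prob (Tt w2) (Num.sqrt (e_ n))]_y
    (gauss (e_ n) y * (ind y * \int[P]_w1 smoothed_test (e_ n) (U (y, (w1, w2))))))
    (fun w2 => \int[P]_w1 phi (U (Tt w2, (w1, w2)))) K).
- by move=> n; exact: (measurable_gauss_average (e0 n) mT (mavg _ (ms n) (bs n)) (M := K) (fun p => bavg _ _ _ _ (ms n) (bs n))).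
- apply: (@measurable_parameter_integral _ _ _ _ _ P (fun q : Omega * Omega => phi (U (Tt q.1, (q.2, q.1)))) K) => //.
  apply: (measurableT_comp mphi); apply: (measurableT_comp mU).
  apply: measurable_fun_pair; first exact: measurableT_comp.
  exact: measurable_fun_pair.
- move=> n w2; apply: (Rintegral_le_prob (normal_prob _ _)) => [|y].
    apply: measurable_funM; first exact: measurable_gauss.
    exact: (measurableT_comp (mavg _ (ms n) (bs n)) (pair1_measurable w2)).
  by apply: gauss_le => //; exact: bavg.
apply: filterS cont => w2 [T0 cvgT].
pose Psi y : R := ind y * \int[P]_w1 phi (U (y, (w1, w2))).
have mPsi : measurable_fun setT Psi by exact: (measurableT_comp (mavg _ mphi phiK) (pair1_measurable w2)).
have PsiT : Psi (Tt w2) = \int[P]_w1 phi (U (Tt w2, (w1, w2))).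
  by rewrite /Psi /ind indicE mem_set ?mul1r//= in_itv/= andbT ltW.
(* Here [T_t > 0] is used: the indicator of [y >= 0] is constant near [T_t]. *)
have cPsi : Psi y @[y --> Tt w2] --> Psi (Tt w2).
  rewrite PsiT; apply: cvg_trans cvgT; apply: near_eq_cvg.
  near=> y; rewrite /Psi /ind indicE mem_set ?mul1r//= in_itv/= andbT ltW//.
  by near: y; exact: lt_nbhsr.
have lim1 := approximate_identity mPsi (fun y => bavg _ y w2 _ mphi phiK) cPsi e0 ecv.
rewrite PsiT in lim1.
have del0 : L * (Num.sqrt 2 * Num.sqrt (rho ^+ 2 * e_ n)) @[n --> \oo] --> (0 : R).
  rewrite -[X in _ --> X](mulr0 L); apply: cvgM; first exact: cvg_cst.
  rewrite -[X in _ --> X](mulr0 (Num.sqrt 2)); apply: cvgM; first exact: cvg_cst.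
  rewrite -[X in _ --> X](sqrtr0 R); apply: (continuous_cvg _ (@sqrt_continuous R _)).
  by rewrite -[X in _ --> X](mulr0 (rho ^+ 2)); apply: cvgM; [exact: cvg_cst|exact: ecv].
have diff n : `|\int[normal_prob (Tt w2) (Num.sqrt (e_ n))]_y
      (gauss (e_ n) y * (ind y * \int[P]_w1 smoothed_test (e_ n) (U (y, (w1, w2))))) -
    \int[normal_prob (Tt w2) (Num.sqrt (e_ n))]_y (gauss (e_ n) y * Psi y)| <=
    L * (Num.sqrt 2 * Num.sqrt (rho ^+ 2 * e_ n)).
  have m1 : measurable_fun setT (fun y => gauss (e_ n) y *
      (ind y * \int[P]_w1 smoothed_test (e_ n) (U (y, (w1, w2))))).
    apply: measurable_funM; first exact: measurable_gauss.
    exact: (measurableT_comp (mavg _ (ms n) (bs n)) (pair1_measurable w2)).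
  have m2 : measurable_fun setT (fun y => gauss (e_ n) y * Psi y).
    by apply: measurable_funM => //; exact: measurable_gauss.
  have b1 y : `|gauss (e_ n) y *
      (ind y * \int[P]_w1 smoothed_test (e_ n) (U (y, (w1, w2))))| <= K.
    by apply: gauss_le => //; exact: bavg.
  have b2 y : `|gauss (e_ n) y * Psi y| <= K by apply: gauss_le => //; exact: bavg.
  have i1 := bounded_integrable (normal_prob (Tt w2) (Num.sqrt (e_ n))) m1 b1.
  have i2 := bounded_integrable (normal_prob (Tt w2) (Num.sqrt (e_ n))) m2 b2.
  rewrite -RintegralB//; apply: (Rintegral_le_prob (normal_prob _ _)) => [|y].
    exact: measurable_funB.
  rewrite -mulrBr; apply: gauss_le => //; rewrite /Psi -mulrBr.
  rewrite -RintegralB//; last 2 first.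
  - by apply: (bounded_integrable P (mfU _ _ _ (ms n))) => w; exact: bs.
  - by apply: (bounded_integrable P (mfU _ _ _ mphi)) => w; exact: phiK.
  apply: (bavg (fun u => smoothed_test (e_ n) u - phi u)); first exact: measurable_funB.
  by move=> u; exact: smoothed_test_approx.
apply/cvgrPdist_le => eps eps0.
have eps2 : 0 < eps / 2 by rewrite divr_gt0.
move/cvgrPdist_le: lim1 => /(_ _ eps2) l1; move/cvgrPdist_le: del0 => /(_ _ eps2) l2.
apply: filterS2 l1 l2 => n; rewrite sub0r normrN => h1 h2.
have h3 := le_trans (diff n) (le_trans (ler_norm _) h2).
rewrite [eps]splitr -(subrK (\int[normal_prob (Tt w2) (Num.sqrt (e_ n))]_y (gauss (e_ n) y * Psi y))
  (\int[P]_w1 phi (U (Tt w2, (w1, w2))))) -addrA (le_trans (ler_normD _ _))//.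
by apply: lerD; [exact: h1|rewrite distrC; exact: h3].
Unshelve. all: by end_near. Qed.

End Smoothing.

(** * The time-changed process *)

Section SubordinatedDensity.
Context {R : realType} d (Omega : measurableType d) (P : probability Omega R).
Variables (F : R -> set (set Omega)) (B W J v T : R -> {RV P >-> R}).
Variables (mu sigma : R -> R -> R) (rho t : R).
Notation leb := (@lebesgue_measure R).
Hypotheses (uF : usual_filtration P F) (bB : brownian F B) (bW : brownian F W).
Hypothesis iBW : indep_sigma P (sigma_proc B `[0, +oo[) (sigma_proc W `[0, +oo[).
Hypotheses (lJ : levy F J) (mJ : nondecreasing_paths J).
Hypothesis iJBW : indep_sigma P (sigma_proc J `[0, +oo[) (sigma_proc2 B W `[0, +oo[).
Hypothesis sol : strong_solution F B mu sigma v T.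
Hypothesis v0 : \forall w \ae P, forall s, 0 <= s -> 0 <= v s w.
Hypotheses (rho1 : -1 <= rho <= 1) (rho0 : rho != 0) (t0 : 0 < t).

Let Z s w := rho * B s w + Num.sqrt (1 - rho ^+ 2) * W s w.

Let GJ := completion P (sigma_proc J `[0, +oo[).
Let GBW := completion P (sigma_proc2 B W `[0, +oo[).

Let sigmaJ : sigma_algebra setT (sigma_proc J `[0, +oo[).
Proof. exact: smallest_sigma_algebra. Qed.

Let sigmaBW : sigma_algebra setT (sigma_proc2 B W `[0, +oo[).
Proof. exact: smallest_sigma_algebra. Qed.

Let itv0 (s : R) : 0 <= s -> [set` `[0, +oo[] s.
Proof. by move=> s0; rewrite /= in_itv/= s0. Qed.

Let versionJ : exists2 Y : R * g_sigma_algebraType GJ -> R, measurable_fun setT Y &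
  \forall w \ae P, forall s, 0 <= s -> Y (s, w) = J s w.
Proof.
have [_ _ _ _ cJ] := lJ.
apply: joint_version.
- exact: sigma_algebra_completion sigmaJ.
- by move=> A; exact: (completion_negligible uF sigmaJ).
- move=> s C s0 mC; apply: sub_completion; first exact: sigma_proc_measurable.
  by apply: sigma_proc_preimage => //; exact: itv0.
- by apply: filterS cJ => w [].
Qed.

Let versionBW (X : R -> {RV P >-> R}) :
  sigma_proc X `[0, +oo[ `<=` sigma_proc2 B W `[0, +oo[ -> continuous_paths P X ->
  exists2 Y : R * g_sigma_algebraType GBW -> R, measurable_fun setT Y &
    \forall w \ae P, forall s, 0 <= s -> Y (s, w) = X s w.
Proof.
move=> sX cX; apply: joint_version.
- exact: sigma_algebra_completion sigmaBW.
- by move=> A; exact: (completion_negligible uF sigmaBW).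
- move=> s C s0 mC; apply: sub_completion; first exact: sigma_proc2_measurable.
  by apply: sX; apply: sigma_proc_preimage => //; exact: itv0.
- exact: right_continuous_paths.
Qed.

Let subB : sigma_proc B `[0, +oo[ `<=` sigma_proc2 B W `[0, +oo[.
Proof. by move=> A sA; apply: sub_sigma_algebra; left. Qed.

Let subW : sigma_proc W `[0, +oo[ `<=` sigma_proc2 B W `[0, +oo[.
Proof. by move=> A sA; apply: sub_sigma_algebra; right. Qed.

Let measurable_T : measurable_fun setT (T t : g_sigma_algebraType GBW -> R).
Proof.
have [[_ aT] _ _ _ _] := sol.
apply: measurable_sigma_fun => [|C mC]; first exact: sigma_algebra_completion sigmaBW.
apply: (completion_mono subB); apply: (@natural_filtration_completion _ _ _ _ _ t); last first.
  by apply: aT => //; exact: ltW.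
by rewrite -[X in measurable X]setTI; exact: measurable_funPT.
Qed.

Let J_ge0 : \forall w \ae P, forall s, 0 <= s -> 0 <= J s w.
Proof.
have [J0 _ _ _ _] := lJ.
by apply: filterS2 J0 mJ => w J0w mJw s s0; rewrite -J0w; exact: mJw.
Qed.

Section Versions.
Variables (J0 : R * g_sigma_algebraType GJ -> R) (B0 W0 : R * g_sigma_algebraType GBW -> R).
Hypotheses (mJ0 : measurable_fun setT J0) (mB0 : measurable_fun setT B0)
  (mW0 : measurable_fun setT W0).
Hypothesis eJ : nbhs (almost_everywhere P) [set w : Omega | forall s, 0 <= s -> J0 (s, w) = J s w].
Hypothesis eB : nbhs (almost_everywhere P) [set w : Omega | forall s, 0 <= s -> B0 (s, w) = B s w].
Hypothesis eW : nbhs (almost_everywhere P) [set w : Omega | forall s, 0 <= s -> W0 (s, w) = W s w].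

Let Z0 (p : R * g_sigma_algebraType GBW) : R :=
  rho * B0 p + Num.sqrt (1 - rho ^+ 2) * W0 p.

Let mZ0 : measurable_fun setT Z0.
Proof. by apply: measurable_funD; exact: measurable_funM. Qed.

Let forget (G : set (set Omega)) (f : R * g_sigma_algebraType (completion P G) -> R) :
  measurable_fun setT f -> measurable_fun setT (fun p : R * Omega => f (p.1, p.2)).
Proof.
move=> mf; apply: (measurableT_comp mf); apply: measurable_fun_pair => //.
have Gm : completion P G `<=` d.-measurable by exact: completion_measurable.
exact: (measurableT_comp (measurable_to_sigma Gm) (@measurable_snd _ _ _ _)).
Qed.

Let U (p : R * (Omega * Omega)) : R := Z0 (J0 (p.1, p.2.1), p.2.2).

Let mU : measurable_fun setT U.
Proof.
apply: (measurableT_comp (forget mZ0) (g := fun p : R * (Omega * Omega) => (J0 (p.1, p.2.1), p.2.2))).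
apply: measurable_fun_pair; last exact: measurableT_comp.
apply: (measurableT_comp (forget mJ0) (g := fun p : R * (Omega * Omega) => (p.1, p.2.1))).
by apply: measurable_fun_pair => //; exact: measurableT_comp.
Qed.

Let mTt : measurable_fun setT (T t). Proof. exact: measurable_funPT. Qed.

Let bphase xi eta y z : cbmeas (fun p : R * Omega =>
  expi (xi * (y - T t p.2)) * expi (eta * ((z - Z0 (p.1, p.2)) / rho))).
Proof.
apply: cbmeasM; apply: cbmeas_expi; apply: measurable_funM => //.
  by apply: measurable_funB => //; exact: measurableT_comp.
apply: measurable_funM => //; apply: measurable_funB => //; exact: forget.
Qed.

(** [fhat_correlated] replaces [B_j] by [Z_j] at each fixed [j], as an expectation over [w2];
    integrating [j] against the law of [J_y] is then an expectation over an independent [w1]. *)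
Let inner xi eta y z : 0 <= y ->
  cint (distribution P (J y)) `[0, +oo[ (fun j =>
      fhat (T t) (B j) xi eta *
      cexp ((- ((1 - rho ^+ 2) * eta ^+ 2 * j / (2 * rho ^+ 2))) +i* (eta * z / rho)) *
      cexp (0 +i* (xi * y))) =
  cint P setT (fun w1 => cint P setT (fun w2 =>
    expi (xi * (y - T t w2)) * expi (eta * ((z - U (y, (w1, w2))) / rho)))).
Proof.
move=> y0.
(* The indicator confines [j] to the times where the versions describe the processes; it disappears
   again because [J_y >= 0] almost surely. *)
pose Q j : R[i] := (\1_[set` `[0, +oo[] j)%:C * cint P setT (fun w2 =>
  expi (xi * (y - T t w2)) * expi (eta * ((z - Z0 (j, w2)) / rho))).
have bQ : cbmeas Q.
  apply: cbmeasM; last exact: (@cbmeas_cint _ _ _ _ _ P _ (bphase xi eta y z)).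
  exact: cbmeas_indic (measurable_itv _).
transitivity (cint (distribution P (J y)) setT Q).
  rewrite cint_mkcond; apply: eq_cint => j _; rewrite /Q.
  have [j0|j0] := leP 0 j; last first.
    by rewrite indicE memNset ?mul0r// => /=; rewrite in_itv/= andbT leNgt j0.
  congr (_ * _); rewrite cexp_real_expi -expiE mulrA (fhat_correlated bW iBW sol rho1 rho0 _ _ (ltW t0) j0).
  rewrite -mulrA -expiD -(cintZr P); last first.
    apply: cbmeas_expi; apply: measurable_funB.
      by apply: measurableT_comp => //; exact: measurable_funM.
    by apply: measurable_funM => //; apply: measurable_funD; apply: measurable_funM.
  apply: (@cint_ae_eq _ _ Omega P); apply: filterS2 eB eW => w eBw eWw.
  rewrite -!expiD /Z0 eBw// eWw//; congr expi.
  by field.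
rewrite (cint_distribution P (J y) bQ).
apply: (@cint_ae_eq _ _ Omega P); apply: filterS2 eJ J_ge0 => w1 eJw Jw.
rewrite /Q indicE mem_set ?mul1r; last exact/itv0/Jw.
by apply: eq_cint => w2 _; rewrite /U /= eJw.
Qed.

Let density_rhsE e z : 0 < e ->
  density_rhs rho (T t) B J e z =
  (((2 * pi) ^+ 2 * `|rho|)^-1 * gauss_mass e ^+ 3)%:C * spectral_integral P (T t) U rho e z.
Proof.
move=> e0.
pose H (p : R * R * R) : R[i] := (\1_[set` `[0, +oo[] p.2)%:C *
  cint P setT (fun w1 => cint P setT (fun w2 =>
    expi (p.1.1 * (p.2 - T t w2)) * expi (p.1.2 * ((z - U (p.2, (w1, w2))) / rho)))).
have bH : cbmeas H.
  apply: cbmeasM.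
    exact: (cbmeas_comp (@measurable_snd _ _ _ _) (cbmeas_indic (measurable_itv _))).
  apply: (@cbmeas_cint _ _ _ _ _ P (fun p : R * R * R * Omega => cint P setT (fun w2 =>
    expi (p.1.1.1 * (p.1.2 - T t w2)) * expi (p.1.1.2 * ((z - U (p.1.2, (p.2, w2))) / rho))))).
  apply: (@cbmeas_cint _ _ _ _ _ P (fun p : R * R * R * Omega * Omega =>
    expi (p.1.1.1.1 * (p.1.1.2 - T t p.2)) *
    expi (p.1.1.1.2 * ((z - U (p.1.1.2, (p.1.2, p.2))) / rho)))).
  have m11 : measurable_fun setT (fun p : R * R * R * Omega * Omega => p.1.1).
    exact: measurableT_comp.
  have m112 : measurable_fun setT (fun p : R * R * R * Omega * Omega => p.1.1.2).
    exact: (measurableT_comp (@measurable_snd _ _ _ _) m11).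
  have m111 : measurable_fun setT (fun p : R * R * R * Omega * Omega => p.1.1.1).
    exact: (measurableT_comp (@measurable_fst _ _ _ _) m11).
  have mUU : measurable_fun setT (fun p : R * R * R * Omega * Omega => U (p.1.1.2, (p.1.2, p.2))).
    apply: (measurableT_comp mU); apply: measurable_fun_pair => //.
    by apply: measurable_fun_pair => //; exact: measurableT_comp.
  apply: cbmeasM; apply: cbmeas_expi; apply: measurable_funM.
  - exact: (measurableT_comp (@measurable_fst _ _ _ _) m111).
  - by apply: measurable_funB => //; exact: measurableT_comp.
  - exact: (measurableT_comp (@measurable_snd _ _ _ _) m111).
  - by apply: measurable_funM => //; exact: measurable_funB.
have key : cint leb setT (fun xi => cint leb setT (fun eta => cint leb `[0, +oo[ (fun y =>
    (gauss e xi * gauss e eta * gauss e y)%:C *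
    cint (distribution P (J y)) `[0, +oo[ (fun j =>
      fhat (T t) (B j) xi eta *
      cexp ((- ((1 - rho ^+ 2) * eta ^+ 2 * j / (2 * rho ^+ 2)))
              +i* (eta * z / rho)) *
      cexp (0 +i* (xi * y)))))) =
    (gauss_mass e ^+ 3)%:C * spectral_integral P (T t) U rho e z.
  rewrite /spectral_integral -(cint_gauss3 e0 bH).
  apply: eq_cint => xi _; apply: eq_cint => eta _; rewrite cint_mkcond.
  apply: eq_cint => y _; rewrite /H /= mulrCA; congr (_ * _).
  have [y0|y0] := leP 0 y; first by rewrite inner.
  by rewrite indicE memNset ?mul0r// => /=; rewrite in_itv/= andbT leNgt y0.
by rewrite /density_rhs key mulrA -rmorphM.
Qed.

Variable phi : R -> R.
Hypothesis tphi : test_fun phi.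

Let mphi : measurable_fun setT phi.
Proof. exact: smooth_measurable (test_fun_smooth tphi). Qed.

Let mphiU y w2 : measurable_fun setT (fun w1 => phi (U (y, (w1, w2)))).
Proof.
apply: (measurableT_comp mphi); apply: (measurableT_comp mU).
by apply: measurable_fun_pair => //; exact: measurable_fun_pair.
Qed.

Let cphi : continuous phi.
Proof. by move=> x; exact: smooth_continuous (test_fun_smooth tphi) x. Qed.

(** The limit [b] will be a value of [J] and may be 0, where the paths of [B] and [W] are continuous
    only within the half line. *)
Let path_cvg (f : R -> R) (b_ : nat -> R) (b : R) : {within `[0, +oo[, continuous f} ->
  0 <= b -> b_ n @[n --> \oo] --> b -> (\forall n \near \oo, 0 <= b_ n) ->
  f (b_ n) @[n --> \oo] --> f b.
Proof.
move=> /subspace_continuousP/(_ b) cf b0 cb nb.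
apply: (cvg_trans _ (cf (itv0 b0))) => S /= nS.
have h : \forall n \near \oo, [set` `[0, +oo[] (b_ n) -> S (f (b_ n)) by exact: (cb _ nS).
by apply: filterS2 h nb => n h1 h2; apply: h1; exact: itv0.
Qed.

(** With [w2] fixed, [T_t] is a deterministic positive time for the path of [J] taken at [w1], so
    the absence of fixed jumps applies to it for almost every [w1]; the paths of [B] and [W] at [w2]
    then carry the convergence over to [Z]. *)
Let mean_continuous : \forall w2 \ae P, 0 < T t w2 /\
  \int[P]_w1 phi (U (y, (w1, w2))) @[y --> T t w2] --> \int[P]_w1 phi (U (T t w2, (w1, w2))).
Proof.
have [K hK] := test_fun_bounded tphi.
have [_ _ _ _ cB] := bB; have [_ _ _ _ cW] := bW.
have cBW : \forall w \ae P, {within `[0, +oo[, continuous (fun s => B s w)} /\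
    {within `[0, +oo[, continuous (fun s => W s w)} by apply: filterS2 cB cW.
have eBW : \forall w \ae P, (forall s, 0 <= s -> B0 (s, (w : Omega)) = B s w) /\
    (forall s, 0 <= s -> W0 (s, (w : Omega)) = W s w) by apply: filterS2 eB eW.
apply: filterS3 (T_gt0 uF sol v0 t0) cBW eBW => w2 T0 [cBw cWw] [eBw eWw].
split => //; apply/(@cvg_nbhsP _ R^o) => y_ cy.
have y_ge0 : \forall n \near \oo, 0 <= y_ n.
  have h : \forall n \near \oo, 0 < y_ n by exact: (cy _ (lt_nbhsr T0)).
  by apply: filterS h => n /ltW.
apply: (@bounded_dct _ _ _ P (fun n w1 => phi (U (y_ n, (w1, w2))))
  (fun w1 => phi (U (T t w2, (w1, w2)))) K).
- by move=> n; exact: mphiU.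
- exact: mphiU.
- by move=> n w1; exact: hK.
have eJ0 : \forall w \ae P, (forall s, 0 <= s -> J0 (s, (w : Omega)) = J s w) /\
    (forall s, 0 <= s -> 0 <= J s w) by apply: filterS2 eJ J_ge0.
apply: filterS2 (levy_no_fixed_jump lJ mJ T0) eJ0 => w1 cJw [eJw Jw].
apply: continuous_cvg; first exact: cphi.
have cJy : J (y_ n) w1 @[n --> \oo] --> J (T t w2) w1 by apply: (cvg_comp _ _ cy cJw).
have Jy0 : \forall n \near \oo, 0 <= J (y_ n) w1 by apply: filterS y_ge0 => n; exact: Jw.
have JT0 := Jw _ (ltW T0).
have lim : Z (J (y_ n) w1) w2 @[n --> \oo] --> Z (J (T t w2) w1) w2.
  have cB' := path_cvg cBw JT0 cJy Jy0; have cW' := path_cvg cWw JT0 cJy Jy0.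
  by apply: cvgD; apply: cvgM; first [exact: cvg_cst|exact: cB'|exact: cW'].
rewrite /U /Z0 /= eJw ?ltW// eBw// eWw//.
apply: cvg_trans lim; apply: near_eq_cvg.
by apply: filterS2 y_ge0 Jy0 => n yn Jn; rewrite eJw// eBw// eWw.
Qed.

(** Return from two copies of [Omega] to one: the version of [J] is measurable for the completion
    [GJ], while [T_t] and the versions of [B] and [W] are so for [GBW], and these completions are
    independent. *)
Let mean_subordinated :
  \int[P]_w2 \int[P]_w1 phi (U (T t w2, (w1, w2))) = \int[P]_w phi (Z (J (T t w) w) w).
Proof.
have [K hK] := test_fun_bounded tphi.
pose f (p : g_sigma_algebraType GJ * g_sigma_algebraType GBW) : R[i] :=
  (phi (Z0 (J0 (T t p.2, p.1), p.2)))%:C.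
have bf : cbmeas f.
  apply: (@cbmeas_real _ _ _ _ K) => //; apply: (measurableT_comp mphi).
  apply: (measurableT_comp mZ0); apply: measurable_fun_pair => //.
  apply: (measurableT_comp mJ0); apply: measurable_fun_pair => //.
  exact: (measurableT_comp measurable_T (@measurable_snd _ _ _ _)).
have bf' : cbmeas (fun p : Omega * Omega => (phi (U (T t p.2, p)))%:C).
  apply: (@cbmeas_real _ _ _ _ K) => //; apply: (measurableT_comp mphi).
  apply: (measurableT_comp mU); apply: measurable_fun_pair => //; exact: measurableT_comp.
have ind : indep_sigma P GJ GBW.
  apply: indep_completion iJBW; [exact: sigma_proc_measurable|exact: sigma_proc2_measurable].
have := indep_sigma_cint (sigma_algebra_completion P sigmaJ) (sigma_algebra_completion P sigmaBW)
  (@completion_measurable _ _ _ P _) (@completion_measurable _ _ _ P _) ind bf.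
have -> : cint P setT (fun w1 : Omega => cint P setT (fun w2 : Omega => f (w1, w2))) =
    cint P setT (fun w1 => cint P setT (fun w2 => (phi (U (T t w2, (w1, w2))))%:C)) by [].
rewrite (cint_swap P P bf') => h.
have e1 : cint P setT (fun w2 => cint P setT (fun w1 => (phi (U (T t w2, (w1, w2))))%:C)) =
    (\int[P]_w2 \int[P]_w1 phi (U (T t w2, (w1, w2))))%:C.
  by rewrite -cint_real; apply: eq_cint => w2 _; rewrite cint_real.
have e2 : cint P setT (fun w : Omega => f (w, w)) = (\int[P]_w phi (Z (J (T t w) w) w))%:C.
  rewrite -cint_real; apply: (@cint_ae_eq _ _ Omega P).
  have eBW : \forall w \ae P, (forall s, 0 <= s -> B0 (s, (w : Omega)) = B s w) /\
      (forall s, 0 <= s -> W0 (s, (w : Omega)) = W s w) by apply: filterS2 eB eW.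
  have eJ0 : \forall w \ae P, (forall s, 0 <= s -> J0 (s, (w : Omega)) = J s w) /\
      (forall s, 0 <= s -> 0 <= J s w) by apply: filterS2 eJ J_ge0.
  apply: filterS3 (T_gt0 uF sol v0 t0) eBW eJ0 => w T0 [eBw eWw] [eJw Jw].
  have JT0 := Jw _ (ltW T0).
  by rewrite /f /Z0 /Z /= eJw ?ltW// eBw// eWw.
by move: h; rewrite e1 => /(etrans (esym e2)) -[->].
Qed.

Lemma density_versions :
  ccvg 0^'+ (fun e => cint leb setT (fun z => (phi z)%:C * density_rhs rho (T t) B J e z))
    (\int[P]_w phi (Z (J (T t w) w) w))%:C.
Proof.
have [K hK] := test_fun_bounded tphi; have [_ [Kc hKc]] := tphi.
have [L L0 lip] := test_fun_lipschitz tphi.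
rewrite -mean_subordinated; apply: ccvg_at_right0 => e_ e0 ecv.
have E n : cint leb setT (fun z => (phi z)%:C * density_rhs rho (T t) B J (e_ n) z) =
    cint leb setT (fun z => (phi z)%:C * ((((2 * pi) ^+ 2 * `|rho|)^-1 * gauss_mass (e_ n) ^+ 3)%:C *
      spectral_integral P (T t) U rho (e_ n) z)).
  by apply: eq_cint => z _; rewrite density_rhsE.
under [X in ccvg _ X]eq_fun do rewrite E.
have [/cvg_at_rightP c1 /cvg_at_rightP c2] :=
  spectral_limit mTt mU rho0 mphi hK hKc L0 lip mean_continuous.
by split; [apply: c1|apply: c2].
Qed.

End Versions.

Lemma subordinated_density :
  gdensity_eq P (fun w => Z (J (T t w) w) w) (density_rhs rho (T t) B J).
Proof.
move=> phi tphi.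
have [_ _ _ _ cB] := bB; have [_ _ _ _ cW] := bW.
have [J0 mJ0 eJ] := versionJ.
have [B0 mB0 eB] := versionBW subB cB; have [W0 mW0 eW] := versionBW subW cW.
exact: (density_versions mJ0 mB0 mW0 eJ eB eW tphi).
Qed.

End SubordinatedDensity.

Theorem theorem5p4 (R : realType) (d : measure_display)
  (Omega : measurableType d) (P : probability Omega R)
  (F : R -> set (set Omega)) (B W J v T : R -> {RV P >-> R})
  (mu sigma : R -> R -> R) (rho t : R)
  (Phi : R -> R -> R -> R -> R -> R[i])
  (q : R -> probability (R * R * R)%type R)
  (qhat : R -> R -> R -> @cmeasure R) :
  usual_filtration P F ->
  brownian F B -> brownian F W ->
  indep_sigma P (sigma_proc B `[0, +oo[) (sigma_proc W `[0, +oo[) ->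
  levy F J -> nondecreasing_paths J ->
  indep_sigma P (sigma_proc J `[0, +oo[) (sigma_proc2 B W `[0, +oo[) ->
  measurable_fun [set p : R * R | 0 <= p.1] (fun p => mu p.1 p.2) ->
  measurable_fun [set p : R * R | 0 <= p.1] (fun p => sigma p.1 p.2) ->
  unique_strong_solution F B mu sigma v T ->
  (\forall w \ae P, forall s, 0 <= s -> 0 <= v s w) ->
  (forall s, 0 <= s -> (\int[P]_w (T s w)%:E = s%:E)%E) ->
  (\forall w \ae P, T s w @[s --> +oo] --> +oo) ->
  char_exponent F v T Phi ->
  law_flow v T B q -> fp_unique_solution mu sigma q ->
  fphat_unique_solution mu sigma qhat ->
  -1 <= rho <= 1 -> rho != 0 -> 0 < t ->
  let Z s w := rho * B s w + Num.sqrt (1 - rho ^+ 2) * W s w in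
  gdensity_eq P (fun w => Z (J (T t w) w) w) (density_rhs rho (T t) B J) /\
  (forall j xi eta, t <= j ->
     fhat (T t) (B j) xi eta =
     (expR (- ((j - t) * eta ^+ 2 / 2)))%:C *
     cm_int (qhat t xi eta) (fun=> 1)) /\
  (forall j xi eta, 0 <= j -> j <= t ->
     ccvg 0^'+ (fhat_late_rhs Phi qhat t j xi eta) (fhat (T t) (B j) xi eta)).
Proof.
move=> uF bB bW iBW lJ mJ iJBW mmu msigma [sol _] v0 _ _ cPhi flow [fps _] uq rho1 rho0 t0 Z.
have [_ aB _ _ _] := bB.
split; first exact: (subordinated_density uF bB bW iBW lJ mJ iJBW sol v0 rho1 rho0 t0).
split=> [j xi eta tj|j xi eta j0 jt].
  exact: (fhat_early uF bB mmu msigma sol flow fps uq xi eta (ltW t0) tj).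
apply: (fhat_late aB cPhi) => // zeta f bf.
exact: (qhat_law uF bB mmu msigma sol flow fps uq zeta eta j0 bf).
Qed.
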